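(* There exist absolute constants $C_0\in(0,43)$, $C>1$, $c>0$ such that the following holds. Consider the SSBM in the context with $\eta\in[0,1/2)$, $k\ge2$, $n\ge10$ and $\sqrt\rho>1-\frac{1}{4k(2+\sqrt k)}$. Let $\xi>0$ and $\delta\in\left(0,\sqrt{\frac{1}{12(16+8\xi)(k-1)}}\right)$. (Dense case) Suppose $p>\left(\frac{2C_0k}{\delta(1-2\eta)}\right)^2\frac{\ln n}{n}$ and set $V=V_{k-1}(\overline{L_{sym}})$; then with probability at least $1-\frac2n-n\exp(-\frac{np}{c})$ there exists an orthogonal $O\in\mathbb R^{(k-1)\times(k-1)}$ with $\|V-\Theta R_{k-1}O\|\le2\delta$ such that, for every $(1+\xi)$-approximate solution $(\tilde\Theta,\tilde R_{k-1})\in\mathbb M_{n,k}\times\mathbb R^{k\times(k-1)}$ of the $k$-means problem $\min_{\Theta'\in\mathbb M_{n,k},R\in\mathbb R^{k\times(k-1)}}\|\Theta'R-V\|_F^2$, setting $S_i=\{j\in C_i:\|(\tilde\Theta\tilde R_{k-1})_{j*}-(\Theta R_{k-1}O)_{j*}\|^2\ge\frac{2}{3n_i}\}$ and $\tilde V=\bigcup_{i=1}^kC_i\setminus S_i$, there is a permutation matrix $\pi\in\mathbb R^{k\times k}$ with $\tilde\Theta_{\tilde V*}=\hat\Theta_{\tilde V*}\pi$ and $$\sum_{i=1}^k\frac{|S_i|}{n_i}\le96(2+\xi)(k-1)\delta^2.$$ In particular the set of mis-clustered nodes is a subset of $\bigcup_iS_i$. (Sparse case) The same conclusion holds with $V=V_{k-1}(L_\gamma)$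 and probability at least $1-7e^{-2r}-\frac2n-ne^{-np/c}$, if instead $r\ge1$, $p>\left(\frac{2k(128Cr^2+1)}{\delta(1-2\eta)}\right)^8\frac2n$, and $\gamma^+,\gamma^-\ge0$ with $\gamma^++\gamma^-=\bar d^{7/8}$.
   Context: SSBM: integers $n\ge2,k\ge2$, $p\in(0,1]$, $\eta\in[0,1/2)$, partition of $[n]$ into nonempty clusters $C_1,\dots,C_k$, $|C_i|=n_i$. Independently for each unordered pair $j\ne j'$, an edge is present w.p. $p$, signed $+1$ if same cluster and $-1$ otherwise, then sign flipped independently w.p. $\eta$. $A$ symmetric signed adjacency (zero diagonal), $A^\pm=\max(\pm A,0)$, $\bar D=\mathrm{diag}((A^++A^-)\mathbf1)$, $\bar d=p(n-1)$, $\overline{L_{sym}}=I-\bar D^{-1/2}A\bar D^{-1/2}$. Regularized: $A_\gamma=A+\frac{\gamma^+-\gamma^-}{n}\mathbf1\mathbf1^\top$, $\gamma=\gamma^++\gamma^-$, $\bar D_\gamma=\bar D+\gamma I$, $L_\gamma=I-\bar D_\gamma^{-1/2}A_\gamma\bar D_\gamma^{-1/2}$. $\rho=\min_in_i/\max_in_i$. $\Theta_{ji}=1/\sqrt{n_i}$ if $j\in C_i$ else 0; $\hat\Theta_{ji}=1$ if $j\in C_i$ else 0. $\mathbb M_{n,k}$: $n\times k$ 0/1 matrices with exactly one 1 per row. A $(1+\xi)$-approximate solution has cost at most $(1+\xi)$ times the minimum cost. $V_{k-1}(M)$: orthonormal eigenvectors of the $k-1$ smallest eigenvalues. $\bar\alpha=1+\frac{p}{\bar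 d}(1-2\eta)$, $\bar C=\bar\alpha I_k-\bar B$ with $\bar B_{ii}=\frac{n_ip}{\bar d}(1-2\eta)$, $\bar B_{ii'}=-\frac{\sqrt{n_in_{i'}}p}{\bar d}(1-2\eta)$ ($i\ne i'$); $R_{k-1}\in\mathbb R^{k\times(k-1)}$: orthonormal eigenvectors of the $k-1$ smallest eigenvalues of $\bar C$. $M_{j*}$ is the $j$-th row, $M_{\tilde V*}$ the rows indexed by $\tilde V$. *)

(* Defs.v *)
From HB Require Import structures.
From mathcomp Require Import all_boot all_order all_fingroup all_algebra.
From mathcomp Require Import all_classical all_reals all_analysis.
Set Implicit Arguments. Unset Strict Implicit. Unset Printing Implicit Defensive.
Import Order.TTheory GRing.Theory Num.Theory.
Local Open Scope ring_scope.
Local Open Scope classical_set_scope.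

Section SSBM.
Context {R : realType}.

(* An outcome assigns to each ordered pair (a,b) a pair of booleans
   (edge present?, sign flipped?); only pairs with a < b are random
   (independent Bernoulli(p) and Bernoulli(eta)); the other coordinates are
   fixed to (false,false). *)
Definition outcome (n : nat) := {ffun 'I_n * 'I_n -> bool * bool}.

Definition pair_weight (p eta : R) (b : bool * bool) : R :=
  (if b.1 then p else 1 - p) * (if b.2 then eta else 1 - eta).

Definition ssbm_weight n (p eta : R) (w : outcome n) : R :=
  \prod_(ab : 'I_n * 'I_n)
     (if (ab.1 < ab.2)%N then pair_weight p eta (w ab)
      else (w ab == (false, false))%:R).

Definition ssbm_prob n (p eta : R) (E : outcome n -> Prop) : R :=
  \sum_(w : outcome n) (if `[< E w >] then ssbm_weight p eta w else 0).

(* sigma j = i  means  j \in C_i *)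
Definition csize n k (sigma : 'I_n -> 'I_k) (i : 'I_k) : nat :=
  #|[set j | sigma j == i]|.

Definition nmin n k (sigma : 'I_n -> 'I_k) : nat := \big[minn/n]_(i < k) csize sigma i.
Definition nmax n k (sigma : 'I_n -> 'I_k) : nat := \big[maxn/0%N]_(i < k) csize sigma i.
Definition rho n k (sigma : 'I_n -> 'I_k) : R := (nmin sigma)%:R / (nmax sigma)%:R.

Definition entry_val n k (sigma : 'I_n -> 'I_k) (w : outcome n) (a b : 'I_n) : R :=
  if (w (a, b)).1 then
    (if sigma a == sigma b then 1 else -1) * (if (w (a, b)).2 then -1 else 1)
  else 0.

Definition adj n k (sigma : 'I_n -> 'I_k) (w : outcome n) : 'M[R]_n :=
  \matrix_(a, b) (if (a < b)%N then entry_val sigma w a b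
                  else if (b < a)%N then entry_val sigma w b a else 0).

Definition Apos n (A : 'M[R]_n) : 'M[R]_n := \matrix_(a, b) Num.max (A a b) 0.
Definition Aneg n (A : 'M[R]_n) : 'M[R]_n := \matrix_(a, b) Num.max (- A a b) 0.

Definition degs n (A : 'M[R]_n) : 'I_n -> R :=
  fun a => ((Apos A + Aneg A) *m (const_mx 1 : 'cV[R]_n)) a ord0.

Definition Dbar n (A : 'M[R]_n) : 'M[R]_n := diag_mx (\row_a degs A a).

(* M^{-1/2} for a diagonal matrix with diagonal d (MathComp: 0^-1 = 0) *)
Definition diag_invsqrt n (d : 'I_n -> R) : 'M[R]_n :=
  diag_mx (\row_a (Num.sqrt (d a))^-1).

Definition dbar (n : nat) (p : R) : R := p * (n%:R - 1).

Definition Lsym n k (sigma : 'I_n -> 'I_k) (w : outcome n) : 'M[R]_n :=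
  let A := adj sigma w in
  1%:M - diag_invsqrt (degs A) *m A *m diag_invsqrt (degs A).

Definition Lgamma n k (sigma : 'I_n -> 'I_k) (gp gm : R) (w : outcome n)
  : 'M[R]_n :=
  let A := adj sigma w in
  let Ag := A + ((gp - gm) / n%:R) *: const_mx 1 in
  let dg := fun a => degs A a + (gp + gm) in
  1%:M - diag_invsqrt dg *m Ag *m diag_invsqrt dg.

(* V consists of the first q columns of an orthonormal eigenbasis U of M,
   ordered by nondecreasing eigenvalues: M = U diag(lam) U^T. *)
Definition is_Vsmall m q (M : 'M[R]_m) (V : 'M[R]_(m, q)) : Prop :=
  (q <= m)%N /\
  exists (U : 'M[R]_m) (lam : 'I_m -> R),
    U^T *m U = 1%:M /\
    M = U *m diag_mx (\row_a lam a) *m U^T /\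
    (forall a b : 'I_m, (a <= b)%N -> lam a <= lam b) /\
    (forall (a : 'I_m) (i : 'I_q), nat_of_ord a = nat_of_ord i ->
       forall r : 'I_m, V r i = U r a).

Definition Theta n k (sigma : 'I_n -> 'I_k) : 'M[R]_(n, k) :=
  \matrix_(j, i) (if sigma j == i then (Num.sqrt (csize sigma i)%:R)^-1 else 0).

Definition Thetahat n k (sigma : 'I_n -> 'I_k) : 'M[R]_(n, k) :=
  \matrix_(j, i) (if sigma j == i then 1 else 0).

Definition alphabar (n : nat) (p eta : R) : R := 1 + p / dbar n p * (1 - 2 * eta).

Definition Bbar n k (sigma : 'I_n -> 'I_k) (p eta : R) : 'M[R]_k :=
  \matrix_(i, i')
    (if i == i' then (csize sigma i)%:R * p / dbar n p * (1 - 2 * eta)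
     else - (Num.sqrt ((csize sigma i)%:R * (csize sigma i')%:R) * p / dbar n p
             * (1 - 2 * eta))).

Definition Cbar n k (sigma : 'I_n -> 'I_k) (p eta : R) : 'M[R]_k :=
  (alphabar n p eta)%:M - Bbar sigma p eta.

Definition vnorm q (x : 'cV[R]_q) : R := Num.sqrt (\sum_i (x i ord0) ^+ 2).

Definition opnorm m q (A : 'M[R]_(m, q)) : R :=
  sup [set vnorm (A *m x) | x in [set x : 'cV[R]_q | vnorm x = 1]].

Definition frob2 m q (A : 'M[R]_(m, q)) : R := \sum_i \sum_j (A i j) ^+ 2.

Definition rownorm2 m q (A : 'M[R]_(m, q)) (j : 'I_m) : R := \sum_i (A j i) ^+ 2.

Definition is_memb n k (T : 'M[R]_(n, k)) : Prop :=
  forall j, exists i, T j i = 1 /\ forall i', i' != i -> T j i' = 0.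

Definition approx_kmeans n k q (xi : R) (V : 'M[R]_(n, q))
  (Tt : 'M[R]_(n, k)) (Rt : 'M[R]_(k, q)) : Prop :=
  is_memb Tt /\
  forall (T' : 'M[R]_(n, k)) (R' : 'M[R]_(k, q)), is_memb T' ->
    frob2 (Tt *m Rt - V) <= (1 + xi) * frob2 (T' *m R' - V).

Definition Sset n k q (sigma : 'I_n -> 'I_k) (Y : 'M[R]_(n, q)) (i : 'I_k)
  : {set 'I_n} :=
  [set j | (sigma j == i) && (2 / (3 * (csize sigma i)%:R) <= rownorm2 Y j)].

Definition recovery_event n k (sigma : 'I_n -> 'I_k) (xi delta : R)
  (Rk : 'M[R]_(k, k.-1)) (L : 'M[R]_n) : Prop :=
  forall V : 'M[R]_(n, k.-1), is_Vsmall L V ->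
  exists O : 'M[R]_(k.-1),
    O^T *m O = 1%:M /\
    opnorm (V - Theta sigma *m Rk *m O) <= 2 * delta /\
    forall (Tt : 'M[R]_(n, k)) (Rt : 'M[R]_(k, k.-1)),
      approx_kmeans xi V Tt Rt ->
      let S := Sset sigma (Tt *m Rt - Theta sigma *m Rk *m O) in
      let Vt := [set j | [exists i, (sigma j == i) && (j \notin S i)]] in
      exists s : 'S_k,
        (forall j, j \in Vt -> row j Tt = row j (Thetahat sigma) *m perm_mx s) /\
        \sum_(i < k) (#|S i|%:R / (csize sigma i)%:R)
          <= 96 * (2 + xi) * (k.-1)%:R * delta ^+ 2.

End SSBM.

(* Main.v *)
(** Since the constant [c] is at our disposal, only the regime [n p > c ln n] matters.
    There the centred signed and unsigned adjacency matrices have operator norm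
    [O(sqrt (n p))]: the expected trace of their [2m]-th power, [m ~ n p], is a sum over
    closed walks using no edge exactly once, and is dominated by the same sum for an
    ensemble of dimension [2m] with bounded entries, whose norm is controlled by a net
    of [C^m] points.  The norm of the unsigned noise bounds the l2 fluctuation of the
    degrees, so the (regularised) Laplacian is within
    [O((sqrt (n p) + gamma) / (n p))] of its population version.  The latter has
    spectral gap at least [8/5 (1 - 2 eta) / k], Davis-Kahan in operator norm together
    with a polar decomposition gives [O], and the rows of [Theta Rk O] are separated
    enough for any approximate k-means solution to recover the clusters outside the
    sets [S_i]. *)

Require Import Defs.
From HB Require Import structures.
From mathcomp Require Import all_boot all_order all_fingroup all_algebra.
From mathcomp Require Import all_classical all_reals all_analysis.
From mathcomp Require Import ring lra zify.
From mathcomp Require complex.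
Set Implicit Arguments. Unset Strict Implicit. Unset Printing Implicit Defensive.
Import Order.TTheory GRing.Theory Num.Theory.
Local Open Scope ring_scope.

(** * Euclidean norms *)

(** The statement leaves no freedom in the leading constant: [C0] must stay below 43, whereas the
    norm bound carries the huge factor [normcst]. But the dense threshold is on the scale of a
    relative perturbation sqrt(ln n / (n p)), while the moment method yields a multiple of sqrt(1 /
    (n p)). The spare sqrt(ln n) pays for [normcst] once ln n exceeds a multiple of its square, and
    the choice of [c] leaves only such n. In the sparse case [normcst] is itself the constant [C] of
    the threshold.

    The bound without logarithm requires no enumeration of walks. Walks are only compared, pattern
    by pattern, with those on 2m vertices. The number of the latter is at most the expected trace of
    a random matrix all of whose entry moments of order at least 2 are at least 1, and that trace is
    bounded through the operator norm. There the power of the trace equals the dimension, so a net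
    of exponential size costs only a constant factor after taking the root. *)

Section Euclidean.
Context {R : realType}.

Definition dot n (x y : 'cV[R]_n) : R := \sum_i x i ord0 * y i ord0.

Lemma dotE n (x y : 'cV[R]_n) : dot x y = (x^T *m y) ord0 ord0.
Proof. by rewrite !mxE; apply: eq_bigr => i _; rewrite mxE. Qed.

Lemma dotC n (x y : 'cV[R]_n) : dot x y = dot y x.
Proof. by apply: eq_bigr => i _; rewrite mulrC. Qed.

Lemma dotDl n (x y z : 'cV[R]_n) : dot (x + y) z = dot x z + dot y z.
Proof. by rewrite !dotE linearD mulmxDl mxE. Qed.

Lemma dotDr n (x y z : 'cV[R]_n) : dot z (x + y) = dot z x + dot z y.
Proof. by rewrite dotC dotDl !(dotC z). Qed.

Lemma dotZl n a (x z : 'cV[R]_n) : dot (a *: x) z = a * dot x z.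
Proof. by rewrite !dotE linearZ /= -scalemxAl mxE. Qed.

Lemma dotZr n a (x z : 'cV[R]_n) : dot z (a *: x) = a * dot z x.
Proof. by rewrite dotC dotZl dotC. Qed.

Lemma dotNl n (x z : 'cV[R]_n) : dot (- x) z = - dot x z.
Proof. by rewrite -scaleN1r dotZl mulN1r. Qed.

Lemma dotNr n (x z : 'cV[R]_n) : dot z (- x) = - dot z x.
Proof. by rewrite dotC dotNl dotC. Qed.

Lemma dotBl n (x y z : 'cV[R]_n) : dot (x - y) z = dot x z - dot y z.
Proof. by rewrite dotDl dotNl. Qed.

Lemma dotBr n (x y z : 'cV[R]_n) : dot z (x - y) = dot z x - dot z y.
Proof. by rewrite dotDr dotNr. Qed.

Lemma dot0l n (x : 'cV[R]_n) : dot 0 x = 0.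
Proof. by rewrite -[0](scale0r x) dotZl mul0r. Qed.

Lemma dot0r n (x : 'cV[R]_n) : dot x 0 = 0.
Proof. by rewrite dotC dot0l. Qed.

Lemma dot_mull n m (A : 'M[R]_(m, n)) x y : dot (A *m x) y = dot x (A^T *m y).
Proof. by rewrite !dotE trmx_mul mulmxA. Qed.

Lemma dot_mulr n m (A : 'M[R]_(m, n)) x y : dot y (A *m x) = dot (A^T *m y) x.
Proof. by rewrite dotC dot_mull dotC. Qed.

Lemma dot_ge0 n (x : 'cV[R]_n) : 0 <= dot x x.
Proof. by apply: sumr_ge0 => i _; rewrite -expr2 sqr_ge0. Qed.

Lemma dot_eq0 n (x : 'cV[R]_n) : (dot x x == 0) = (x == 0).
Proof.
apply/idP/eqP => [|->]; last by rewrite dot0l.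
rewrite psumr_eq0 => [/allP h|i _]; last by rewrite -expr2 sqr_ge0.
apply/colP => i; rewrite mxE; apply/eqP.
by have := h i (mem_index_enum _); rewrite /= mulf_eq0 orbb.
Qed.

Lemma vnormE n (x : 'cV[R]_n) : vnorm x = Num.sqrt (dot x x).
Proof. by congr Num.sqrt; apply: eq_bigr => i _; rewrite expr2. Qed.

Lemma vnorm_ge0 n (x : 'cV[R]_n) : 0 <= vnorm x.
Proof. exact: sqrtr_ge0. Qed.

Lemma vnorm_sqr n (x : 'cV[R]_n) : vnorm x ^+ 2 = dot x x.
Proof. by rewrite vnormE sqr_sqrtr ?dot_ge0. Qed.

Lemma vnorm0 n : vnorm (0 : 'cV[R]_n) = 0.
Proof. by rewrite vnormE dot0l sqrtr0. Qed.

Lemma vnorm_eq0 n (x : 'cV[R]_n) : (vnorm x == 0) = (x == 0).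
Proof. by rewrite -dot_eq0 -vnorm_sqr sqrf_eq0. Qed.

Lemma vnorm_gt0 n (x : 'cV[R]_n) : (0 < vnorm x) = (x != 0).
Proof. by rewrite lt_def vnorm_ge0 andbT vnorm_eq0. Qed.

Lemma vnormZ n a (x : 'cV[R]_n) : vnorm (a *: x) = `|a| * vnorm x.
Proof.
by rewrite !vnormE dotZl dotZr mulrA -expr2 sqrtrM ?sqr_ge0 // sqrtr_sqr.
Qed.

Lemma vnormN n (x : 'cV[R]_n) : vnorm (- x) = vnorm x.
Proof. by rewrite -scaleN1r vnormZ normrN1 mul1r. Qed.

Lemma vnorm_le n m (x : 'cV[R]_n) (y : 'cV[R]_m) :
  (vnorm x <= vnorm y) = (dot x x <= dot y y).
Proof. by rewrite !vnormE ler_sqrt ?dot_ge0. Qed.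

Lemma vnorm_leP n (x : 'cV[R]_n) c :
  0 <= c -> (vnorm x <= c) = (dot x x <= c ^+ 2).
Proof. by move=> c0; rewrite -vnorm_sqr ler_sqr ?nnegrE ?vnorm_ge0. Qed.

Lemma cauchy_schwarz n (x y : 'cV[R]_n) : `|dot x y| <= vnorm x * vnorm y.
Proof.
rewrite -ler_sqr ?nnegrE ?mulr_ge0 ?vnorm_ge0 //.
rewrite exprMn !vnorm_sqr real_normK ?num_real //.
have [->|y0] := eqVneq y 0; first by rewrite !dot0r mulr0 expr0n.
have py : 0 < dot y y by rewrite lt_def dot_eq0 y0 dot_ge0.
have := dot_ge0 (x - (dot x y / dot y y) *: y).
rewrite !(dotBl, dotBr, dotZl, dotZr) (dotC y x).
set a := dot x y; set b := dot y y in py *; set c := dot x x => h.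
have e : (c * b - a ^+ 2) / b = c - a / b * a - a / b * (a - a / b * b).
  by field; rewrite gt_eqF.
have : 0 <= (c * b - a ^+ 2) / b by rewrite e; move: h; lra.
by rewrite pmulr_lge0 ?invr_gt0 // subr_ge0.
Qed.

Lemma dot_le n (x y : 'cV[R]_n) : dot x y <= vnorm x * vnorm y.
Proof. exact: le_trans (ler_norm _) (cauchy_schwarz _ _). Qed.

Lemma vnormD n (x y : 'cV[R]_n) : vnorm (x + y) <= vnorm x + vnorm y.
Proof.
rewrite vnorm_leP ?addr_ge0 ?vnorm_ge0 // sqrrD !vnorm_sqr !(dotDl, dotDr).
have := dot_le x y; rewrite (dotC y x); lra.
Qed.

Lemma vnorm_isometry n m (A : 'M[R]_(m, n)) x :
  A^T *m A = 1%:M -> vnorm (A *m x) = vnorm x.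
Proof. by move=> h; rewrite !vnormE dot_mull mulmxA h mul1mx. Qed.

Lemma vnorm_trmx_isometry n m (A : 'M[R]_(m, n)) x :
  A^T *m A = 1%:M -> vnorm (A^T *m x) <= vnorm x.
Proof.
move=> h; have [->|x0] := eqVneq (A^T *m x) 0; first by rewrite vnorm0 vnorm_ge0.
rewrite -(ler_pM2l (x := vnorm (A^T *m x))) ?vnorm_gt0 // -expr2 vnorm_sqr.
by rewrite dot_mull trmxK (le_trans (dot_le _ _)) // vnorm_isometry // mulrC.
Qed.

(** Norm bounds are carried as inequalities. Suprema are confined to [net_opb], [least_opb] and the
    final passage to [opnorm]. *)
Definition opb n m (A : 'M[R]_(m, n)) (N : R) := forall x, vnorm (A *m x) <= N * vnorm x.

Lemma opb_le n m (A : 'M[R]_(m, n)) N N' : N <= N' -> opb A N -> opb A N'.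
Proof. by move=> h H x; apply: le_trans (H x) _; rewrite ler_wpM2r ?vnorm_ge0. Qed.

Lemma opbD n m (A B : 'M[R]_(m, n)) N N' : opb A N -> opb B N' -> opb (A + B) (N + N').
Proof.
by move=> H H' x; rewrite mulmxDl mulrDl (le_trans (vnormD _ _)) // lerD.
Qed.

Lemma opbN n m (A : 'M[R]_(m, n)) N : opb A N -> opb (- A) N.
Proof. by move=> H x; rewrite mulNmx vnormN. Qed.

Lemma opbM n m l (A : 'M[R]_(m, n)) (B : 'M[R]_(n, l)) N N' :
  0 <= N -> opb A N -> opb B N' -> opb (A *m B) (N * N').
Proof.
move=> N0 HA HB x; rewrite -mulmxA (le_trans (HA _)) // -mulrA.
by rewrite ler_wpM2l.
Qed.

Lemma opbZ n m (A : 'M[R]_(m, n)) N a : opb A N -> opb (a *: A) (`|a| * N).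
Proof. by move=> H x; rewrite -scalemxAl vnormZ -mulrA ler_wpM2l. Qed.

Lemma opb_tr n m (A : 'M[R]_(m, n)) N : 0 <= N -> opb A N -> opb A^T N.
Proof.
move=> N0 H x; have [->|x0] := eqVneq (A^T *m x) 0.
  by rewrite vnorm0 mulr_ge0 ?vnorm_ge0.
rewrite -(ler_pM2l (x := vnorm (A^T *m x))) ?vnorm_gt0 // -expr2 vnorm_sqr.
rewrite dot_mull trmxK (le_trans (dot_le _ _)) // mulrC mulrA ler_wpM2r ?vnorm_ge0 //.
by rewrite mulrC.
Qed.

Lemma opb_isometry n m (A : 'M[R]_(m, n)) : A^T *m A = 1%:M -> opb A 1.
Proof. by move=> h x; rewrite vnorm_isometry // mul1r. Qed.

Lemma opb_diag n (d : 'rV[R]_n) N : (forall a, `|d ord0 a| <= N) -> opb (diag_mx d) N.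
Proof.
move=> h x; have [n0|n0] := posnP n.
  subst n; have -> : x = 0 by apply/colP => -[].
  by rewrite mulmx0 vnorm0 mulr0.
have N0 : 0 <= N by apply: le_trans (h (Ordinal n0)); rewrite normr_ge0.
rewrite vnorm_leP ?mulr_ge0 ?vnorm_ge0 // exprMn vnorm_sqr /dot mulr_sumr.
apply: ler_sum => i _; rewrite mul_diag_mx mxE mulrACA ler_wpM2r -?expr2 ?sqr_ge0 //.
by rewrite -[d _ _ ^+ 2]real_normK ?num_real // ler_sqr ?nnegrE ?normr_ge0.
Qed.

Lemma opb_frob n m (A : 'M[R]_(m, n)) N : 0 <= N -> frob2 A <= N ^+ 2 -> opb A N.
Proof.
move=> N0 h x; rewrite vnorm_leP ?mulr_ge0 ?vnorm_ge0 // exprMn vnorm_sqr.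
apply: le_trans (ler_wpM2r (dot_ge0 x) h); rewrite /frob2 mulr_suml.
apply: ler_sum => i _; pose r := (row i A)^T.
have -> : (A *m x) i ord0 = dot r x.
  by rewrite mxE; apply: eq_bigr => j _; rewrite !mxE.
have -> : \sum_j A i j ^+ 2 = dot r r.
  by apply: eq_bigr => j _; rewrite !mxE expr2.
rewrite -!vnorm_sqr -exprMn -expr2 -[dot r x ^+ 2]real_normK ?num_real //.
by rewrite ler_sqr ?nnegrE ?mulr_ge0 ?vnorm_ge0 ?normr_ge0 // cauchy_schwarz.
Qed.

Lemma frob2_ge0 n m (A : 'M[R]_(m, n)) : 0 <= frob2 A.
Proof. by apply: sumr_ge0 => i _; apply: sumr_ge0 => j _; rewrite sqr_ge0. Qed.

Lemma frob2_col n m (A : 'M[R]_(m, n)) : frob2 A = \sum_j dot (col j A) (col j A).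
Proof.
rewrite /frob2 exchange_big; apply: eq_bigr => j _; apply: eq_bigr => i _.
by rewrite !mxE expr2.
Qed.

(** Each column is the image of a unit vector. The number of columns becomes the factor k-1 of the
    k-means cost, and the dimension factor in the trace bounds. *)
Lemma frob2_opb n m (A : 'M[R]_(m, n)) N : 0 <= N -> opb A N -> frob2 A <= n%:R * N ^+ 2.
Proof.
move=> N0 h; rewrite frob2_col.
have -> : n%:R * N ^+ 2 = \sum_(j < n) N ^+ 2 by rewrite sumr_const card_ord mulr_natl.
apply: ler_sum => j _; rewrite -vnorm_leP // colE.
rewrite (le_trans (h _)) // (_ : vnorm _ = 1) ?mulr1 // vnormE dotE trmx_delta.
by rewrite mul_delta_mx mxE !eqxx sqrtr1.
Qed.

Lemma frob2D n m (A B : 'M[R]_(m, n)) : frob2 (A + B) <= 2 * frob2 A + 2 * frob2 B.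
Proof.
rewrite /frob2 !mulr_sumr -big_split; apply: ler_sum => i _ /=.
rewrite !mulr_sumr -big_split; apply: ler_sum => j _ /=; rewrite mxE.
by have := sqr_ge0 (A i j - B i j); lra.
Qed.

Lemma frob2N n m (A : 'M[R]_(m, n)) : frob2 (- A) = frob2 A.
Proof. by apply: eq_bigr => i _; apply: eq_bigr => j _; rewrite mxE sqrrN. Qed.

Lemma frob2_tr n (A : 'M[R]_n) : frob2 A = \tr (A *m A^T).
Proof.
apply: eq_bigr => i _; rewrite mxE; apply: eq_bigr => j _; by rewrite !mxE expr2.
Qed.

(** The dimension [n.+1] keeps the unit sphere nonempty, so that the supremum is taken over a
    nonempty set. *)
Lemma opnorm_le n m (A : 'M[R]_(m, n.+1)) N : opb A N -> opnorm A <= N.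
Proof.
move=> h; apply: ge_sup => [|_ [x /= x1 <-]]; last first.
  by rewrite (le_trans (h x)) // x1 mulr1.
exists (vnorm (A *m delta_mx ord0 ord0)); exists (delta_mx ord0 ord0) => //=.
by rewrite vnormE dotE trmx_delta mul_delta_mx mxE !eqxx sqrtr1.
Qed.

End Euclidean.

(** * Trace moments of random symmetric matrices *)

Section TraceWalks.
Context {R : realType} {n : nat}.
Implicit Type M : 'M[R]_n.

Fixpoint walkprod M (a : 'I_n) (s : seq 'I_n) : R :=
  if s is b :: s' then M a b * walkprod M b s' else 1.

Lemma walkprodE M x0 a s :
  walkprod M a s = \prod_(i < size s) M (nth x0 (a :: s) i) (nth x0 s i).
Proof.
elim: s a => [|b s IH] a /=; first by rewrite big_ord0.
by rewrite big_ord_recl /= IH.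
Qed.

Lemma sum_tuple_cons (T : finType) l (F : l.+1.-tuple T -> R) :
  \sum_t F t = \sum_a \sum_(t : l.-tuple T) F [tuple of a :: t].
Proof.
rewrite pair_big /= (reindex (fun q : T * l.-tuple T => [tuple of q.1 :: q.2])) //=.
exists (fun t => (thead t, [tuple of behead t])) => [[a t]|t] _ /=.
  by congr pair; apply: val_inj.
by rewrite -tuple_eta.
Qed.

Lemma expr_walk M l a b :
  (M ^+ l) a b = \sum_(t : l.-tuple 'I_n) (last a t == b)%:R * walkprod M a t.
Proof.
elim: l a => [|l IH] a.
  rewrite expr0 mxE (big_pred1 [tuple]) /= ?mulr1 // => t.
  by apply/esym/eqP; rewrite [LHS]tuple0.
rewrite exprS mxE sum_tuple_cons; apply: eq_bigr => c _.
rewrite IH mulr_sumr; apply: eq_bigr => t _ /=.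
by rewrite mulrCA.
Qed.

Lemma sum_tuple_ffun (T : finType) l (F : l.-tuple T -> R) :
  \sum_t F t = \sum_(u : {ffun 'I_l -> T}) F [tuple u i | i < l].
Proof.
apply: (reindex (fun u : {ffun 'I_l -> T} => [tuple u i | i < l])).
exists (fun t => [ffun i => tnth t i]) => [u|t] _.
  by apply/ffunP => i; rewrite ffunE tnth_mktuple.
by apply: eq_from_tnth => i; rewrite tnth_mktuple ffunE.
Qed.

Lemma mxtrace_walk M l :
  \tr (M ^+ l.+1) =
  \sum_(u : {ffun 'I_l.+1 -> 'I_n}) \prod_i M (u i) (u (ordS i)).
Proof.
(* In [expr_walk] closing the walk identifies its base point with the last tuple entry, so step i
   ends at position i and starts at its cyclic predecessor. Reindexing by [ordS] shifts this
   back. *)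
transitivity (\sum_(u : {ffun 'I_l.+1 -> 'I_n}) \prod_i M (u (ord_pred i)) (u i)); last first.
  apply: eq_bigr => u _; rewrite (reindex (@ordS _)) /=; last first.
    by apply: onW_bij; exists (@ord_pred _); [exact: ordSK|exact: ord_predK].
  by apply: eq_bigr => i _; rewrite ordSK.
rewrite /mxtrace; under eq_bigr => a _ do rewrite expr_walk.
rewrite exchange_big /= sum_tuple_ffun; apply: eq_bigr => u _.
set t := [tuple _ | _ < _].
have nt (i : 'I_l.+1) x0 : nth x0 t i = u i.
  by rewrite -tnth_nth tnth_mktuple.
have lt a : last a t = u ord_max.
  by rewrite -nth_last size_tuple -(nt ord_max a).
clearbody t; rewrite (bigD1 (u ord_max)) //= lt eqxx mul1r big1 ?addr0; last first.
  by move=> a /negbTE; rewrite lt eq_sym => ->; rewrite mul0r.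
rewrite (walkprodE _ (u ord0)) size_tuple.

apply: eq_bigr => i _.
rewrite nt; congr (M _ _); case: i => -[|i] Hi /=.
  by congr (u _); apply: val_inj; rewrite /= modn_small.
have Hi' : (i < l.+1)%N by apply: ltnW.
rewrite (nt (Ordinal Hi')); congr (u _); apply: val_inj => /=.
by rewrite modnDr modn_small.
Qed.

End TraceWalks.

(** * Expectations over independent entries *)

Section RandomSymmetric.
Context {R : realType} {n : nat} {B : finType}.
Variables (mu : 'I_n * 'I_n -> B -> R).
Local Notation outc := {ffun 'I_n * 'I_n -> B}.

Definition wgt (w : outc) : R := \prod_e mu e (w e).
Definition Ex (f : outc -> R) : R := \sum_w wgt w * f w.

Lemma Ex_prod (f : 'I_n * 'I_n -> B -> R) :
  Ex (fun w => \prod_e f e (w e)) = \prod_e \sum_b mu e b * f e b.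
Proof.
by rewrite bigA_distr_bigA; apply: eq_bigr => w _; rewrite -big_split.
Qed.

Hypothesis mu_ge0 : forall e b, 0 <= mu e b.

Lemma wgt_ge0 w : 0 <= wgt w.
Proof. exact: prodr_ge0. Qed.

Lemma Ex_le f g : (forall w, f w <= g w) -> Ex f <= Ex g.
Proof. by move=> h; apply: ler_sum => w _; rewrite ler_wpM2l ?wgt_ge0. Qed.

Lemma ExD f g : Ex (fun w => f w + g w) = Ex f + Ex g.
Proof. by rewrite -big_split; apply: eq_bigr => w _; rewrite mulrDr. Qed.

Lemma ExZ c f : Ex (fun w => c * f w) = c * Ex f.
Proof. by rewrite mulr_sumr; apply: eq_bigr => w _; rewrite mulrCA. Qed.

Lemma Ex_sum (I : finType) (P : pred I) (f : I -> outc -> R) :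
  Ex (fun w => \sum_(i | P i) f i w) = \sum_(i | P i) Ex (f i).
Proof.
by rewrite exchange_big; apply: eq_bigr => w _; rewrite mulr_sumr.
Qed.

Lemma Ex_ext f g : f =1 g -> Ex f = Ex g.
Proof. by move=> h; apply: eq_bigr => w _; rewrite h. Qed.

Hypothesis mu_sum : forall e, \sum_b mu e b = 1.

Lemma Ex_cst c : Ex (fun=> c) = c.
Proof.
have h := Ex_prod (fun _ _ => 1).
rewrite /Ex -mulr_suml (_ : \sum_w wgt w = 1) ?mul1r //.
rewrite -[RHS](_ : \prod_(e : 'I_n * 'I_n) \sum_b mu e b * 1 = 1); last first.
  by rewrite big1 // => e _; rewrite -mulr_suml mu_sum mul1r.
by rewrite -h; apply: eq_bigr => w _; rewrite big1_eq mulr1.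
Qed.

Variable y : 'I_n * 'I_n -> B -> R.

Definition rsm (w : outc) : 'M[R]_n :=
  \matrix_(a, b) if (a < b)%N then y (a, b) (w (a, b))
                 else if (b < a)%N then y (b, a) (w (b, a)) else 0.

Lemma rsm_sym w : (rsm w)^T = rsm w.
Proof. by apply/matrixP => a b; rewrite !mxE; case: ltngtP. Qed.

(** The unordered pair, normalised so that both directions of a step read the same random
    coordinate. *)
Definition edge (a b : 'I_n) := if (a < b)%N then (a, b) else (b, a).

Lemma rsmE w a b : a != b -> rsm w a b = y (edge a b) (w (edge a b)).
Proof.
by rewrite mxE /edge -val_eqE; case: ltngtP.
Qed.

Section Walk.
Variables (l : nat) (u : 'I_l.+1 -> 'I_n).

Definition stepe (i : 'I_l.+1) := edge (u i) (u (ordS i)).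
Definition mult e := #|[set i | stepe i == e]|.
Definition noloop := [forall i, u i != u (ordS i)].

(** Grouping the steps by edge, independence gives one moment of order [mult] per edge; a loop meets
    the zero diagonal. *)
Lemma Ex_walk : Ex (fun w => \prod_i rsm w (u i) (u (ordS i))) =
  noloop%:R * \prod_e \sum_b mu e b * y e b ^+ mult e.
Proof.
have [/forallP nl|/forallPn[i]] := boolP noloop; last first.
  rewrite negbK => /eqP ui; rewrite mul0r; apply: big1 => w _.
  by rewrite (bigD1 i) //= -ui mxE ltnn mul0r mulr0.
rewrite mul1r -Ex_prod; apply: Ex_ext => w.
rewrite (partition_big stepe predT) //=; apply: eq_bigr => e _.
rewrite (eq_bigr (fun=> y e (w e))); last first.
  by move=> i /eqP <-; rewrite rsmE.
by rewrite prodr_const /mult cardsE.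
Qed.
End Walk.
End RandomSymmetric.

(** * Coincidence patterns of closed walks *)

Section WalkPatterns.
Context {l : nat}.
Implicit Types T S : finType.

Definition same_step T (u : {ffun 'I_l.+1 -> T}) (i j : 'I_l.+1) :=
  (u i == u j) && (u (ordS i) == u (ordS j)) ||
  (u i == u (ordS j)) && (u (ordS i) == u j).

(** The walks that survive for centred entries: no loop, and no edge used exactly once. Only
    equalities between positions occur, so the notion transfers between vertex sets of different
    sizes. *)
Definition good T (u : {ffun 'I_l.+1 -> T}) :=
  [forall i, u i != u (ordS i)] &&
  [forall i, exists j, (j != i) && same_step u i j].

Definition nval T (u : {ffun 'I_l.+1 -> T}) := #|u @: finset.setT|.

Definition sim T S (u : {ffun 'I_l.+1 -> T}) (w : {ffun 'I_l.+1 -> S}) :=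
  [forall i, forall j, (u i == u j) == (w i == w j)].

Lemma simP T S (u : {ffun 'I_l.+1 -> T}) (w : {ffun 'I_l.+1 -> S}) :
  reflect (forall i j, (u i == u j) = (w i == w j)) (sim u w).
Proof.
apply: (iffP forallP) => [h i j|h i]; first exact: (eqP (forallP (h i) j)).
by apply/forallP => j; rewrite h.
Qed.

Lemma simC T S (u : {ffun 'I_l.+1 -> T}) (w : {ffun 'I_l.+1 -> S}) :
  sim u w = sim w u.
Proof. by apply/simP/simP => h i j; rewrite h. Qed.

Lemma sim_good T S (u : {ffun 'I_l.+1 -> T}) (w : {ffun 'I_l.+1 -> S}) :
  sim u w -> good u = good w.
Proof.
move/simP => h; rewrite /good; congr (_ && _).
  by apply: eq_forallb => i; rewrite h.
by apply: eq_forallb => i; apply: eq_existsb => j; rewrite /same_step !h.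
Qed.

Lemma nval_gt0 T (u : {ffun 'I_l.+1 -> T}) : (0 < nval u)%N.
Proof. by apply/card_gt0P; exists (u ord0); apply: imset_f; rewrite inE. Qed.

Lemma sim_nval_le T S (u : {ffun 'I_l.+1 -> T}) (w : {ffun 'I_l.+1 -> S}) :
  sim u w -> (nval u <= nval w)%N.
Proof.
move/simP => h; pose g x := u (odflt ord0 [pick i | w i == x]).
rewrite /nval; suff -> : u @: finset.setT = g @: (w @: finset.setT) by exact: leq_imset_card.
rewrite -imset_comp; apply: eq_imset => i /=; rewrite /g.
case: pickP => [j|/(_ i)]; last by rewrite eqxx.
by rewrite -h => /eqP ->.
Qed.

Lemma sim_nval T S (u : {ffun 'I_l.+1 -> T}) (w : {ffun 'I_l.+1 -> S}) :
  sim u w -> nval u = nval w.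
Proof.
move=> h; apply/eqP; rewrite eqn_leq (sim_nval_le h) sim_nval_le //.
by rewrite simC.
Qed.

(** A walk with the pattern of [w] is an injective relabelling of the values of [w], and falling
    factorials count injections. *)
Lemma card_sim T S (w : {ffun 'I_l.+1 -> S}) :
  #|[set u : {ffun 'I_l.+1 -> T} | sim u w]| = (#|T| ^_ nval w)%N.
Proof.
pose D := {x | x \in w @: finset.setT}.
have memw i : w i \in w @: finset.setT by rewrite imset_f.
pose wD i : D := exist _ (w i) (memw i).
pose ext (f : {ffun D -> T}) : {ffun 'I_l.+1 -> T} := [ffun i => f (wD i)].
have cD : #|{: D}| = nval w by rewrite card_sig; apply: eq_card => x; rewrite inE.
have surD (x : D) : exists i, x = wD i.
  case: x => x xP; have /imsetP[i _ xi] := xP; exists i; exact: val_inj.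
rewrite -cD -card_inj_ffuns -(card_imset (f := ext)); last first.
  move=> f g /ffunP h; apply/ffunP => x; have [i ->] := surD x.
  by have := h i; rewrite !ffunE.
apply: eq_card => u; rewrite inE; apply/idP/imsetP => [/simP h|[f]]; last first.
  rewrite inE => /injectiveP inj_f ->; apply/simP => i j; rewrite !ffunE.
  by rewrite (inj_eq inj_f).
pose f : {ffun D -> T} := [ffun x => u (odflt ord0 [pick i | w i == val x])].
have fE i : f (wD i) = u i.
  rewrite ffunE /=; case: pickP => [j|/(_ i)]; last by rewrite eqxx.
  by rewrite -h => /eqP ->.
exists f; last by apply/ffunP => i; rewrite ffunE fE.
rewrite inE; apply/injectiveP => x y; have [i ->] := surD x; have [j ->] := surD y.
by rewrite !fE => /eqP; rewrite h => /eqP e; apply: val_inj.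
Qed.

End WalkPatterns.

Section PatternCount.
Context {R : realType}.

(** Factor by factor: (n-1-i) p <= n p <= r - m <= r-1-i for i < m. The arguments are [n.-1] and
    [r.-1] because one vertex is split off as the ratio n/r in the comparison below. *)
Lemma ffact_compare (n r m v : nat) (p : R) :
  0 <= p -> n%:R * p + m%:R <= r%:R -> (v <= m)%N ->
  (n.-1 ^_ v)%:R * p ^+ v <= (r.-1 ^_ v)%:R :> R.
Proof.
move=> p0 h; elim: v => [|v IH] vm; first by rewrite !ffactn0 expr0 mulr1.
rewrite !ffactnSr !natrM exprSr mulrACA.
apply: ler_pM; rewrite ?mulr_ge0 ?exprn_ge0 ?ler0n ?IH // 1?ltnW //.
have h1 : (n.-1 - v)%:R * p <= n%:R * p by rewrite ler_wpM2r // ler_nat; lia.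
have h2 : r%:R - m%:R <= (r.-1 - v)%:R :> R.
  by rewrite lerBlDr -natrD ler_nat; lia.
by move: h h1 h2; lra.
Qed.

(* Double counting the pairs of walks with the same coincidence pattern trades [n]
   vertices of weight [p] for [r >= n p + m] vertices of weight one. *)
Lemma good_walks_compare (l n r m : nat) (p : R) :
  (m < r)%N -> 0 <= p -> n%:R * p + m%:R <= r%:R ->
  (forall k (w : {ffun 'I_l.+1 -> 'I_k}), good w -> nval w <= m.+1)%N ->
  \sum_(u : {ffun 'I_l.+1 -> 'I_n} | good u) p ^+ (nval u).-1 <=
  n%:R / r%:R * \sum_(w : {ffun 'I_l.+1 -> 'I_r} | good w) 1.
Proof.
move=> mr p0 h vm.
have r0 : 0 < r%:R :> R by rewrite ltr0n; lia.
(* The weight of [u] is spread evenly over the [r ^_ nval u] walks of the same pattern, a positive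
   number since [nval u <= m.+1 <= r]. *)
have step (u : {ffun 'I_l.+1 -> 'I_n}) : good u ->
    p ^+ (nval u).-1 = \sum_(w : {ffun 'I_l.+1 -> 'I_r} | good w)
       (sim u w)%:R * (p ^+ (nval w).-1 / (r ^_ nval w)%:R).
  move=> gu.
  rewrite (eq_bigr (fun w : {ffun 'I_l.+1 -> 'I_r} =>
      (sim w u)%:R * (p ^+ (nval u).-1 / (r ^_ nval u)%:R))); last first.
    move=> w _; rewrite (simC u w); have [sw|] := boolP (sim w u); last by rewrite !mul0r.
    by rewrite (sim_nval sw).
  rewrite -mulr_suml (_ : \sum_(w | good w) _ = (r ^_ nval u)%:R); last first.
    have := card_sim 'I_r u; rewrite card_ord => <-; rewrite -sum1_card natr_sum.
    rewrite [in RHS]big_mkcond [in LHS]big_mkcond; apply: eq_bigr => w _.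
    rewrite inE; have [sw|] := boolP (sim w u); last by case: ifP.
    by rewrite (sim_good sw) gu.
  rewrite mulrC divfK // pnatr_eq0 -lt0n ffact_gt0.
  exact: leq_trans (vm _ _ gu) mr.
rewrite (eq_bigr _ step) exchange_big mulr_sumr; apply: ler_sum => w gw /=.
rewrite -mulr_suml mulr1 (_ : \sum_(u | good u) _ = (n ^_ nval w)%:R); last first.
  have := card_sim 'I_n w; rewrite card_ord => <-; rewrite -sum1_card natr_sum.
  rewrite [in RHS]big_mkcond [in LHS]big_mkcond; apply: eq_bigr => u _.
  rewrite inE; have [sw|] := boolP (sim u w); last by case: ifP.
  by rewrite (sim_good sw) gw.
have := vm _ _ gw; have := nval_gt0 w; case: (nval w) => // v _ vlem /=.
have rv : 0 < (r ^_ v.+1)%:R :> R.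
  by rewrite ltr0n ffact_gt0 (leq_trans _ mr).
rewrite mulrA ler_pdivrMr //.
have -> : n%:R / r%:R * (r ^_ v.+1)%:R = n%:R * (r.-1 ^_ v)%:R :> R.
  by rewrite ffactnS natrM mulrA divfK ?gt_eqF.
by rewrite ffactnS natrM -mulrA ler_wpM2l ?ler0n // (ffact_compare p0 h).
Qed.

End PatternCount.

Section WalkEdges.
Context {l n : nat}.
Implicit Type u : {ffun 'I_l.+1 -> 'I_n}.

Lemma edge_eq (a b c d : 'I_n) : (edge a b == edge c d) =
  (a == c) && (b == d) || (a == d) && (b == c).
Proof.
have e (x y : 'I_n) : (x == y) = (x == y :> nat) by [].
rewrite /edge; case: (ltnP a b) => ab; case: (ltnP c d) => cd;
  rewrite xpair_eqE !e; apply/idP/idP; lia.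
Qed.

Lemma stepe_eq u i j : (stepe u i == stepe u j) = same_step u i j.
Proof. exact: edge_eq. Qed.

(* The steps at which a vertex is visited for the first time use distinct edges. *)
Lemma nval_edges u : (nval u <= #|stepe u @: finset.setT|.+1)%N.
Proof.
rewrite /nval (cardsD1 (u ord0)) imset_f // ltnS.
pose f x := [arg min_(i < odflt ord0 [pick i | u i == x] | u i == x) val i]%N.
have fP x : x \in u @: finset.setT -> u (f x) = x /\ forall j, u j = x -> (f x <= j)%N.
  case/imsetP => i _ xi; rewrite /f; case: arg_minnP => /=.
    by case: pickP => // /(_ i); rewrite xi eqxx.
  by move=> j /eqP uj hj; split => // j' uj'; apply: hj; rewrite uj'.
pose g x := ord_pred (f x).
have gP x : x \in (u @: finset.setT) :\ u ord0 ->
    [/\ u (ordS (g x)) = x, (g x < f x)%N & forall j, u j = x -> (f x <= j)%N].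
  rewrite !inE => /andP[x0 /fP[ux hx]]; split=> //; first by rewrite ord_predK.
  have f0 : (0 < f x)%N.
    rewrite lt0n; apply: contraNneq x0 => f0; rewrite -ux; apply/eqP; congr (u _).
    exact: val_inj.
  rewrite /g /= -(prednK f0) addSn /= modnDr modn_small ?leqnn //.
  by rewrite prednK // ltnW // ltn_ord.
rewrite -(card_in_imset (f := fun x => stepe u (g x))); last first.
  move=> x y /gP[ux gx hx] /gP[uy gy hy] /eqP; rewrite stepe_eq /same_step ux uy.
  case/orP => [/andP[_ /eqP] //|/andP[/eqP uxy /eqP xuy]].
  (* Traversed in opposite directions, the two steps would give f x <= g y < f y and f y <= g x < f
     x. *)
  by have := hx _ (esym xuy); have := hy _ uxy; lia.
apply/subset_leq_card/fintype.subsetP => e /imsetP[x _ ->]; exact: imset_f.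
Qed.

(** The l+1 steps fall into fibres over the edges, each of size at least 2. *)
Lemma good_edges u : good u -> (2 * #|stepe u @: finset.setT| <= l.+1)%N.
Proof.
case/andP => _ /forallP gu.
have e : (\sum_(i in [set: 'I_l.+1]%SET) 1 = l.+1)%N by rewrite sum1_card cardsT card_ord.
rewrite -[leqRHS]e (partition_big_imset (stepe u)) mulnC -sum_nat_const /=.
apply: leq_sum => _ /imsetP[i _ ->]; rewrite sum1dep_card.
have /existsP[j /andP[ji ss]] := gu i.
by rewrite (cardsD1 i) (cardsD1 j) !inE eqxx ji /= eq_sym stepe_eq ss.
Qed.

Lemma good_nval u m : l.+1 = m.*2 -> good u -> (nval u <= m.+1)%N.
Proof.
move=> lm gu; apply: leq_trans (nval_edges u) _.
by rewrite ltnS -leq_double -mul2n -lm good_edges.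
Qed.

End WalkEdges.

(** * The contribution of one walk in terms of entry moments *)

Section WalkMoments.
Context {R : realType} {l n : nat}.
Implicit Type u : {ffun 'I_l.+1 -> 'I_n}.
Variable (Mo : 'I_n * 'I_n -> nat -> R).
Hypotheses (Mo0 : forall e, Mo e 0 = 1) (Mo1 : forall e, Mo e 1 = 0).

Lemma mult_gt0 u e : (0 < mult u e)%N = (e \in stepe u @: finset.setT).
Proof.
apply/card_gt0P/imsetP => [[i]|[i _ ->]]; last by exists i; rewrite inE.
by rewrite inE => /eqP <-; exists i; rewrite ?inE.
Qed.

Lemma not_good_walk u : ~~ good u -> (noloop u)%:R * \prod_e Mo e (mult u e) = 0.
Proof.
rewrite negb_and => /orP[/negbTE h|/forallPn[i /existsPn h]].
  by rewrite /noloop h mul0r.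
have m1 : mult u (stepe u i) = 1%N.
  rewrite /mult (cardsD1 i) !inE eqxx (_ : _ :\ i = finset.set0) ?cards0 //.
  apply/setP => j; rewrite !inE stepe_eq; have := h j; case: eqP => //= _.
  apply: contraNF; rewrite /same_step => /orP[] /andP[/eqP -> /eqP ->]; by rewrite !eqxx ?orbT.
by rewrite (bigD1 (stepe u i)) //= m1 Mo1 mul0r mulr0.
Qed.

(** Each distinct edge contributes at most p, and there are at least [(nval u).-1] of them; p <= 1
    turns this into the exponent on the right. *)
Lemma walk_moment_le u (p : R) : 0 <= p <= 1 ->
  (forall e j, (2 <= j)%N -> `|Mo e j| <= p) ->
  (noloop u)%:R * \prod_e Mo e (mult u e) <= (good u)%:R * p ^+ (nval u).-1.
Proof.
case/andP => p0 p1 hM; have [gu|gu] := boolP (good u); last first.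
  by rewrite not_good_walk // mul0r.
have -> : noloop u by case/andP: gu.
rewrite !mul1r; apply: le_trans (ler_norm _) _; rewrite normr_prod.
apply: le_trans (_ : p ^+ #|stepe u @: finset.setT| <= _); last first.
  by rewrite ler_wiXn2l // -ltnS prednK ?nval_gt0 // nval_edges.
rewrite -prodr_const [X in _ <= X]big_mkcond /=; apply: ler_prod => e _.
rewrite normr_ge0 /= -mult_gt0; case: (posnP (mult u e)) => [->|m0].
  by rewrite Mo0 normr1.
have [|m2] := leqP 2 (mult u e); first exact: hM.
have -> : mult u e = 1%N by lia.
by rewrite Mo1 normr0.
Qed.

(** With all moments of order at least 2 bounded below by 1 nothing cancels, so the expected trace
    dominates the number of good walks. *)
Lemma walk_moment_ge u : (forall e j, (2 <= j)%N -> 1 <= Mo e j) ->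
  (good u)%:R <= (noloop u)%:R * \prod_e Mo e (mult u e).
Proof.
move=> hM; have [gu|gu] := boolP (good u); last by rewrite not_good_walk.
have -> : noloop u by case/andP: gu.
rewrite mul1r; elim/big_ind: _ => // [x y x1 y1|e _]; first exact: mulr_ege1.
have [/hM //|m2] := leqP 2 (mult u e).
have [m0|m0] := posnP (mult u e); first by rewrite m0 Mo0.
have /andP[_ /forallP gu2] := gu.
have : e \in stepe u @: finset.setT by rewrite -mult_gt0.
case/imsetP => i _ ei; have /existsP[j /andP[ji ss]] := gu2 i.
move: m2; rewrite /mult (cardsD1 i) (cardsD1 j) !inE ei eqxx ji /= eq_sym stepe_eq ss.
by [].
Qed.

End WalkMoments.

(** * A comparison ensemble with explicit norm bounds *)

Section NetNorm.
Context {R : realType}.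

(** The mesh 1/(4 sqrt r) is chosen so that rounding all r coordinates moves a point by at most 1/4
    in Euclidean norm. *)
Definition netpt r b (c : {ffun 'I_r -> bool * 'I_b.+1}) : 'cV[R]_r :=
  \col_i ((-1) ^+ (c i).1 * (c i).2%:R / (4 * Num.sqrt r%:R)).

Lemma dot_netpt r b (c : {ffun 'I_r -> bool * 'I_b.+1}) :
  dot (netpt c) (netpt c) = (\sum_i ((c i).2%:R ^+ 2)) / (16 * r%:R).
Proof.
rewrite mulr_suml; apply: eq_bigr => i _; rewrite !mxE -expr2 !exprMn.
by rewrite sqrr_sign mul1r exprVn exprMn sqr_sqrtr ?ler0n //; congr (_ / (_ * _)); ring.
Qed.

Definition netc r b : pred {ffun 'I_r -> bool * 'I_b.+1} :=
  [pred c | dot (netpt c) (netpt c) <= 1].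

(** Rounding every coordinate towards zero keeps the point in the unit ball. The integers stay below
    4 sqrt r <= 4 r <= b. *)
Lemma net_approx r b (x : 'cV[R]_r) : (0 < r)%N -> (4 * r <= b)%N -> vnorm x <= 1 ->
  exists2 c, c \in @netc r b & vnorm (x - netpt c) <= 1 / 4.
Proof.
move=> r0 rb x1; pose s := Num.sqrt r%:R : R.
have s0 : 0 < s by rewrite sqrtr_gt0 ltr0n.
have ss : s * s = r%:R by rewrite -expr2 sqr_sqrtr ?ler0n.
have s1 : 1 <= s by rewrite -[1]sqrtr1 ler_sqrt // ler1n.
have xi i : `|x i ord0| <= 1.
  rewrite -(@expr_le1 _ 2) // real_normK ?num_real // (le_trans (y := dot x x)) //.
    by rewrite /dot (bigD1 i) //= -expr2 lerDl sumr_ge0 // => j _; rewrite -expr2 sqr_ge0.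
  by rewrite -vnorm_sqr expr_le1 ?vnorm_ge0.
pose v i := Num.truncn (4 * s * `|x i ord0|).
have vP i : (v i)%:R <= 4 * s * `|x i ord0| < (v i).+1%:R.
  by apply: truncn_itv; rewrite !mulr_ge0 // ltW.
have vb i : (v i < b.+1)%N.
  rewrite ltnS -(ler_nat R); have /andP[h _] := vP i.
  apply: le_trans h _; apply: (le_trans (y := (4 * r)%:R)); last by rewrite ler_nat.
  rewrite natrM -ss; have := xi i; have := normr_ge0 (x i ord0); nra.
pose c : {ffun 'I_r -> bool * 'I_b.+1} := [ffun i => (x i ord0 < 0, Ordinal (vb i))].
have cE i : netpt c i ord0 = (-1) ^+ (x i ord0 < 0)%R * ((v i)%:R / (4 * s)).
  by rewrite mxE ffunE /= mulrA.
have xE i : x i ord0 = (-1) ^+ (x i ord0 < 0)%R * `|x i ord0|.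
  by rewrite -numEsign.
have dE i : (x - netpt c) i ord0 =
    (-1) ^+ (x i ord0 < 0)%R * (`|x i ord0| - (v i)%:R / (4 * s)).
  by rewrite mulrBr -xE -cE !mxE.
have s4 : 0 < 4 * s by rewrite mulr_gt0.
have hq i : (v i)%:R / (4 * s) <= `|x i ord0| /\ `|x i ord0| - (v i)%:R / (4 * s) <= 1 / (4 * s).
  have /andP[h1 h2] := vP i; split; first by rewrite ler_pdivrMr // mulrC.
  rewrite lerBlDr -mulrDl ler_pdivlMr // mulrC (le_trans (ltW h2)) //.
  by rewrite -natr1 addrC.
exists c.
  rewrite inE; apply: (le_trans (y := dot x x)); last by rewrite -vnorm_sqr expr_le1 ?vnorm_ge0.
  apply: ler_sum => i _; rewrite cE mulrACA -expr2 sqrr_sign mul1r.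
  rewrite -2!expr2 -[x i ord0 ^+ 2]real_normK ?num_real // ler_sqr ?nnegrE ?normr_ge0 //.
    by case: (hq i).
  by rewrite divr_ge0 ?ler0n // ltW.
rewrite vnorm_leP ?divr_ge0 // /dot.
apply: (le_trans (y := \sum_(i < r) (1 / (4 * s)) ^+ 2)).
  apply: ler_sum => i _; rewrite -expr2 dE [leLHS]exprMn sqrr_sign [leLHS]mul1r.
  rewrite ler_sqr ?nnegrE; last 2 first.
  - by rewrite subr_ge0; case: (hq i).
  - by rewrite divr_ge0 // ltW.
  by case: (hq i).
rewrite sumr_const card_ord -[_ *+ r]mulr_natr -ss le_eqVlt; apply/orP; left; apply/eqP.
by field; rewrite gt_eqF.
Qed.

(** On the net the integer coordinates have squares summing to at most 16 r, so 1 <= exp(16 r - sum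
    of squares). The right side factors over the coordinates, which makes the bound independent of
    b. *)
Lemma net_card r b : (0 < r)%N ->
  \sum_(c | c \in @netc r b) 1 <= (4 * expR 16) ^+ r :> R.
Proof.
move=> r0.
have r0' : 0 < r%:R :> R by rewrite ltr0n.
apply: (le_trans (y := \sum_(c : {ffun 'I_r -> bool * 'I_b.+1})
    expR (16 * r%:R) * \prod_i expR (- ((c i).2%:R ^+ 2)))).
  rewrite big_mkcond; apply: ler_sum => c _; rewrite -expR_sum -expRD sumrN.
  rewrite inE dot_netpt ler_pdivrMr ?mulr_gt0 // mul1r; case: ifP => h; last exact: expR_ge0.
  by rewrite (le_trans _ (expR_ge1Dx _)) // lerDl subr_ge0.
rewrite -mulr_sumr -(bigA_distr_bigA (fun _ j => expR (- ((j : bool * 'I_b.+1).2%:R ^+ 2)))) /=.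
rewrite prodr_const card_ord expRM_natr mulrC exprMn ler_wpM2r ?exprn_ge0 ?expR_ge0 //.
rewrite lerXn2r ?nnegrE //; first by apply: sumr_ge0 => j _; exact: expR_ge0.
rewrite -(pair_bigA _ (fun (_ : bool) (j : 'I_b.+1) => expR (- (j%:R ^+ 2)))) /=.
rewrite big_const card_bool /= addr0.
(* Strengthened for induction: the slack 2^(-b) absorbs the next term, since exp(-(b+1)^2) <=
   2^(-(b+1)). *)
suff h : \sum_(j < b.+1) expR (- (j%:R ^+ 2)) <= 2 - 2^-1 ^+ b :> R.
  have : 0 <= 2^-1 ^+ b :> R by rewrite exprn_ge0.
  by move: h; lra.
elim: b => [|b IH]; first by rewrite big_ord1 expr0n /= oppr0 expR0 expr0; lra.
rewrite big_ord_recr /=.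
have : expR (- (b.+1%:R ^+ 2)) <= 2^-1 ^+ b.+1 :> R.
  rewrite expRN exprVn lef_pV2 ?posrE ?exprn_gt0 ?expR_gt0 //.
  apply: (le_trans (y := expR (1 * b.+1%:R))).
    rewrite expRM_natr lerXn2r ?nnegrE ?expR_ge0 //.
    by have := expR_ge1Dx (1 : R); lra.
  by rewrite ler_expR mul1r expr2 ler_peMl // ler1n.
by move: IH; rewrite (exprSr _ b); lra.
Qed.

(** Let N be the supremum of the form over the unit balls. Since <x, G y> = <c, G c'> + <c, G (y -
    c')> + <x - c, G y>, net points at distance at most 1/4 give N <= M + N/2. *)
Lemma net_opb r b (G : 'M[R]_r) M : (0 < r)%N -> (4 * r <= b)%N ->
  (forall c c', c \in @netc r b -> c' \in @netc r b ->
     `|dot (netpt c) (G *m netpt c')| <= M) ->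
  opb G (2 * M).
Proof.
move=> r0 rb h.
pose S : set R := [set z | exists x y, [/\ vnorm x <= 1, vnorm y <= 1 & z = dot x (G *m y)]]%classic.
have Sub : has_ubound S.
  exists (Num.sqrt (frob2 G)) => _ [x [y [x1 y1 ->]]].
  apply: le_trans (dot_le _ _) _; rewrite -[leRHS]mul1r ler_pM ?vnorm_ge0 //.
  have hG : opb G (Num.sqrt (frob2 G)).
    by apply: opb_frob; rewrite ?sqrtr_ge0 // sqr_sqrtr // frob2_ge0.
  by rewrite (le_trans (hG _)) // -[leRHS]mulr1 ler_wpM2l ?sqrtr_ge0.
have S0 : (S !=set0)%classic by exists 0, 0, 0; rewrite vnorm0 dot0l.
pose N := sup S.
have SN x y : vnorm x <= 1 -> vnorm y <= 1 -> dot x (G *m y) <= N.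
  by move=> x1 y1; apply: (ub_le_sup Sub); exists x, y.
have NM : N <= M + N / 2.
  apply: ge_sup => // _ [x [y [x1 y1 ->]]].
  have [c cn cx] := net_approx r0 rb x1; have [c' cn' cy] := net_approx r0 rb y1.
  have hc := h _ _ cn cn'.
  have n1 d : d \in @netc r b -> vnorm (netpt d) <= 1.
    by rewrite inE vnorm_leP // expr1n.
  have n4 (z : 'cV[R]_r) : vnorm z <= 1 / 4 -> vnorm (4 *: z) <= 1.
    by rewrite vnormZ ger0_norm //; lra.
  have := SN _ _ (n4 _ cx) y1; have := SN _ _ (n1 _ cn) (n4 _ cy).
  rewrite dotZl -scalemxAr dotZr mulmxBr dotBl dotBr.
  have := ler_normlW hc; lra.
move=> x; have [Gx0|Gx0] := eqVneq (G *m x) 0.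
  rewrite Gx0 vnorm0 mulr_ge0 ?vnorm_ge0 //.
  have : 0 <= N by have := SN 0 0; rewrite vnorm0 dot0l; apply.
  by move: NM; lra.
have x0 : x != 0 by apply: contraNneq Gx0 => ->; rewrite mulmx0.
have px : 0 < vnorm x by rewrite vnorm_gt0.
have pG : 0 < vnorm (G *m x) by rewrite vnorm_gt0.
have := SN ((vnorm (G *m x))^-1 *: (G *m x)) ((vnorm x)^-1 *: x).
rewrite !vnormZ !ger0_norm ?invr_ge0 ?vnorm_ge0 // !mulVf ?gt_eqF // => /(_ (lexx _) (lexx _)).
rewrite dotZl -scalemxAr dotZr -vnorm_sqr.
have -> : (vnorm (G *m x))^-1 * ((vnorm x)^-1 * vnorm (G *m x) ^+ 2) =
    vnorm (G *m x) / vnorm x by field; rewrite !gt_eqF.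
rewrite ler_pdivrMr // => /le_trans; apply; rewrite ler_wpM2r ?vnorm_ge0 //.
by move: NM; lra.
Qed.

End NetNorm.

(** * Norms and traces of powers of symmetric matrices *)

Section SymmetricPowers.
Context {R : realType} {n : nat}.
Implicit Type A : 'M[R]_n.

Lemma expmx_sym A k : A^T = A -> (A ^+ k)^T = A ^+ k.
Proof.
move=> h; elim: k => [|k IH]; first by rewrite expr0 trmx1.
by rewrite {1}exprS trmx_mul IH h exprSr.
Qed.

Lemma opbX A N k : 0 <= N -> opb A N -> opb (A ^+ k) (N ^+ k).
Proof.
move=> N0 h; elim: k => [|k IH]; first by move=> x; rewrite !expr0 mul1mx mul1r.
by rewrite !exprS; apply: opbM.
Qed.

(** Reading an even trace as a squared Frobenius norm converts trace bounds into norm bounds and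
    back without diagonalising [A]. *)
Lemma mxtrace_expr_sym A m : A^T = A -> \tr (A ^+ m.*2) = frob2 (A ^+ m).
Proof. by move=> h; rewrite frob2_tr expmx_sym // -addnn exprD. Qed.

Lemma mxtrace_expr_opb A N m : A^T = A -> 0 <= N -> opb A N ->
  \tr (A ^+ m.*2) <= n%:R * N ^+ m.*2.
Proof.
move=> h N0 hA; rewrite mxtrace_expr_sym // -muln2 exprM.
by apply: frob2_opb; rewrite ?exprn_ge0 //; apply: opbX.
Qed.

(* [|A x|^2 = <x, A^2 x> <= |x| |A^2 x|], iterated along powers of two. *)
Lemma sym_expr2n_growth A x j : A^T = A ->
  vnorm (A *m x) ^+ (2 ^ j) <= vnorm (A ^+ (2 ^ j) *m x) * vnorm x ^+ (2 ^ j).-1.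
Proof.
move=> h; elim: j => [|j IH]; first by rewrite expn0 !expr1 expr0 mulr1.
have e0 : (0 < 2 ^ j)%N by rewrite expn_gt0.
rewrite expnSr exprM; apply: le_trans (lerXn2r 2 _ _ IH) _.
- by rewrite nnegrE exprn_ge0 ?vnorm_ge0.
- by rewrite nnegrE mulr_ge0 ?exprn_ge0 ?vnorm_ge0.
rewrite exprMn vnorm_sqr -exprM.
have -> : ((2 ^ j * 2).-1 = ((2 ^ j).-1 * 2).+1)%N by lia.
rewrite exprS mulrA ler_wpM2r ?exprn_ge0 ?vnorm_ge0 //.
rewrite dot_mull expmx_sym // mulmxA mulrC exprM expr2.
exact: dot_le.
Qed.

(** The Frobenius norm of A^(2^j) bounds its operator norm, and [sym_expr2n_growth] takes the root;
    this is why the exponent is a power of two. *)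
Lemma sym_opb_of_trace A j N : A^T = A -> 0 < N ->
  \tr (A ^+ (2 ^ j).*2) <= N ^+ (2 ^ j).*2 -> opb A N.
Proof.
move=> h N0; rewrite mxtrace_expr_sym // -muln2 (exprM N) => hN x.
have e0 : (0 < 2 ^ j)%N by rewrite expn_gt0.
rewrite -(@ler_pXn2r _ (2 ^ j)) ?nnegrE ?mulr_ge0 ?vnorm_ge0 ?(ltW N0) //.
apply: le_trans (sym_expr2n_growth x j h) _; rewrite exprMn.
have hM : opb (A ^+ (2 ^ j)) (N ^+ (2 ^ j)) by apply: opb_frob => //; rewrite exprn_ge0 ?ltW.
have -> : vnorm x ^+ (2 ^ j) = vnorm x * vnorm x ^+ (2 ^ j).-1 by rewrite -exprS prednK.
rewrite mulrA.
by rewrite ler_wpM2r ?exprn_ge0 ?vnorm_ge0.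
Qed.

End SymmetricPowers.

(** * Trace of the two-point comparison matrix *)

Section TwoPointEnsemble.
Context {R : realType}.

(** Under a centred law the linear term disappears and a sub-Gaussian moment generating function
    remains. For x <= 1/2 combine e^x (1 - x) <= 1 with (1 + x + 2x^2)(1 - x) = 1 + x^2 (1 - 2x) >=
    1. *)
Lemma expR_le_square (x : R) : expR x <= x + expR (2 * x ^+ 2).
Proof.
have [x2|x2] := ltP (1 / 2) x.
  have : expR x <= expR (2 * x ^+ 2) by rewrite ler_expR expr2; nra.
  by lra.
have h1 : 1 + 2 * x ^+ 2 <= expR (2 * x ^+ 2) by exact: expR_ge1Dx.
suff : expR x <= 1 + x + 2 * x ^+ 2 by lra.
have h2 := expR_ge1Dx (- x); have h3 := expR_gt0 x.
have e : expR x * expR (- x) = 1 by rewrite expRxMexpNx_1.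
have h4 : 0 <= 1 + x + 2 * x ^+ 2 by nra.
have h5 : 1 <= (1 + x + 2 * x ^+ 2) * (1 - x).
  have : 0 <= x ^+ 2 * (1 - 2 * x) by rewrite mulr_ge0 ?sqr_ge0 //; lra.
  by lra.
have : expR x * (1 - x) <= 1 by rewrite -e ler_pM2l //; lra.
by nra.
Qed.

(* The centred law 2 w.p. 1/3, -1 w.p. 2/3: all its moments of order at least 2
   are at least 1, including the odd ones. *)
Definition tpmu {n} (e : 'I_n * 'I_n) (b : bool) : R := if b then 1 / 3 else 2 / 3.
Definition tpval {n} (e : 'I_n * 'I_n) (b : bool) : R := if b then 2 else -1.

Lemma tpmu_ge0 n (e : 'I_n * 'I_n) b : 0 <= tpmu e b.
Proof. by rewrite /tpmu; case: b; lra. Qed.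

Lemma tp_moment_ge n (e : 'I_n * 'I_n) j : (2 <= j)%N ->
  1 <= \sum_b tpmu e b * tpval e b ^+ j.
Proof.
move=> j2; rewrite big_bool /= /tpmu /tpval.
have [k ->] : exists k, j = k.+2 by exists j.-2; lia.
have h1 : 4 <= 2 ^+ k.+2 :> R.
  by rewrite !exprS; have := @exprn_ege1 R k 2; rewrite ler1n => /(_ isT); lra.
case: k h1 {j2} => [|k] h1; first by rewrite !expr2; lra.
have : 8 <= 2 ^+ k.+3 :> R.
  by rewrite !exprS; have := @exprn_ege1 R k 2; rewrite ler1n => /(_ isT); lra.
have : -1 <= (-1) ^+ k.+3 :> R.
  by rewrite -signr_odd; case: (odd _); rewrite ?expr1 ?expr0; lra.
by lra.
Qed.

Lemma tp_moment0 n (e : 'I_n * 'I_n) : \sum_b tpmu e b * tpval e b ^+ 0 = 1.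
Proof. by rewrite big_bool /= /tpmu /tpval !expr0; lra. Qed.

Lemma tp_moment1 n (e : 'I_n * 'I_n) : \sum_b tpmu e b * tpval e b ^+ 1 = 0.
Proof. by rewrite big_bool /= /tpmu /tpval !expr1; lra. Qed.

(** Folding the lower triangle onto the upper one makes each independent coordinate occur once, so
    exponentials of the form factor. *)
Lemma dot_rsm n (B : finType) (y : 'I_n * 'I_n -> B -> R) w (z z' : 'cV[R]_n) :
  dot z (rsm y w *m z') = \sum_(e : 'I_n * 'I_n | (e.1 < e.2)%N)
    y e (w e) * (z e.1 ord0 * z' e.2 ord0 + z e.2 ord0 * z' e.1 ord0).
Proof.
under [RHS]eq_bigr => e _ do rewrite mulrDr.
rewrite big_split /=.
have -> : \sum_(e : 'I_n * 'I_n | (e.1 < e.2)%N) y e (w e) * (z e.2 ord0 * z' e.1 ord0) =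
  \sum_(e : 'I_n * 'I_n | (e.2 < e.1)%N) y (e.2, e.1) (w (e.2, e.1)) * (z e.1 ord0 * z' e.2 ord0).
  rewrite (reindex (fun e : 'I_n * 'I_n => (e.2, e.1))) //=.
  by exists (fun e : 'I_n * 'I_n => (e.2, e.1)) => -[].
rewrite big_mkcond [X in _ = _ + X]big_mkcond -big_split /=.
rewrite (eq_bigr (fun e : 'I_n * 'I_n => z e.1 ord0 * (rsm y w e.1 e.2 * z' e.2 ord0))).
  rewrite -(pair_bigA _ (fun a b => z a ord0 * (rsm y w a b * z' b ord0))) /=.
  by apply: eq_bigr => a _; rewrite mxE mulr_sumr.
move=> [a b] _ /=; rewrite mxE; case: ltngtP => _; rewrite ?mul0r ?mulr0; ring.
Qed.

(** With c_e the coefficient of the edge e, values bounded by 2 give a factor exp(8 t^2 c_e^2), and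
    the c_e^2 sum to at most 2 |z|^2 |z'|^2 by (a + b)^2 <= 2a^2 + 2b^2. *)
Lemma tp_mgf n (z z' : 'cV[R]_n) t : dot z z <= 1 -> dot z' z' <= 1 ->
  Ex tpmu (fun w => expR (t * dot z (rsm tpval w *m z'))) <= expR (16 * t ^+ 2).
Proof.
move=> z1 z1'.
pose c (e : 'I_n * 'I_n) : R := if (e.1 < e.2)%N then
  z e.1 ord0 * z' e.2 ord0 + z e.2 ord0 * z' e.1 ord0 else 0.
rewrite (@Ex_ext _ _ _ tpmu _ (fun w => \prod_e expR (t * c e * tpval e (w e)))); last first.
  move=> w; rewrite -expR_sum dot_rsm big_mkcond mulr_sumr; congr expR.
  by apply: eq_bigr => e _; rewrite /c; case: ifP => _; ring.
rewrite (Ex_prod tpmu (fun e b => expR (t * c e * tpval e b))).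
apply: (le_trans (y := \prod_(e : 'I_n * 'I_n) expR (8 * t ^+ 2 * c e ^+ 2))).
  apply: ler_prod => e _; rewrite sumr_ge0 /=; last first.
    by move=> b _; rewrite mulr_ge0 ?tpmu_ge0 ?expR_ge0.
  rewrite big_bool /= /tpmu /tpval.
  have h1 := expR_le_square (t * c e * 2); have h2 := expR_le_square (t * c e * -1).
  have h3 : expR (2 * (t * c e * 2) ^+ 2) = expR (8 * t ^+ 2 * c e ^+ 2).
    by congr expR; ring.
  have h4 : expR (2 * (t * c e * -1) ^+ 2) <= expR (8 * t ^+ 2 * c e ^+ 2).
    by rewrite ler_expR; have := sqr_ge0 (t * c e); rewrite !exprMn; nra.
  by move: h1 h2 h4; rewrite h3; lra.
rewrite -expR_sum ler_expR -mulr_sumr.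
suff : \sum_e c e ^+ 2 <= 2 by have := sqr_ge0 t; nra.
apply: (le_trans (y := 2 * (dot z z * dot z' z'))); last first.
  by have := dot_ge0 z; have := dot_ge0 z'; nra.
have -> : dot z z * dot z' z' = \sum_(e : 'I_n * 'I_n | (e.1 < e.2)%N)
     ((z e.1 ord0 * z' e.2 ord0) ^+ 2 + (z e.2 ord0 * z' e.1 ord0) ^+ 2) +
     \sum_a (z a ord0 * z' a ord0) ^+ 2.
  rewrite big_distrlr /= pair_bigA /=.
  rewrite big_split /=.
  have -> : \sum_(e : 'I_n * 'I_n | (e.1 < e.2)%N) (z e.2 ord0 * z' e.1 ord0) ^+ 2 =
    \sum_(e : 'I_n * 'I_n | (e.2 < e.1)%N) (z e.1 ord0 * z' e.2 ord0) ^+ 2.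
    rewrite (reindex (fun e : 'I_n * 'I_n => (e.2, e.1))) //=.
    by exists (fun e : 'I_n * 'I_n => (e.2, e.1)) => -[].
  have -> : \sum_a (z a ord0 * z' a ord0) ^+ 2 =
    \sum_(e : 'I_n * 'I_n | e.1 == e.2) (z e.1 ord0 * z' e.2 ord0) ^+ 2.
    rewrite -(pair_big_dep predT (fun a b => a == b) (fun a b => (z a ord0 * z' b ord0) ^+ 2)) /=.
    by apply: eq_bigr => a _; rewrite (eq_bigl (pred1 a)) ?big_pred1_eq // => b; rewrite eq_sym.
  rewrite [X in _ = X + _ + _]big_mkcond [X in _ = _ + X + _]big_mkcond.
  rewrite [X in _ = _ + _ + X]big_mkcond -!big_split /=.
  apply: eq_bigr => -[a b] _ /=; rewrite -val_eqE /=; case: ltngtP => _; ring.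
rewrite mulrDr -[leLHS]addr0 lerD //; last first.
  by rewrite mulr_ge0 // sumr_ge0 // => a _; rewrite sqr_ge0.
rewrite mulr_sumr [leRHS]big_mkcond; apply: ler_sum => e _; rewrite /c.
case: ifP => _; last by rewrite expr0n.
by have := sqr_ge0 (z e.1 ord0 * z' e.2 ord0 - z e.2 ord0 * z' e.1 ord0); lra.
Qed.

(** A single term of the exponential series; adding both signs of t removes the absolute value. *)
Lemma abs_pow_le_exp (y t : R) q : 0 < t ->
  `|y| ^+ q.+1 <= (q.+1)`!%:R / t ^+ q.+1 * (expR (t * y) + expR (- t * y)).
Proof.
move=> t0; have f0 : 0 < (q.+1)`!%:R :> R by rewrite ltr0n fact_gt0.
have h := @expR_ge1Dxn R (t * `|y|) q; rewrite mulr_ge0 ?(ltW t0) // in h.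
have {}h := h isT.
have h2 : expR (t * `|y|) <= expR (t * y) + expR (- t * y).
  have [y0|y0] := leP 0 y.
    by rewrite ger0_norm // lerDl expR_ge0.
  by rewrite ltr0_norm // mulrN mulNr lerDr expR_ge0.
rewrite -mulrA mulrC -mulrA ler_pdivlMl ?exprn_gt0 // -exprMn.
rewrite -ler_pdivrMr //; move: h h2; lra.
Qed.

Lemma tp_moment_form n (z z' : 'cV[R]_n) q t : (0 < q)%N -> 0 < t -> dot z z <= 1 -> dot z' z' <= 1 ->
  Ex tpmu (fun w => `|dot z (rsm tpval w *m z')| ^+ q) <=
  q`!%:R / t ^+ q * (2 * expR (16 * t ^+ 2)).
Proof.
case: q => // q _ t0 z1 z1'.
apply: le_trans (Ex_le (@tpmu_ge0 n) (fun w => abs_pow_le_exp _ q t0)) _.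
rewrite ExZ ExD ler_wpM2l ?divr_ge0 ?exprn_ge0 ?(ltW t0) //.
have := tp_mgf t z1 z1'; have := tp_mgf (- t) z1 z1'; rewrite sqrrN; lra.
Qed.

Lemma bigmax_pow (I : finType) (P : pred I) (F : I -> R) q :
  (0 < q)%N -> (forall i, 0 <= F i) ->
  (\big[Num.max/0]_(i | P i) F i) ^+ q <= \sum_(i | P i) F i ^+ q.
Proof.
case: q => // q _ F0; have [_ //] : 0 <= \big[Num.max/0]_(i | P i) F i /\
  (\big[Num.max/0]_(i | P i) F i) ^+ q.+1 <= \sum_(i | P i) F i ^+ q.+1.
elim/big_rec2: _ => [|i y x _ [x0 xy] /=]; first by rewrite expr0n.
have f0 : 0 <= F i ^+ q.+1 by rewrite exprn_ge0.
rewrite le_max x0 orbT; split=> //; have y0 : 0 <= x ^+ q.+1 by rewrite exprn_ge0.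
by case: (leP (F i) x) => _; lra.
Qed.

Lemma fact_le_exp q : (q`! <= q ^ q)%N.
Proof.
elim: q => // q IH; rewrite factS expnS leq_mul2l /=.
by apply: leq_trans IH _; case: q => // q; rewrite leq_exp2r.
Qed.

(** Moments of order r are taken at t = sqrt r, and the maximum over pairs of net points is bounded
    by the sum. After the r-th root: 2 from [net_opb], 2 absorbing the factor of the moment bound,
    e^16 sqrt r from the moments and (4 e^16)^2 from the pairs, hence 64 e^48 sqrt r. *)
Lemma tp_trace r m : (0 < m)%N -> r = m.*2 ->
  Ex tpmu (fun w => \tr (rsm (n := r) tpval w ^+ r)) <=
  r%:R * (64 * expR 48 * Num.sqrt r%:R) ^+ r.
Proof.
move=> m0 rm; have r0 : (0 < r)%N by rewrite rm double_gt0.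
pose b := (4 * r)%N; pose s : R := Num.sqrt r%:R.
have s0 : 0 < s by rewrite sqrtr_gt0 ltr0n.
have ss : s * s = r%:R by rewrite -expr2 sqr_sqrtr ?ler0n.
pose net := [pred c : _ * _ | (c.1 \in @netc R r b) && (c.2 \in @netc R r b)].
pose F (w : {ffun 'I_r * 'I_r -> bool})
  (c : {ffun 'I_r -> bool * 'I_b.+1} * {ffun 'I_r -> bool * 'I_b.+1}) := `|dot (netpt c.1) (rsm tpval w *m netpt c.2)| : R.
have step w : \tr (rsm (n := r) tpval w ^+ r) <=
    r%:R * 2 ^+ r * \sum_(c | net c) F w c ^+ r.
  pose M := \big[Num.max/0]_(c | net c) F w c.
  have M0 : 0 <= M by rewrite /M; elim/big_ind: _ => // [x y x0 y0|c _]; rewrite ?le_max ?x0 ?normr_ge0.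
  have hM : opb (rsm tpval w) (2 * M).
    apply: (@net_opb _ _ b) => // c c' cn cn'.
    apply: (le_trans (y := F w (c, c'))) => //.
    by apply: (@le_bigmax_cond _ _ _ _ (c, c')); rewrite /= cn cn'.
  have := mxtrace_expr_opb m (rsm_sym _ _) (mulr_ge0 (ler0n _ _) M0) hM.
  rewrite -rm => /le_trans; apply; rewrite exprMn mulrA ler_wpM2l ?mulr_ge0 ?exprn_ge0 //.
  by apply: bigmax_pow => // c; exact: normr_ge0.
apply: le_trans (Ex_le (@tpmu_ge0 r) step) _; rewrite ExZ Ex_sum -mulrA ler_wpM2l //.
have mom c : net c -> Ex tpmu (fun w => F w c ^+ r) <= 2 * (s * expR 16) ^+ r.
  case: c => c c' /andP[/= cn cn']; rewrite inE in cn; rewrite inE in cn'.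
  apply: le_trans (tp_moment_form r0 s0 cn cn') _.
  rewrite expr2 ss expRM_natr mulrCA ler_wpM2l // exprMn ler_wpM2r ?exprn_ge0 ?expR_ge0 //.
  rewrite ler_pdivrMr ?exprn_gt0 // -exprMn ss -natrX ler_nat; exact: fact_le_exp.
apply: le_trans (ler_wpM2l _ (ler_sum _ mom)) _; first by rewrite exprn_ge0.
rewrite -(mulr1 (2 * _)) -mulr_sumr -(pair_big (mem (@netc R r b)) (mem (@netc R r b)) (fun _ _ => 1)) /=.
pose T : R := \sum_(c | c \in @netc R r b) 1.
have hn : T <= _ := net_card b r0.
rewrite (_ : \sum_(i | _) _ = T * T); last first.
  by rewrite /T mulr_suml; apply: eq_bigr => c _; rewrite mul1r.
have T0 : 0 <= T by apply: sumr_ge0.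
apply: (le_trans (y := 2 ^+ r * (2 ^+ r * (s * expR 16) ^+ r * ((4 * expR 16) ^+ r * (4 * expR 16) ^+ r)))).
  rewrite ler_wpM2l ?exprn_ge0 // ler_pM //.
  - by rewrite !mulr_ge0 ?exprn_ge0 ?mulr_ge0 ?expR_ge0 ?(ltW s0).
  - by rewrite mulr_ge0.
  - rewrite ler_wpM2r ?exprn_ge0 ?mulr_ge0 ?expR_ge0 ?(ltW s0) //.
    by rewrite -(prednK r0) exprS ler_peMr // exprn_ege1 // ler1n.
  - by rewrite ler_pM.
rewrite -!exprMn -/s le_eqVlt; apply/orP; left; apply/eqP; congr (_ ^+ _).
have -> : 48 = 16 + 16 + 16 :> R by ring.
by rewrite !expRD; ring.
Qed.

End TwoPointEnsemble.

(** * Norm tail for centred entries with moments at most p *)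

Section NormBound.
Context {R : realType} {n : nat} {B : finType}.
Variables (mu y : 'I_n * 'I_n -> B -> R) (p : R).
Hypotheses (mu_ge0 : forall e b, 0 <= mu e b) (mu_sum : forall e, \sum_b mu e b = 1).
Hypotheses (p01 : 0 <= p <= 1) (centred : forall e, \sum_b mu e b * y e b = 0).
Hypothesis moments : forall e j, (2 <= j)%N -> `|\sum_b mu e b * y e b ^+ j| <= p.

Lemma Ex_mxtrace_walk (n' : nat) (B' : finType) (mu' y' : 'I_n' * 'I_n' -> B' -> R) l :
  Ex mu' (fun w => \tr (rsm y' w ^+ l.+1)) =
  \sum_(u : {ffun 'I_l.+1 -> 'I_n'})
    (noloop u)%:R * \prod_e \sum_b mu' e b * y' e b ^+ mult u e.
Proof.
under Ex_ext => w do rewrite mxtrace_walk.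
rewrite Ex_sum; apply: eq_bigr => u _; exact: Ex_walk.
Qed.

(** With r = 2m >= n p + m the comparison gives n/r times the number of good walks on r vertices.
    [tp_trace] bounds that number, and its prefactor r cancels. *)
Lemma Ex_mxtrace_le m : (0 < m)%N -> n%:R * p <= m%:R ->
  Ex mu (fun w => \tr (rsm y w ^+ m.*2)) <=
  n%:R * (64 * expR 48 * Num.sqrt m.*2%:R) ^+ m.*2.
Proof.
move=> m0 npm; pose r := m.*2.
have r0 : 0 < r%:R :> R by rewrite ltr0n double_gt0.
have [l lr] : exists l, l.+1 = r by exists r.-1; rewrite prednK // double_gt0.
have tp := tp_trace (R := R) m0 (erefl r).
rewrite -/r -{1}lr Ex_mxtrace_walk.
apply: (le_trans (y := \sum_(u : {ffun 'I_l.+1 -> 'I_n} | good u) p ^+ (nval u).-1)).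
  rewrite [leRHS]big_mkcond; apply: ler_sum => u _.
  have h := @walk_moment_le R l n (fun e j => \sum_b mu e b * y e b ^+ j) _ _ u p p01 moments.
  apply: le_trans (h _ _) _.
  - by move=> e; under eq_bigr => b _ do rewrite expr0 mulr1; exact: mu_sum.
  - by move=> e; under eq_bigr => b _ do rewrite expr1; exact: centred.
  - by case: (good u); rewrite ?mul1r ?mul0r.
have hc := @good_walks_compare R l n r m p.
apply: le_trans (hc _ _ _ _) _.
- by rewrite /r -addnn -[X in (X < _)%N]addn0 ltn_add2l.
- by case/andP: p01.
- by rewrite /r -addnn natrD lerD2r.
- by move=> k w; apply: good_nval.
rewrite -mulrA ler_wpM2l ?ler0n // ler_pdivrMl //.
apply: le_trans tp.
rewrite (@Ex_ext _ _ _ tpmu _ (fun w => \tr (rsm tpval w ^+ l.+1))); last by rewrite lr.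
rewrite Ex_mxtrace_walk big_mkcond.
apply: ler_sum => u _.
have := @walk_moment_ge R l r (fun e j => \sum_b tpmu e b * tpval e b ^+ j) _ _ u.
move=> /(_ (@tp_moment0 _ _) (@tp_moment1 _ _) (@tp_moment_ge _ _)).
by case: (good u).
Qed.

(** Markov's inequality for the trace of the power 2m, m = 2^j. Replacing e^48 by e^49 buys the
    factor exp(-2m). *)
Lemma norm_tail j N : n%:R * p <= (2 ^ j)%:R ->
  N = 64 * expR 49 * Num.sqrt (2 ^ j).*2%:R ->
  Ex mu (fun w => (~~ `[< opb (rsm y w) N >])%:R) <= n%:R * expR (- (2 ^ j).*2%:R) :> R.
Proof.
move=> npj NE; set m := (2 ^ j)%N in npj NE *; pose r := m.*2.
have m0 : (0 < m)%N by rewrite expn_gt0.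
have s0 : 0 < Num.sqrt r%:R :> R by rewrite sqrtr_gt0 ltr0n double_gt0.
have N0 : 0 < N by rewrite NE !mulr_gt0 ?expR_gt0.
have Nr : 0 < N ^+ r by rewrite exprn_gt0.
apply: (le_trans (y := Ex mu (fun w => (N ^+ r)^-1 * \tr (rsm y w ^+ r)))).
  apply: Ex_le => // w; case: asboolP => /= h.
    by rewrite mulr_ge0 ?invr_ge0 ?(ltW Nr) // mxtrace_expr_sym ?rsm_sym // frob2_ge0.
  rewrite ler_pdivlMl // mulr1 leNgt; apply/negP => /ltW h'; apply: h.
  by apply: (sym_opb_of_trace (j := j)); rewrite ?rsm_sym.
rewrite ExZ; have := Ex_mxtrace_le m0 npj; rewrite -/r => h.
rewrite ler_pdivrMl //; apply: le_trans h _; rewrite mulrCA ler_wpM2l ?ler0n //.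
have -> : expR (- r%:R) = expR (-1) ^+ r :> R by rewrite -expRM_natr mulN1r.
rewrite -exprMn NE lerXn2r ?nnegrE ?mulr_ge0 ?expR_ge0 ?(ltW s0) //.
have -> : 48 = 49 + -1 :> R by ring.
by rewrite expRD le_eqVlt; apply/orP; left; apply/eqP; rewrite -/r; ring.
Qed.

End NormBound.

(** * Concentration in the signed stochastic block model *)

(** The 64 e^49 of [norm_tail], times 2 because the entries of [ysigned] and [yabs] are halved,
    times 2 because 2^j <= 2 n p gives sqrt(2 * 2^j) <= 2 sqrt(n p). *)
Definition normcst {R : realType} : R := 256 * expR 49.

Lemma normcst_ge2 {R : realType} : 2 <= @normcst R.
Proof. by rewrite /normcst; have := expR_ge1Dx (49 : R); lra. Qed.

Section SSBMConcentration.
Context {R : realType} {n k : nat}.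
Variables (sigma : 'I_n -> 'I_k) (p eta : R).

Definition smu (e : 'I_n * 'I_n) (b : bool * bool) : R :=
  if (e.1 < e.2)%N then pair_weight p eta b else (b == (false, false))%:R.

Lemma ssbm_probE (E : outcome n -> Prop) :
  ssbm_prob p eta E = Ex smu (fun w => `[< E w >]%:R).
Proof. by apply: eq_bigr => w _; case: asbool; rewrite ?mulr1 ?mulr0. Qed.

Hypotheses (p01 : 0 <= p <= 1) (eta01 : 0 <= eta <= 1).

Lemma big_bool2 (F : bool * bool -> R) : \sum_b F b =
  F (true, true) + F (true, false) + (F (false, true) + F (false, false)).
Proof.
rewrite (eq_bigr (fun b => F (b.1, b.2))) => [|[] //].
by rewrite -(pair_bigA _ (fun a b => F (a, b))) !big_bool.
Qed.

Lemma smu_ge0 e b : 0 <= smu e b.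
Proof.
rewrite /smu /pair_weight; case: ifP => _; last by rewrite ler0n.
have /andP[? ?] := p01; have /andP[? ?] := eta01.
by rewrite mulr_ge0 //; case: ifP => _; rewrite ?subr_ge0.
Qed.

Lemma smu_sum e : \sum_b smu e b = 1.
Proof.
rewrite big_bool2 /smu /pair_weight; case: ifP => _ /=; first by ring.
by rewrite !add0r.
Qed.

Lemma ssbm_prob_ge (I : finType) (E G1 G2 : outcome n -> Prop) (G3 : I -> outcome n -> Prop) :
  (forall w, G1 w -> G2 w -> (forall a, G3 a w) -> E w) ->
  1 - Ex smu (fun w => (~~ `[< G1 w >])%:R) - Ex smu (fun w => (~~ `[< G2 w >])%:R)
    - \sum_a Ex smu (fun w => (~~ `[< G3 a w >])%:R) <= ssbm_prob p eta E.
Proof.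
move=> h; rewrite ssbm_probE -Ex_sum -{1}(Ex_cst smu_sum 1) !lerBlDr -!ExD.
apply: Ex_le; first exact: smu_ge0.
move=> w; have S0 : 0 <= \sum_a (~~ `[< G3 a w >])%:R :> R by apply: sumr_ge0.
case: (asboolP (E w)) => /= hE.
  by case: `[< G1 w >]; case: `[< G2 w >] => /=; lra.
case: (asboolP (G1 w)) => /= h1; last by case: `[< G2 w >] => /=; lra.
case: (asboolP (G2 w)) => /= h2; last by lra.
have [a ha] : exists a, ~ G3 a w.
  by apply: contrapT => hn; apply: hE; apply: h => // a; apply: contrapT => ha; apply: hn; exists a.
rewrite (bigD1 a) //=; case: asboolP => //= _.
have : 0 <= \sum_(b | b != a) (~~ `[< G3 b w >])%:R :> R by apply: sumr_ge0.
by lra.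
Qed.

(** For values in [-1, 1] the second moment dominates all higher ones. *)
Lemma moments_of_variance (y : 'I_n * 'I_n -> bool * bool -> R) (q : R) e j :
  (forall b, `|y e b| <= 1) -> \sum_b smu e b * y e b ^+ 2 <= q -> (2 <= j)%N ->
  `|\sum_b smu e b * y e b ^+ j| <= q.
Proof.
move=> y1 hq j2; apply: le_trans hq; apply: le_trans (ler_norm_sum _ _ _) _.
apply: ler_sum => b _; rewrite normrM ger0_norm ?smu_ge0 // ler_wpM2l ?smu_ge0 //.
rewrite normrX -[y e b ^+ 2]real_normK ?num_real // ler_wiXn2l //.
Qed.

Definition sgn (a b : 'I_n) : R := if sigma a == sigma b then 1 else -1.

Lemma sgn_sqr a b : sgn a b * sgn a b = 1.
Proof. by rewrite /sgn; case: ifP => _; rewrite ?mulr1 // mulrNN mulr1. Qed.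

Lemma sgnC a b : sgn a b = sgn b a.
Proof. by rewrite /sgn eq_sym. Qed.

(** [EA] and [EJ] are the means of the signed adjacency matrix and of its entrywise absolute
    value. *)
Definition EA : 'M[R]_n :=
  \matrix_(a, b) if a == b then 0 else p * (1 - 2 * eta) * sgn a b.
Definition EJ : 'M[R]_n := \matrix_(a, b) if a == b then 0 else p.
Definition absmx (A : 'M[R]_n) := Apos A + Aneg A.

(** The centred signed entry ranges in [-2, 2]; halving brings it into [-1, 1]. The unsigned entry
    is halved too, so that both noises share one constant. *)
Definition ysigned (e : 'I_n * 'I_n) (b : bool * bool) : R :=
  if (e.1 < e.2)%N then sgn e.1 e.2 *
    ((if b.1 then if b.2 then -1 else 1 else 0) - p * (1 - 2 * eta)) / 2 else 0.
Definition yabs (e : 'I_n * 'I_n) (b : bool * bool) : R :=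
  if (e.1 < e.2)%N then (b.1%:R - p) / 2 else 0.

Lemma adj_centred w : adj sigma w - EA = 2 *: rsm ysigned w.
Proof.
apply/matrixP => a b; rewrite !mxE /entry_val /ysigned -[a == b]val_eqE /=.
case: (ltngtP a b) => ab; last by rewrite mulr0 subr0.
  by rewrite -/(sgn a b); case: ifP => _; [case: ifP => _|]; field.
by rewrite -/(sgn b a) (sgnC a b); case: ifP => _; [case: ifP => _|]; field.
Qed.

Lemma absmxE (A : 'M[R]_n) a b : absmx A a b = `|A a b|.
Proof.
rewrite !mxE; have [h|h] := leP 0 (A a b).
  by rewrite ger0_norm // (max_idPr _) ?oppr_le0 // addr0.
by rewrite ltr0_norm // (max_idPl _) ?add0r // oppr_ge0 ltW.
Qed.

Lemma abs_adjE w a b : absmx (adj sigma w) a b =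
  rsm (fun _ (b : bool * bool) => (b.1)%:R) w a b.
Proof.
rewrite absmxE !mxE /entry_val.
by case: (ltngtP a b) => ab; rewrite ?normr0 //; case: ifP => _; rewrite ?normr0 //;
  case: ifP => _; case: ifP => _; rewrite ?mulr1 ?mulrN1 ?opprK ?normrN ?normr1.
Qed.

Lemma abs_centred w : absmx (adj sigma w) - EJ = 2 *: rsm yabs w.
Proof.
apply/matrixP => a b; rewrite mxE abs_adjE !mxE /yabs -val_eqE /=.
by case: (ltngtP a b) => ab; [field|field|rewrite mulr0 subr0].
Qed.

Lemma ysigned_centred e : \sum_b smu e b * ysigned e b = 0.
Proof.
rewrite big_bool2 /smu /ysigned /pair_weight; case: ifP => _ /=; first by field.
by rewrite !mulr0 !addr0.
Qed.

Lemma yabs_centred e : \sum_b smu e b * yabs e b = 0.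
Proof.
rewrite big_bool2 /smu /yabs /pair_weight; case: ifP => _ /=; first by field.
by rewrite !mulr0 !addr0.
Qed.

Lemma ysigned_moments e j : (2 <= j)%N -> `|\sum_b smu e b * ysigned e b ^+ j| <= p.
Proof.
have /andP[p0 p1] := p01; have /andP[e0 e1] := eta01.
have pe : -1 <= p * (1 - 2 * eta) <= 1 by apply/andP; split; nra.
apply: moments_of_variance => [b|].
  rewrite /ysigned; case: ifP => _; last by rewrite normr0.
  have /andP[? ?] := pe; rewrite ler_norml /sgn.
  by case: (sigma e.1 == sigma e.2); case: b.1; case: b.2; apply/andP; split; lra.
rewrite big_bool2 /smu /ysigned /pair_weight; case: ifP => _ /=; last by rewrite !expr0n /= !mulr0 !addr0.
rewrite !exprMn !(expr2 (sgn _ _)) sgn_sqr exprVn.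
set q := p * (1 - 2 * eta).
have -> : p * eta * (1 * (-1 - q) ^+ 2 * (2 ^+ 2)^-1) +
   p * (1 - eta) * (1 * (1 - q) ^+ 2 * (2 ^+ 2)^-1) +
   ((1 - p) * eta * (1 * (0 - q) ^+ 2 * (2 ^+ 2)^-1) +
    (1 - p) * (1 - eta) * (1 * (0 - q) ^+ 2 * (2 ^+ 2)^-1)) = (p - q ^+ 2) / 4.
  by rewrite /q; field.
by have := sqr_ge0 q; lra.
Qed.

Lemma yabs_moments e j : (2 <= j)%N -> `|\sum_b smu e b * yabs e b ^+ j| <= p.
Proof.
have /andP[p0 p1] := p01.
apply: moments_of_variance => [b|].
  rewrite /yabs; case: ifP => _; last by rewrite normr0.
  by rewrite ler_norml; case: b.1 => /=; apply/andP; split; lra.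
rewrite big_bool2 /smu /yabs /pair_weight; case: ifP => _ /=; last by rewrite !expr0n /= !mulr0 !addr0.
have -> : p * eta * ((1 - p) / 2) ^+ 2 + p * (1 - eta) * ((1 - p) / 2) ^+ 2 +
   ((1 - p) * eta * ((0 - p) / 2) ^+ 2 +
    (1 - p) * (1 - eta) * ((0 - p) / 2) ^+ 2) = (p - p ^+ 2) / 4 by field.
by have := sqr_ge0 p; lra.
Qed.

Lemma degs_dot w a : degs (adj sigma w) a =
  dot (delta_mx a ord0) (rsm (fun _ (b : bool * bool) => (b.1)%:R) w *m const_mx 1) :> R.
Proof.
rewrite dotE trmx_delta -rowE mxE /degs -/(absmx _) !mxE.
by apply: eq_bigr => b _; rewrite abs_adjE.
Qed.

(** The pairs containing a are counted by evaluating [dot_rsm] on the deterministic adjacency matrix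
    of the complete graph. *)
Lemma sum_incident (a : 'I_n) : \sum_(e : 'I_n * 'I_n | (e.1 < e.2)%N)
  ((delta_mx a ord0 : 'cV[R]_n) e.1 ord0 + (delta_mx a ord0 : 'cV[R]_n) e.2 ord0) = n%:R - 1.
Proof.
have := @dot_rsm R n bool (fun _ _ => 1) [ffun=> true] (delta_mx a ord0) (const_mx 1).
under [in RHS]eq_bigr => e _ do rewrite !mxE !mulr1 mul1r.
under [in X in _ -> X]eq_bigr => e _ do rewrite !mxE.
move=> <-; rewrite dotE trmx_delta -rowE mxE mxE.
rewrite (bigD1 a) //= !mxE ltnn mul0r add0r.
rewrite (eq_bigr (fun=> 1)) => [|b ba]; last first.
  by rewrite !mxE mulr1; move: ba; rewrite -val_eqE /=; case: ltngtP.
by rewrite sumr_const cardC1 card_ord -subn1 natrB // (leq_trans _ (ltn_ord a)).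
Qed.

(** Chernoff's bound with parameter 1: each of the n-1 pairs contributes 1 - p + p/e <= exp(-p/2).
    Only this crude lower tail is asked of individual degrees; it keeps the inverse square roots
    bounded. *)
Lemma degree_tail a :
  Ex smu (fun w => (~~ `[< dbar n p / 4 <= degs (adj sigma w) a >])%:R) <= expR (- (dbar n p / 4)).
Proof.
have /andP[p0 p1] := p01; have /andP[e0 e1] := eta01.
pose c (e : 'I_n * 'I_n) : R := if (e.1 < e.2)%N then
   (delta_mx a ord0 : 'cV[R]_n) e.1 ord0 + (delta_mx a ord0 : 'cV[R]_n) e.2 ord0 else 0.
have c01 e : c e = 0 \/ c e = 1.
  rewrite /c; case: ifP => e12; last by left.
  rewrite !mxE eqxx !andbT; case: eqP => [ea|_]; case: eqP => [eb|_] /=; rewrite ?addr0 ?add0r;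
    try by [left|right].
  by rewrite ea eb ltnn in e12.
apply: (le_trans (y := Ex smu (fun w => expR (dbar n p / 4) *
    \prod_e expR (- (c e * (w e).1%:R))))).
  apply: Ex_le; first exact: smu_ge0.
  move=> w; rewrite -expR_sum -expRD; case: asboolP => /= h; first exact: expR_ge0.
  rewrite -[1%:R]expR0 ler_expR sumrN subr_ge0 ltW //.
  move/negP: h; rewrite -ltNge degs_dot dot_rsm; congr (_ < _).
  rewrite big_mkcond; apply: eq_bigr => e _; rewrite /c; case: ifP => _; last by rewrite mul0r.
  by rewrite ![const_mx _ _ _]mxE !mulr1 mulrC.
rewrite ExZ (Ex_prod smu (fun e b => expR (- (c e * b.1%:R)))).
have hprod : \prod_e (\sum_b smu e b * expR (- (c e * b.1%:R))) <= expR (- (dbar n p / 2)).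
  apply: (le_trans (y := \prod_e expR (- (p / 2 * c e)))).
    apply: ler_prod => e _; rewrite sumr_ge0 /=; last first.
      by move=> b _; rewrite mulr_ge0 ?smu_ge0 ?expR_ge0.
    case: (c01 e) => ce.
      rewrite ce mulr0 oppr0 expR0 -[X in _ <= X](smu_sum e).
      by apply: ler_sum => b _; rewrite mul0r oppr0 expR0 mulr1.
    have e12 : (e.1 < e.2)%N.
      by move: ce; rewrite /c; case: ifP => // _ /eqP; rewrite eq_sym oner_eq0.
    rewrite big_bool2 /smu e12 /pair_weight ce /= !mulr1 mulr0 oppr0 expR0.
    have h1 := expR_ge1Dx (- (p / 2)); have h2 := expR_ge1Dx (1 : R).
    have h3 := expRxMexpNx_1 (1 : R); have h4 := expR_gt0 (-1 : R).
    by nra.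
  rewrite -expR_sum ler_expR sumrN -mulr_sumr lerN2 /c -big_mkcond /= sum_incident /dbar.
  by rewrite le_eqVlt; apply/orP; left; apply/eqP; field.
apply: le_trans (ler_wpM2l (expR_ge0 _) hprod) _; rewrite -expRD ler_expR.
by lra.
Qed.

Lemma exists_pow2 (x : R) : 1 <= x -> exists j, x <= (2 ^ j)%:R <= 2 * x.
Proof.
move=> x1; have x0 : 0 <= x by lra.
have /andP[h1 h2] := truncn_itv x0.
have t0 : (0 < Num.truncn x)%N by rewrite truncn_gt0.
exists (trunc_log 2 (Num.truncn x)).+1.
have := trunc_log_bounds (isT : (1 < 2)%N) t0; set t := Num.truncn x in h1 h2 t0 *.
set j := trunc_log 2 t => /andP[h3 h4]; apply/andP; split.
  by rewrite (le_trans (ltW h2)) // ler_nat.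
by rewrite expnS natrM ler_pM2l // (le_trans _ h1) // ler_nat.
Qed.

(** Union bound over two norm tails and n degree tails. Rounding n p up to a power of two meets the
    requirement of [norm_tail]. *)
Lemma ssbm_good_event (E : outcome n -> Prop) : 1 <= n%:R * p ->
  (forall w N, N = normcst * Num.sqrt (n%:R * p) ->
     opb (adj sigma w - EA) N -> opb (absmx (adj sigma w) - EJ) N ->
     (forall a, dbar n p / 4 <= degs (adj sigma w) a) -> E w) ->
  1 - 2 * (n%:R * expR (- (2 * (n%:R * p)))) - n%:R * expR (- (dbar n p / 4)) <= ssbm_prob p eta E.
Proof.
move=> np1 h; have [j /andP[j1 j2]] := exists_pow2 np1.
pose M : R := 64 * expR 49 * Num.sqrt (2 ^ j).*2%:R.
have MN (A : 'M[R]_n) : opb A M -> opb (2 *: A) (normcst * Num.sqrt (n%:R * p)).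
  move=> hA; apply: opb_le (opbZ 2 hA); rewrite ger0_norm // /M /normcst.
  have -> : 256 * expR 49 * Num.sqrt (n%:R * p) =
      2 * (64 * expR 49 * (2 * Num.sqrt (n%:R * p))) :> R by ring.
  rewrite ler_pM2l // ler_pM2l ?mulr_gt0 ?expR_gt0 //.
  have -> : 2 = Num.sqrt 4 :> R by rewrite -[2]ger0_norm // -sqrtr_sqr; congr Num.sqrt; ring.
  rewrite -sqrtrM // ler_sqrt; last by lra.
  by rewrite -muln2 natrM; lra.
have t1 := norm_tail smu_ge0 smu_sum p01 ysigned_centred ysigned_moments j1 (erefl M).
have t2 := norm_tail smu_ge0 smu_sum p01 yabs_centred yabs_moments j1 (erefl M).
have t3 : \sum_a Ex smu (fun w => (~~ `[< dbar n p / 4 <= degs (adj sigma w) a >])%:R)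
    <= n%:R * expR (- (dbar n p / 4)).
  apply: le_trans (ler_sum _ (fun a _ => degree_tail a)) _.
  by rewrite sumr_const card_ord mulr_natl.
have t4 : n%:R * expR (- (2 ^ j).*2%:R) <= n%:R * expR (- (2 * (n%:R * p))).
  by rewrite ler_wpM2l // ler_expR lerN2 -muln2 natrM mulrC ler_pM2r.
have := @ssbm_prob_ge _ E (fun w => opb (rsm ysigned w) M) (fun w => opb (rsm yabs w) M)
  (fun a w => dbar n p / 4 <= degs (adj sigma w) a).
have hw w : opb (rsm ysigned w) M -> opb (rsm yabs w) M ->
    (forall a, dbar n p / 4 <= degs (adj sigma w) a) -> E w.
  by move=> h1 h2 h3; apply: (h w _ erefl) h3; rewrite ?adj_centred ?abs_centred; apply: MN.
by move=> /(_ hw); move: t1 t2 t3 t4; lra.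
Qed.

End SSBMConcentration.

(** * Distance between the Laplacian and its population version *)

Section LaplacianPerturbation.
Context {R : realType} {n k : nat}.
Variables (sigma : 'I_n -> 'I_k) (p eta : R).

Definition Lbar : 'M[R]_n := 1%:M - (dbar n p)^-1 *: EA sigma p eta.

(** The dense case is the regularised one at zero parameters, so one perturbation bound serves
    both. *)
Lemma LsymE w : Lsym sigma w = Lgamma sigma (0 : R) 0 w.
Proof.
rewrite /Lsym /Lgamma.
have -> : (fun a => degs (adj sigma w) a + (0 + 0) : R) = degs (adj sigma w).
  by apply/funext => a; rewrite !addr0.
by rewrite subrr mul0r scale0r addr0.
Qed.

Lemma opb_const1 : opb (const_mx 1 : 'M[R]_n) n%:R.
Proof.
apply: opb_frob; rewrite ?ler0n // /frob2.
under eq_bigr => i _ do under eq_bigr => j _ do rewrite mxE expr1n.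
by rewrite !sumr_const card_ord -mulrnA -natrX mulnn.
Qed.

(** |sqrt(d/x) - 1| = |x - d| / (sqrt x (sqrt x + sqrt d)), and sqrt x >= sqrt d / 2 bounds the
    denominator below by d/2. *)
Lemma inv_sqrt_ratio (d x : R) : 0 < d -> d / 4 <= x ->
  (Num.sqrt d / Num.sqrt x - 1) ^+ 2 <= 4 * (x - d) ^+ 2 / d ^+ 2 /\
  `|(Num.sqrt x)^-1| <= 2 / Num.sqrt d.
Proof.
move=> d0 dx; have x0 : 0 < x by lra.
set u := Num.sqrt d; set v := Num.sqrt x.
have u0 : 0 < u by rewrite sqrtr_gt0.
have v0 : 0 < v by rewrite sqrtr_gt0.
have uu : u ^+ 2 = d by rewrite sqr_sqrtr // ltW.
have vv : v ^+ 2 = x by rewrite sqr_sqrtr // ltW.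
have uv : u <= 2 * v.
  by rewrite -ler_sqr ?nnegrE ?mulr_ge0 ?(ltW u0) ?(ltW v0) // exprMn uu vv; lra.
split; last first.
  by rewrite ger0_norm ?invr_ge0 ?(ltW v0) // ler_pdivlMr // mulrC ler_pdivrMr.
rewrite -vv -uu.
have -> : (u / v - 1) ^+ 2 = (u - v) ^+ 2 / v ^+ 2 by field; rewrite gt_eqF.
rewrite ler_pdivrMr ?exprn_gt0 // mulrAC ler_pdivlMr ?exprn_gt0 ?exprn_gt0 //.
have -> : 4 * (v ^+ 2 - u ^+ 2) ^+ 2 * v ^+ 2 = (u - v) ^+ 2 * (2 * v * (u + v)) ^+ 2 by ring.
rewrite ler_wpM2l ?sqr_ge0 // ler_sqr ?nnegrE ?sqr_ge0 //; last by rewrite !mulr_ge0 ?addr_ge0 // ltW.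
by rewrite expr2 ler_pM ?(ltW u0) //; lra.
Qed.

Lemma EA_tr : (EA sigma p eta)^T = EA sigma p eta.
Proof. by apply/matrixP => a b; rewrite !mxE eq_sym sgnC. Qed.

(** With S = d^(-1/2) (1 + T) and F = [EA], the error is S (A - F) S, the regularisation S G S, and
    (T F (1 + T) + F T)/d. Their norms are at most 4N/d, 4g/d and (12 + 6)(N + g)/d, which gives
    22. *)
Lemma Lgamma_perturb w gp gm N :
  0 < p -> 0 <= eta <= 1 -> (2 <= n)%N -> 0 <= N -> 0 <= gp -> 0 <= gm ->
  opb (adj sigma w - EA sigma p eta) N -> opb (absmx (adj sigma w) - EJ p) N ->
  (forall a, dbar n p / 4 <= degs (adj sigma w) a) ->
  opb (Lgamma sigma gp gm w - Lbar) (22 * (N + (gp + gm)) / dbar n p).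
Proof.
move=> p0 /andP[e0 e1] n2 N0 gp0 gm0 hX hY hD.
set d := dbar n p in hD *; set g := gp + gm; have g0 : 0 <= g by rewrite addr_ge0.
have n2' : 2 <= n%:R :> R by rewrite ler_nat.
have d0 : 0 < d by rewrite mulr_gt0 //; lra.
have npd : n%:R * p <= 2 * d by rewrite /d /dbar; nra.
set A := adj sigma w in hX hY hD *; set F := EA sigma p eta in hX *.
pose x a := degs A a + g; pose u := Num.sqrt d.
have u0 : 0 < u by rewrite sqrtr_gt0.
have uu : u * u = d by rewrite -expr2 sqr_sqrtr // ltW.
have xd a : d / 4 <= x a by rewrite (le_trans (hD a)) // lerDl.
pose t a := u / Num.sqrt (x a) - 1.
pose S := diag_invsqrt x; pose T : 'M[R]_n := diag_mx (\row_a t a).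
have hS : opb S (2 / u).
  by apply: opb_diag => a; rewrite mxE; case: (inv_sqrt_ratio d0 (xd a)).
have SE : S = u^-1 *: (1%:M + T).
  apply/matrixP => a b; rewrite !mxE /t; case: eqP => _ /=; rewrite ?mulr0n ?addr0 ?mulr0 //.
  rewrite !mulr1n addrC subrK mulrA mulVf ?gt_eqF // mul1r //.
have h1T : opb (1%:M + T) 2.
  have -> : 1%:M + T = u *: S by rewrite SE scalerA divff ?gt_eqF // scale1r.
  by apply: opb_le (opbZ u hS); rewrite ger0_norm ?(ltW u0) // mulrC divfK ?gt_eqF.
(* Single degrees may be off by a constant factor; only their l2 fluctuation, which
   is the unsigned noise applied to the all-ones vector, is small. *)
have sumD : \sum_a (degs A a - d) ^+ 2 <= N ^+ 2 * n%:R.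
  have := hY (const_mx 1); rewrite vnorm_leP; last by rewrite mulr_ge0 ?vnorm_ge0.
  rewrite exprMn vnorm_sqr; set D1 := dot _ _; set D2 := dot _ _.
  have -> : D2 = n%:R.
    by rewrite /D2 /dot; under eq_bigr => i _ do rewrite !mxE mulr1; rewrite sumr_const card_ord.
  suff -> : D1 = \sum_a (degs A a - d) ^+ 2 by [].
  apply: eq_bigr => a _; rewrite -expr2; congr (_ ^+ 2).
  rewrite mulmxBl mxE; congr (_ + _); rewrite mxE; congr (- _).
  rewrite mxE (bigD1 a) //= !mxE eqxx mul0r add0r.
  rewrite (eq_bigr (fun=> p)) => [|b ba]; last by rewrite !mxE eq_sym (negbTE ba) mulr1.
  rewrite sumr_const cardC1 card_ord -mulr_natr /d /dbar; congr (_ * _).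
  by rewrite -subn1 natrB // ltnW.
have sumT : \sum_a t a ^+ 2 <= 8 * n%:R * (N ^+ 2 + g ^+ 2) / d ^+ 2.
  apply: (le_trans (y := \sum_a (8 / d ^+ 2 * ((degs A a - d) ^+ 2 + g ^+ 2)))).
    apply: ler_sum => a _; have [h _] := inv_sqrt_ratio d0 (xd a).
    apply: le_trans h _; rewrite [leRHS]mulrAC ler_pM2r ?invr_gt0 ?exprn_gt0 //.
    by rewrite /x; have := sqr_ge0 (degs A a - d - g); lra.
  rewrite -mulr_sumr big_split /= sumr_const card_ord mulrAC ler_pM2r ?invr_gt0 ?exprn_gt0 //.
  by rewrite -mulr_natr; move: sumD; lra.
(* [T] need not be small in operator norm. But the rows of [F] have norm at most p sqrt n, so the
   Frobenius norm of T F only sees the l2 norm of the diagonal of [T]; the constant is 8 * 4 = 32 <=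
   6^2. *)
have hTF : opb (T *m F) (6 * (N + g)).
  apply: opb_frob; first by rewrite mulr_ge0 ?addr_ge0.
  apply: (le_trans (y := \sum_a t a ^+ 2 * (n%:R * p ^+ 2))).
    apply: ler_sum => a _.
    apply: (le_trans (y := \sum_(b < n) t a ^+ 2 * p ^+ 2)); last first.
      by rewrite sumr_const card_ord -mulr_natr le_eqVlt; apply/orP; left; apply/eqP; ring.
    apply: ler_sum => b _; rewrite mul_diag_mx !mxE exprMn ler_wpM2l ?sqr_ge0 //.
    case: eqP => _; first by rewrite expr0n /= sqr_ge0.
    rewrite !exprMn [sgn _ _ _ ^+ 2]expr2 sgn_sqr mulr1 ler_piMr ?sqr_ge0 //.
    rewrite -[_ ^+ 2]real_normK ?num_real // expr_le1 // ler_norml; apply/andP; split; lra.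
  rewrite -mulr_suml; apply: le_trans (ler_wpM2r _ sumT) _.
    by rewrite mulr_ge0 ?sqr_ge0.
  have -> : 8 * n%:R * (N ^+ 2 + g ^+ 2) / d ^+ 2 * (n%:R * p ^+ 2) =
     8 * (N ^+ 2 + g ^+ 2) * ((n%:R * p) / d) ^+ 2 by field; rewrite gt_eqF.
  have h1 : ((n%:R * p) / d) ^+ 2 <= 4.
    have h : 0 <= (n%:R * p) / d <= 2.
      apply/andP; split; last by rewrite ler_pdivrMr.
      by rewrite divr_ge0 ?(ltW d0) // mulr_ge0 // ltW.
    by case/andP: h => ? ?; rewrite expr2; nra.
  have h2 := sqr_ge0 N; have h3 := sqr_ge0 g.
  apply: (le_trans (y := 8 * (N ^+ 2 + g ^+ 2) * 4)); first by rewrite ler_wpM2l //; lra.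
  by have := mulr_ge0 N0 g0; lra.
have hFT : opb (F *m T) (6 * (N + g)).
  have -> : F *m T = (T *m F)^T by rewrite trmx_mul tr_diag_mx EA_tr.
  by apply: opb_tr => //; rewrite mulr_ge0 ?addr_ge0.
pose Gm : 'M[R]_n := ((gp - gm) / n%:R) *: const_mx 1.
have hG : opb Gm g.
  apply: opb_le (opbZ _ opb_const1).
  rewrite normrM normfV [`|n%:R|]ger0_norm // divfK ?gt_eqF //; last by lra.
  by rewrite ler_norml /g; apply/andP; split; lra.
have -> : Lgamma sigma gp gm w - Lbar =
   - (S *m (A - F) *m S + S *m Gm *m S + d^-1 *: (T *m F *m (1%:M + T) + F *m T)).
  have SFS : S *m F *m S = d^-1 *: (F + (T *m F *m (1%:M + T) + F *m T)).
    rewrite SE -scalemxAl -scalemxAl -scalemxAr scalerA -invfM uu; congr (_ *: _).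
    rewrite !(mulmxDl, mulmxDr) !mul1mx !mulmx1.
    move: (T *m F *m T) (T *m F) (F *m T) => a b c.
    by apply/matrixP => i j; rewrite !mxE; ring.
  have -> : S *m (A - F) *m S = S *m A *m S - S *m F *m S by rewrite mulmxBr mulmxBl.
  have -> : Lgamma sigma gp gm w = 1%:M - (S *m A *m S + S *m Gm *m S).
    by rewrite -mulmxDl -mulmxDr.
  rewrite SFS /Lbar -/F -/d.
  move: (S *m A *m S) (S *m Gm *m S) (T *m F *m (1%:M + T) + F *m T) => a b c.
  by apply/matrixP => i j; rewrite !mxE; ring.
apply: opbN.
have hSS M c : 0 <= c -> opb M c -> opb (S *m M *m S) (4 * c / d).
  move=> c0 hM; have s2 : 0 <= 2 / u by rewrite divr_ge0 ?ltW.
  have := opbM (mulr_ge0 s2 c0) (opbM s2 hS hM) hS; apply: opb_le.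
  by rewrite -uu le_eqVlt; apply/orP; left; apply/eqP; field; rewrite gt_eqF.
have q0 : 0 <= 6 * (N + g) by rewrite mulr_ge0 ?addr_ge0.
have h3 := opbZ d^-1 (opbD (opbM q0 hTF h1T) hFT).
apply: opb_le (opbD (opbD (hSS _ _ N0 hX) (hSS _ _ g0 hG)) h3).
rewrite ger0_norm ?invr_ge0 ?(ltW d0) // le_eqVlt; apply/orP; left; apply/eqP.
by field; rewrite gt_eqF.
Qed.

End LaplacianPerturbation.

(** * Perturbation of invariant subspaces *)


Section RealSpectral.
Import complex.

(** The complex spectral theorem gives a similarity to a real diagonal matrix, which [real_similar]
    brings back to the reals. [P] is then known to be invertible, not orthogonal. *)
Lemma sym_diagonalizable (R : realType) n (H : 'M[R]_n) : H^T = H ->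
  exists (P : 'M[R]_n) (d : 'rV[R]_n), P \in unitmx /\ P *m H = diag_mx d *m P.
Proof.
move=> Hs; pose f := real_complex R; pose A := map_mx f H.
have realP m l (M : 'M[R[i]]_(m, l)) : M \is a mxOver Num.real ->
    exists M', M = map_mx f M'.
  move=> /mxOverP h; exists (map_mx (@complex.Re R) M).
  by apply/matrixP => i j; rewrite !mxE /f RRe_real.
have Areal : A \is a mxOver Num.real.
  by apply/mxOverP => i j; rewrite mxE complex_real.
have Asym : A \is symmetricmx.
  by apply/is_hermitianmxP; rewrite expr0 scale1r; apply/matrixP => i j; rewrite !mxE -{1}Hs mxE.
have Aherm := realsym_hermsym Asym Areal.
have Dreal := hermitian_spectral_diag_real Aherm.
have /orthomx_spectralP AE := hermitian_normalmx Aherm.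
have Pu := spectral_unit A.
have sim0 : similar (spectralmx A) A (diag_mx (spectral_diag A)).
  by apply/similarP => //; rewrite {2}AE !mulmxA mulmxV // mul1mx.
have [] := @real_similar _ _ A (diag_mx (spectral_diag A)).
- by exists (spectralmx A).
- exact: Areal.
- by apply/mxOverP => i j; rewrite mxE; case: eqP => _; rewrite ?mulr0n ?real0 // mulr1n (mxOverP Dreal).
move=> P /andP[Preal Punit] /(similarP Punit).
have [P' PE] := realP _ _ _ Preal; have [d dE] := realP _ _ _ Dreal.
rewrite PE dE -map_diag_mx -!map_mxM => /map_mx_inj h.
by exists P', d; split=> //; move: Punit; rewrite PE map_unitmx.
Qed.

End RealSpectral.

(** * Functional calculus and the polar factor *)

Section Polar.
Context {R : realType} {q : nat}.
Variables (P : 'M[R]_q) (d : 'rV[R]_q).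
Hypothesis Pu : P \in unitmx.

Definition fcalc (g : R -> R) : 'M[R]_q :=
  invmx P *m diag_mx (\row_i g (d ord0 i)) *m P.

Lemma fcalcM g h : fcalc g *m fcalc h = fcalc (fun t => g t * h t).
Proof.
rewrite /fcalc !mulmxA -[_ *m P *m invmx P]mulmxA mulmxV // mulmx1.
rewrite -[invmx P *m _ *m diag_mx _]mulmxA mulmx_diag; congr (_ *m diag_mx _ *m _).
by apply/rowP => i; rewrite !mxE.
Qed.

Lemma fcalc1 g : (forall i, g (d ord0 i) = 1) -> fcalc g = 1%:M.
Proof.
move=> h; rewrite /fcalc (_ : \row_i _ = const_mx 1).
  by rewrite diag_const_mx mulmx1 mulVmx.
by apply/rowP => i; rewrite !mxE.
Qed.

Lemma fcalc_ext g h : (forall i, g (d ord0 i) = h (d ord0 i)) -> fcalc g = fcalc h.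
Proof.
by move=> e; congr (_ *m diag_mx _ *m _); apply/rowP => i; rewrite !mxE.
Qed.

(** Symmetry of [fcalc g] means that P P^T commutes with diag(g(d)). Commuting with diag(d) forces
    the entries of P P^T to vanish where the d_i differ, hence gives commutation with every function
    of d. *)
Lemma fcalc_sym g : (fcalc id)^T = fcalc id -> (fcalc g)^T = fcalc g.
Proof.
have key h : ((fcalc h)^T = fcalc h) <->
    P *m P^T *m diag_mx (\row_i h (d ord0 i)) = diag_mx (\row_i h (d ord0 i)) *m (P *m P^T).
  have PTu : P^T \in unitmx by rewrite unitmx_tr.
  set D := diag_mx _.
  have e1 : P *m fcalc h *m P^T = D *m (P *m P^T).
    by rewrite /fcalc !mulmxA mulmxV // mul1mx.
  have e2 : P *m (fcalc h)^T *m P^T = P *m P^T *m D.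
    by rewrite /fcalc !trmx_mul tr_diag_mx trmx_inv -!mulmxA mulVmx // mulmx1.
  rewrite -e1 -e2; split=> [->//|] e.
  by move: e => /(can_inj (mulmxK PTu)) /(can_inj (mulKmx Pu)).
move=> /key h0; apply/key; apply/matrixP => i j.
move/matrixP: h0 => /(_ i j); rewrite !mul_diag_mx !mul_mx_diag !mxE.
set K := \sum_k _ => h0; have [e|ne] := eqVneq (d ord0 i) (d ord0 j); first by rewrite e mulrC.
suff -> : K = 0 by rewrite mul0r mulr0.
apply/eqP; have : K * (d ord0 j - d ord0 i) = 0 by rewrite mulrBr h0; ring.
by move/eqP; rewrite mulf_eq0 subr_eq0 [d _ j == _]eq_sym (negbTE ne) orbF.
Qed.

End Polar.

(* [O] is the polar factor [M (M^T M)^(-1/2)]; since [(1 + Y)(1 - Y) = Z^T Z] with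
   [Y = (M^T M)^(1/2) >= 0], one gets [|1 - Y| <= |Z|^2]. *)
Lemma near_orthogonal (R : realType) n q (M : 'M[R]_q) (Z : 'M[R]_(n, q)) s :
  0 <= s -> s < 1 -> opb Z s -> M^T *m M = 1%:M - Z^T *m Z ->
  exists O : 'M[R]_q, O^T *m O = 1%:M /\ opb (M - O) (s ^+ 2).
Proof.
move=> s0 s1 hZ hM; pose H := Z^T *m Z.
have Hs : H^T = H by rewrite trmx_mul trmxK.
have [P [d [Pu PH]]] := sym_diagonalizable Hs.
have HE : fcalc P d id = H.
  rewrite /fcalc (_ : \row_i _ = d); last by apply/rowP => i; rewrite mxE.
  by rewrite -mulmxA -PH mulKmx.
have dle i : d ord0 i <= s ^+ 2.
  pose x := (row i P)^T.
  have Hx : H *m x = d ord0 i *: x.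
    apply: trmx_inj; rewrite trmx_mul Hs /x trmxK -row_mul PH linearZ /= trmxK.
    by apply/rowP => j; rewrite mul_diag_mx !mxE.
  have x0 : x != 0.
    apply: contraTneq Pu => x0; rewrite -row_free_unit; apply/negP => /row_freeP[B PB].
    have : row i (P *m B) = 0 by rewrite row_mul -[row i P]trmxK -/x x0 trmx0 mul0mx.
    rewrite PB => /rowP /(_ i); rewrite !mxE eqxx => /eqP.
    by rewrite oner_eq0.
  have px : 0 < dot x x by rewrite lt_def dot_eq0 x0 dot_ge0.
  rewrite -(ler_pM2r px) -dotZr -Hx -mulmxA -dot_mull -vnorm_sqr -[dot x x]vnorm_sqr -exprMn.
  by rewrite ler_sqr ?nnegrE ?mulr_ge0 ?vnorm_ge0.
have s21 : s ^+ 2 < 1 by rewrite expr_lt1.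
have d1 i : 0 < 1 - d ord0 i by have := dle i; lra.
have sym g : (fcalc P d g)^T = fcalc P d g by apply: fcalc_sym => //; rewrite HE.
pose Y := fcalc P d (fun t => Num.sqrt (1 - t)).
pose W := fcalc P d (fun t => (Num.sqrt (1 - t))^-1).
(* A symmetric square root of [Y]: it witnesses that [Y] is positive semidefinite. *)
pose Q := fcalc P d (fun t => Num.sqrt (Num.sqrt (1 - t))).
have YW : Y *m W = 1%:M.
  by rewrite fcalcM // fcalc1 // => i; rewrite divff // gt_eqF // sqrtr_gt0.
have WY : W *m Y = 1%:M.
  by rewrite fcalcM // fcalc1 // => i; rewrite mulVf // gt_eqF // sqrtr_gt0.
have QQ : Q *m Q = Y.
  by rewrite fcalcM //; apply: fcalc_ext => i; rewrite -expr2 sqr_sqrtr ?sqrtr_ge0.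
have YY : Y *m Y + H = 1%:M.
  rewrite -HE fcalcM // /fcalc -mulmxDl -mulmxDr -raddfD /=.
  rewrite (_ : _ + _ = const_mx 1) ?diag_const_mx ?mulmx1 ?mulVmx //.
  by apply/rowP => i; rewrite !mxE -expr2 sqr_sqrtr ?subrK // ltW.
have YY' : Y *m Y = 1%:M - H by rewrite -YY addrK.
pose O := M *m W.
have OO : O^T *m O = 1%:M.
  have Wt : W^T = W by exact: sym.
  by rewrite /O trmx_mul Wt mulmxA -(mulmxA W) hM -/H -YY' mulmxA WY mul1mx YW.
exists O; split=> //.
have -> : M - O = O *m (Y - 1%:M) by rewrite mulmxBr mulmx1 /O -mulmxA WY mulmx1.
move=> x; rewrite -mulmxA vnorm_isometry //.
set z := (Y - 1%:M) *m x.
have hH : vnorm (H *m x) <= s ^+ 2 * vnorm x.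
  rewrite -mulmxA (le_trans (opb_tr s0 hZ _)) // expr2 -mulrA ler_wpM2l //.
(* From 1 - Y^2 = H. As Y >= 0, |(1 + Y) z| >= |z|, so |z| is at most |H x| <= s^2 |x|. *)
have e : H *m x = - ((1%:M + Y) *m z).
  rewrite /z mulmxA mulmxDl mul1mx mulmxBr mulmx1 YY' -mulNmx; congr (_ *m x).
  by apply/matrixP => i j; rewrite !mxE; ring.
apply: le_trans hH; rewrite e vnormN.
have [->|z0] := eqVneq z 0; first by rewrite vnorm0 vnorm_ge0.
have pz : 0 < vnorm z by rewrite vnorm_gt0.
rewrite -(ler_pM2l pz) (le_trans _ (dot_le _ _)) // mulmxDl mul1mx dotDr -expr2 vnorm_sqr.
by rewrite lerDl -QQ -mulmxA dot_mulr sym dot_ge0.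
Qed.

Section DavisKahan.
Context {R : realType}.

Lemma underdetermined q (A : 'M[R]_(q, q.+1)) : exists2 y : 'cV[R]_q.+1, y != 0 & A *m y = 0.
Proof.
have : kermx A^T != 0.
  by rewrite kermx_eq0 /row_free neq_ltn (leq_ltn_trans (rank_leq_col _)).
case/rowV0Pn => r rk r0; exists r^T; first by rewrite -trmx0 (inj_eq trmx_inj).
by apply: trmx_inj; rewrite trmx_mul trmxK trmx0; apply/sub_kermxP.
Qed.

(** The optimal constant is needed in [davis_kahan], where a bound on [Z] is improved in terms of
    itself. *)
Lemma least_opb n m (A : 'M[R]_(m, n)) :
  exists N : R, [/\ 0 <= N, opb A N & forall N', 0 <= N' -> opb A N' -> N <= N'].
Proof.
pose S : set R := [set vnorm (A *m x) | x in [set x | vnorm x <= 1]]%classic.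
have S0 : S 0 by exists 0; rewrite /= ?vnorm0 // mulmx0 vnorm0.
have ub N' : 0 <= N' -> opb A N' -> ubound S N'.
  by move=> N0 h _ [x /= x1 <-]; rewrite (le_trans (h x)) // ler_piMr.
have Sub : has_ubound S.
  exists (Num.sqrt (frob2 A)); apply: ub; rewrite ?sqrtr_ge0 //.
  by apply: opb_frob; rewrite ?sqrtr_ge0 // sqr_sqrtr // frob2_ge0.
exists (sup S); split; first exact: ub_le_sup.
  move=> x; have [->|x0] := eqVneq x 0; first by rewrite mulmx0 !vnorm0 mulr0.
  have px : 0 < vnorm x by rewrite vnorm_gt0.
  rewrite -ler_pdivrMr //; apply: ub_le_sup => //; exists ((vnorm x)^-1 *: x) => /=.
    by rewrite vnormZ ger0_norm ?invr_ge0 ?vnorm_ge0 // mulVf ?gt_eqF.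
  by rewrite -scalemxAr vnormZ ger0_norm ?invr_ge0 ?vnorm_ge0 // mulrC.
by move=> N' N0 h; apply: ge_sup; [exists 0|exact: ub].
Qed.

Section Eigenbasis.
Context {n : nat}.
Variables (L U : 'M[R]_n) (lam : 'I_n -> R).
Hypotheses (UU : U^T *m U = 1%:M) (LE : L = U *m diag_mx (\row_a lam a) *m U^T).

Lemma eigen_UUt : U *m U^T = 1%:M.
Proof. exact: mulmx1C. Qed.

Lemma eigen_sym : L^T = L.
Proof. by rewrite LE !trmx_mul tr_diag_mx trmxK mulmxA. Qed.

Lemma eigen_col a : L *m col a U = lam a *: col a U.
Proof.
rewrite !colE LE -!mulmxA (mulmxA U^T) UU mul1mx scalemxAr; congr (_ *m _).
apply/colP => i; rewrite mul_diag_mx !mxE; case: eqP => [->|_] //=.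
by rewrite !mulr0.
Qed.

Lemma eigen_dot z : dot z (L *m z) = \sum_a lam a * (U^T *m z) a ord0 ^+ 2.
Proof.
rewrite LE -!mulmxA dot_mulr; apply: eq_bigr => a _.
by rewrite mul_diag_mx !mxE mulrCA expr2.
Qed.

Lemma eigen_norm z : dot z z = \sum_a (U^T *m z) a ord0 ^+ 2.
Proof.
transitivity (dot (U^T *m z) (U^T *m z)).
  by rewrite dot_mull trmxK mulmxA eigen_UUt mul1mx.
by apply: eq_bigr => a _; rewrite expr2.
Qed.

Context {q : nat}.
Hypothesis qn : (q <= n)%N.

Definition eigcols : 'M[R]_(n, q) := \matrix_(r, i) U r (widen_ord qn i).

Lemma eigcols_orth : eigcols^T *m eigcols = 1%:M.
Proof.
apply/matrixP => i j; have /matrixP /(_ (widen_ord qn i) (widen_ord qn j)) := UU.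
rewrite !mxE -[widen_ord _ _ == _]val_eqE /= => <-.
by apply: eq_bigr => r _; rewrite !mxE.
Qed.

Lemma eigcols_eigen :
  L *m eigcols = eigcols *m diag_mx (\row_i lam (widen_ord qn i)).
Proof.
apply/matrixP => r i; have /colP /(_ r) := eigen_col (widen_ord qn i).
rewrite mul_mx_diag !mxE [lam _ * _]mulrC => <-.
by apply: eq_bigr => s _; rewrite !mxE.
Qed.

Lemma eigcols_trmul (z : 'cV[R]_n) i : (eigcols^T *m z) i ord0 = (U^T *m z) (widen_ord qn i) ord0.
Proof. by rewrite !mxE; apply: eq_bigr => r _; rewrite !mxE. Qed.

Lemma eigcols_compl z c : (forall a : 'I_n, (q <= a)%N -> c <= lam a) ->
  eigcols^T *m z = 0 -> c * dot z z <= dot z (L *m z).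
Proof.
move=> hc hz; rewrite eigen_dot eigen_norm mulr_sumr; apply: ler_sum => a _.
have [aq|qa] := ltnP a q; last by rewrite ler_wpM2r ?sqr_ge0 // hc.
have -> : (U^T *m z) a ord0 = 0.
  move/colP: hz => /(_ (Ordinal aq)); rewrite eigcols_trmul [RHS]mxE => <-.
  by congr ((_ *m _) _ _); apply: val_inj.
by rewrite expr0n /= !mulr0.
Qed.

Lemma eigcols_span y c : (forall a : 'I_n, (a < q)%N -> lam a <= c) ->
  dot (eigcols *m y) (L *m (eigcols *m y)) <= c * dot (eigcols *m y) (eigcols *m y).
Proof.
move=> hc; rewrite mulmxA eigcols_eigen -mulmxA !dot_mull !mulmxA eigcols_orth !mul1mx.
rewrite /dot mulr_sumr; apply: ler_sum => i _; rewrite mul_diag_mx !mxE mulrCA.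
by rewrite ler_wpM2r -?expr2 ?sqr_ge0 // hc /=.
Qed.

End Eigenbasis.

Lemma is_Vsmall_eig m q (M : 'M[R]_m) (V : 'M[R]_(m, q)) : is_Vsmall M V ->
  exists (qm : (q <= m)%N) (U : 'M[R]_m) (lam : 'I_m -> R),
   [/\ U^T *m U = 1%:M, M = U *m diag_mx (\row_a lam a) *m U^T,
       (forall a b : 'I_m, (a <= b)%N -> lam a <= lam b) & V = eigcols U qm].
Proof.
case=> qm [U [lam [UU [ME [lamle VU]]]]]; exists qm, U, lam; split=> //.
by apply/matrixP => r i; rewrite mxE (VU (widen_ord qm i) i).
Qed.

(* Shifting by the centre of an interval containing all of [lamb] turns the
   Sylvester equation [L Z = Z diag(lamb) + P (L - Lb) Vb] into a contraction
   estimate for the operator norm of [Z], without any loss in [q]. *)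
Lemma davis_kahan n q (L Lb : 'M[R]_n) (V Vb : 'M[R]_(n, q)) (lamb : 'rV[R]_q) (mu1 mu2 eps : R) :
  (q < n)%N -> is_Vsmall L V -> 0 <= eps -> opb (L - Lb) eps ->
  Vb^T *m Vb = 1%:M -> Lb *m Vb = Vb *m diag_mx lamb -> (forall i, lamb ord0 i <= mu1) ->
  (forall z, Vb^T *m z = 0 -> mu2 * dot z z <= dot z (Lb *m z)) ->
  mu1 + eps < mu2 ->
  opb ((1%:M - V *m V^T) *m Vb) (eps / (mu2 - eps - mu1)).
Proof.
move=> qn /is_Vsmall_eig[qm [U [lam [UU LE lamle VE]]]] e0 hE VbVb LbVb lamb1 hmu2 gap.
pose a0 : 'I_n := Ordinal qn.
(* Weyl's inequality: by dimension the q+1 lowest eigenvectors of [L] span a nonzero x killed by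
   [Vb^T], and the Rayleigh quotients of [L] and [Lb] at x differ by at most eps. *)
have weyl : mu2 - eps <= lam a0.
  pose U' := eigcols U qn.
  have [y y0 hy] := underdetermined (Vb^T *m U').
  set x := U' *m y; have U'U' : U'^T *m U' = 1%:M by exact: eigcols_orth.
  have px : 0 < dot x x.
    by rewrite /x dot_mull mulmxA U'U' mul1mx lt_def dot_eq0 y0 dot_ge0.
  have h1 := hmu2 x; rewrite mulmxA hy in h1; have {}h1 := h1 erefl.
  have h2 : dot x (L *m x) <= lam a0 * dot x x.
    by apply: (eigcols_span UU LE) => a aq; apply: lamle.
  have h3 : - (eps * dot x x) <= dot x ((L - Lb) *m x).
    have := cauchy_schwarz x ((L - Lb) *m x); rewrite ler_norml => /andP[h _].
    apply: le_trans h; rewrite lerN2 -vnorm_sqr expr2 mulrCA.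
    by rewrite ler_wpM2l ?vnorm_ge0.
  rewrite mulmxBl dotBr in h3.
  by rewrite -(ler_pM2r px); move: h1 h2 h3; lra.
set P := 1%:M - V *m V^T; set Z := P *m Vb.
have VV : V^T *m V = 1%:M by rewrite VE; exact: eigcols_orth.
have Lsym : L^T = L by exact: eigen_sym LE.
have VtP : V^T *m P = 0 by rewrite mulmxBr mulmx1 mulmxA VV mul1mx subrr.
have Psym : P^T = P by rewrite /P linearB /= trmx1 trmx_mul trmxK.
have PP : P *m P = P.
  by rewrite {1}/P mulmxBl mul1mx -mulmxA VtP mulmx0 subr0.
have hP : opb P 1.
  move=> z; rewrite mul1r; have [->|Pz0] := eqVneq (P *m z) 0; first by rewrite vnorm0 vnorm_ge0.
  have pz : 0 < vnorm (P *m z) by rewrite vnorm_gt0.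
  rewrite -(ler_pM2l pz) -expr2 vnorm_sqr dot_mull Psym mulmxA PP dotC.
  exact: dot_le.
have LP : L *m P = P *m L.
  have LV : L *m V = V *m diag_mx (\row_i lam (widen_ord qm i)).
    by rewrite VE; exact: (eigcols_eigen UU LE).
  have VL : V^T *m L = diag_mx (\row_i lam (widen_ord qm i)) *m V^T.
    by apply: trmx_inj; rewrite !trmx_mul trmxK Lsym tr_diag_mx.
  by rewrite mulmxBr mulmxBl mulmx1 mul1mx mulmxA LV -[V *m V^T *m L]mulmxA VL mulmxA.
have LZ : L *m Z = Z *m diag_mx lamb + P *m (L - Lb) *m Vb.
  have -> : P *m (L - Lb) *m Vb = P *m L *m Vb - Z *m diag_mx lamb.
    by rewrite mulmxBr mulmxBl -[P *m Lb *m Vb]mulmxA LbVb mulmxA.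
  by rewrite /Z mulmxA LP addrC subrK.
have hEV : opb (P *m (L - Lb) *m Vb) eps.
  have := opbM (mulr_ge0 ler01 e0) (opbM ler01 hP hE) (opb_isometry VbVb).
  by rewrite mul1r mulr1.
(* Half the sum of all gaps is a crude radius: every [lamb] lies in [mu1 - 2h, mu1], centred at [c].
   Its size is harmless because it cancels below. *)
pose h := (\sum_i (mu1 - lamb ord0 i)) / 2; pose c := mu1 - h.
have h0 : 0 <= h.
  by rewrite divr_ge0 // sumr_ge0 // => i _; rewrite subr_ge0.
have lc : opb (diag_mx lamb - c%:M) h.
  rewrite -diag_const_mx -raddfB; apply: opb_diag => i; rewrite !mxE ler_norml /c.
  have := lamb1 i; have : mu1 - lamb ord0 i <= 2 * h.
    rewrite /h mulrC divfK // (bigD1 i) //= lerDl sumr_ge0 // => j _.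
    by rewrite subr_ge0.
  by move=> ? ?; apply/andP; split; lra.
have [N [N0 hN least]] := least_opb Z.
pose g := lam a0 - mu1; have g0 : 0 < g by rewrite /g; lra.
have step : opb Z ((N * h + eps) / (h + g)).
  move=> y; set z := Z *m y.
  have Vz : (eigcols U qm)^T *m z = 0 by rewrite -VE /z /Z !mulmxA VtP !mul0mx.
  have low : lam a0 * dot z z <= dot z (L *m z).
    by apply: (eigcols_compl UU LE _ Vz) => a qa; apply: lamle.
  pose b := Z *m (diag_mx lamb - c%:M) *m y + P *m (L - Lb) *m Vb *m y.
  have Lz : L *m z = c *: z + b.
    rewrite /b; have -> : Z *m (diag_mx lamb - c%:M) *m y = Z *m diag_mx lamb *m y - c *: z.
      by rewrite [Z *m _]mulmxBr mul_mx_scalar mulmxBl -scalemxAl.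
    by rewrite addrA [c *: z + _]addrC subrK /z mulmxA LZ mulmxDl.
  have hg : 0 < h + g by rewrite ltr_wpDl.
  rewrite mulrAC ler_pdivlMr //.
  have [z0|z0] := eqVneq z 0.
    by rewrite z0 vnorm0 mul0r mulr_ge0 ?vnorm_ge0 // addr_ge0 // mulr_ge0.
  have pz : 0 < vnorm z by rewrite vnorm_gt0.
  rewrite -(ler_pM2l pz) [leLHS]mulrA -[_ * vnorm z]expr2 vnorm_sqr.
  move: low; rewrite Lz dotDr dotZr => low.
  have hb : vnorm b <= (N * h + eps) * vnorm y.
    by rewrite mulrDl; apply: le_trans (vnormD _ _) _; apply: lerD; [exact: (opbM N0 hN lc)|exact: hEV].
  have hd := dot_le z b.
  have : vnorm z * vnorm b <= vnorm z * ((N * h + eps) * vnorm y) by rewrite ler_pM2l.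
  by move: low hd; rewrite /c /g; lra.
(* Minimality of N gives N (h + g) <= N h + eps, and the radius h drops out. *)
have Ng : N * g <= eps.
  have hg : 0 < h + g by rewrite ltr_wpDl.
  have nn : 0 <= (N * h + eps) / (h + g).
    by apply: divr_ge0 (ltW hg); apply: addr_ge0 => //; apply: mulr_ge0.
  by have := least _ nn step; rewrite ler_pdivlMr //; lra.
apply: opb_le hN; rewrite ler_pdivlMr; last by lra.
by apply: le_trans Ng; rewrite ler_wpM2l // /g; lra.
Qed.

(** V^T Vb is nearly orthogonal, its Gram matrix being 1 - Z^T Z. With Q its polar factor, Vb - V Q
    = V (V^T Vb - Q) + Z has norm at most s^2 + s <= 2s, and O = Q^T. *)
Lemma davis_kahan_basis n q (V Vb : 'M[R]_(n, q)) s : 0 <= s -> s < 1 ->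
  V^T *m V = 1%:M -> Vb^T *m Vb = 1%:M -> opb ((1%:M - V *m V^T) *m Vb) s ->
  exists O : 'M[R]_q, O^T *m O = 1%:M /\ opb (V - Vb *m O) (2 * s).
Proof.
move=> s0 s1 VV VbVb hZ; set Z := _ *m Vb in hZ.
have [Q [QQ hQ]] : exists Q : 'M[R]_q, Q^T *m Q = 1%:M /\ opb (V^T *m Vb - Q) (s ^+ 2).
  apply: (near_orthogonal s0 s1 hZ); rewrite trmx_mul trmxK /Z.
  rewrite trmx_mul linearB /= trmx1 trmx_mul trmxK.
  have PP : (1%:M - V *m V^T) *m (1%:M - V *m V^T) = 1%:M - V *m V^T.
    rewrite mulmxBl mul1mx mulmxBr mulmx1 mulmxA -[V *m V^T *m V]mulmxA VV mulmx1.
    by rewrite subrr subr0.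
  rewrite -[Vb^T *m (1%:M - _) *m _]mulmxA [(1%:M - _) *m (_ *m _)]mulmxA PP.
  by rewrite mulmxBl mul1mx mulmxBr VbVb opprB addrC subrK !mulmxA.
have QQt : Q *m Q^T = 1%:M by exact: mulmx1C.
exists Q^T; split; first by rewrite trmxK.
have -> : V - Vb *m Q^T = - ((V *m (V^T *m Vb - Q) + Z) *m Q^T).
  have -> : V *m (V^T *m Vb - Q) + Z = Vb - V *m Q.
    by rewrite /Z mulmxBl mul1mx mulmxBr !mulmxA addrC addrA subrK.
  by rewrite mulmxBl -[V *m Q *m Q^T]mulmxA QQt mulmx1 opprB.
apply: opbN.
have hQt : opb Q^T 1 by apply: opb_isometry; rewrite trmxK.
have hV := opb_isometry VV.
have s2 : 0 <= 1 * s ^+ 2 + s by rewrite mul1r addr_ge0 ?sqr_ge0.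
apply: opb_le (opbM s2 (opbD (opbM ler01 hV hQ) hZ) hQt).
by rewrite mulr1 mul1r; have : s ^+ 2 <= s by [rewrite expr2; nra]; lra.
Qed.

End DavisKahan.

(** * Clustering *)

Section Kmeans.
Context {R : realType} {n k q : nat}.
Variables (sigma : 'I_n -> 'I_k).
Hypothesis sigma_surj : forall i : 'I_k, exists j, sigma j = i.

(** The set inside [csize] is a classical one; the count is moved to a decidable predicate. *)
Lemma csizeE i : csize sigma i = #|[pred j | sigma j == i]|.
Proof. by apply: eq_card => j; apply/idP/idP => [/set_mem|/mem_set]. Qed.

Lemma csize_gt0 i : 0 < (csize sigma i)%:R :> R.
Proof.
rewrite ltr0n csizeE; apply/card_gt0P; have [j ji] := sigma_surj i.
by exists j; rewrite inE ji.
Qed.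

Lemma is_memb_Thetahat : is_memb (Thetahat sigma : 'M[R]_(n, k)).
Proof.
move=> j; exists (sigma j); rewrite mxE eqxx; split=> // i; rewrite eq_sym mxE.
by move/negbTE => ->.
Qed.

Lemma is_memb_mul (T : 'M[R]_(n, k)) (K : 'M[R]_(k, q)) j i l :
  T j i = 1 -> (forall i', i' != i -> T j i' = 0) -> (T *m K) j l = K i l.
Proof.
move=> T1 T0; rewrite mxE (bigD1 i) //= T1 mul1r big1 ?addr0 // => i' /T0 ->.
by rewrite mul0r.
Qed.

Definition dist2 (K K' : 'M[R]_(k, q)) (i i' : 'I_k) : R := \sum_l (K i l - K' i' l) ^+ 2.

Lemma dist2_triangle (K K' : 'M[R]_(k, q)) i t i' :
  dist2 K K i i' <= 2 * dist2 K' K t i + 2 * dist2 K' K t i'.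
Proof.
rewrite !mulr_sumr -big_split; apply: ler_sum => l _ /=.
by have := sqr_ge0 (K' t l - K i l + (K' t l - K i' l)); lra.
Qed.

(** Comparing with the planted solution [Thetahat sigma *m K0] bounds the squared Frobenius norm of
    [Y] by 2(1 + (1 + xi)) f. Each node of S_i accounts for at least 2/(3 n_i) of it, whence the
    factor 3/2 * 2 = 3. *)
Lemma kmeans_recovery (V : 'M[R]_(n, q)) (K0 : 'M[R]_(k, q)) (xi f : R) Tt Rt :
  0 < xi ->
  (forall i i', i != i' -> 9 / 5 / (csize sigma i)%:R <= dist2 K0 K0 i i') ->
  (forall i i', 9 / 10 * (csize sigma i')%:R <= (csize sigma i)%:R :> R) ->
  frob2 (V - Thetahat sigma *m K0) <= f -> 2 * (2 + xi) * f < 1 / 12 ->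
  approx_kmeans xi V Tt Rt ->
  let S := Sset sigma (Tt *m Rt - Thetahat sigma *m K0) in
  exists s : 'S_k,
    (forall j, j \notin S (sigma j) -> row j Tt = row j (Thetahat sigma) *m perm_mx s) /\
    \sum_(i < k) (#|S i|%:R / (csize sigma i)%:R) <= 3 * (2 + xi) * f.
Proof.
move=> xi0 sep bal hf fsmall [memb appr] S.
set Y0 := Thetahat sigma *m K0 in hf S *; set Y := Tt *m Rt - Y0 in S *.
have hF : frob2 Y <= 2 * (2 + xi) * f.
  have -> : Y = (Tt *m Rt - V) + (V - Y0) by rewrite /Y addrA subrK.
  apply: le_trans (frob2D _ _) _.
  have := appr _ K0 is_memb_Thetahat.
  rewrite -/Y0 -[frob2 (Y0 - V)]frob2N opprB => h.
  have := frob2_ge0 (V - Y0); nra.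
have frobE : frob2 Y = \sum_i \sum_(j | sigma j == i) rownorm2 Y j.
  by rewrite /frob2 (partition_big sigma predT).
have rn0 j : 0 <= rownorm2 Y j by apply: sumr_ge0 => l _; rewrite sqr_ge0.
have cl0 i : 0 <= \sum_(j | sigma j == i) rownorm2 Y j by apply: sumr_ge0.
have cle i : \sum_(j | sigma j == i) rownorm2 Y j < 1 / 12.
  apply: le_lt_trans fsmall; apply: le_trans hF; rewrite frobE (bigD1 i) //= lerDl.
  by apply: sumr_ge0.
(* Two radii [sqrt (2/3)] would exceed the separation of the centres, so each cluster
   is represented by a point that is much closer to its centre than [S] requires. *)
have rep i : exists j, (sigma j == i) && (rownorm2 Y j < 1 / 12 / (csize sigma i)%:R).
  apply: contrapT => hn; have := cle i; rewrite ltNge => /negP; apply.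
  apply: (le_trans (y := \sum_(j | sigma j == i) 1 / 12 / (csize sigma i)%:R)).
    rewrite sumr_const -csizeE -[leRHS]mulr_natr.
    by rewrite divfK // gt_eqF // csize_gt0.
  apply: ler_sum => j ji; rewrite leNgt; apply/negP => lj; apply: hn.
  by exists j; rewrite ji lj.
have [tau tau1] : exists tau : 'I_n -> 'I_k, forall j,
    Tt j (tau j) = 1 /\ forall i', i' != tau j -> Tt j i' = 0.
  by exists (fun j => projT1 (cid (memb j))) => j; exact: (projT2 (cid (memb j))).
have rnE j : rownorm2 Y j = dist2 Rt K0 (tau j) (sigma j).
  apply: eq_bigr => l _; rewrite mxE [(- Y0) j l]mxE; have [t1 t0] := tau1 j.
  rewrite (is_memb_mul Rt l t1 t0) (@is_memb_mul _ K0 j (sigma j)) //.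
    by rewrite mxE eqxx.
  by move=> i; rewrite eq_sym mxE => /negbTE ->.
pose rp i := xchoose (rep i).
have rpP i : sigma (rp i) = i /\ dist2 Rt K0 (tau (rp i)) i < 1 / 12 / (csize sigma i)%:R.
  have /andP[/eqP e h] := xchooseP (rep i); split=> //.
  by move: h; rewrite rnE -/(rp i) {1}/rp e.
(* A centre cannot be that close to two clusters: 2 * 2/3 + 2 * (1/12) * (10/9) < 9/5, where 10/9
   exchanges the cluster sizes. *)
have clash i i' t : dist2 Rt K0 t i < 2 / (3 * (csize sigma i)%:R) ->
    dist2 Rt K0 t i' < 1 / 12 / (csize sigma i')%:R -> i = i'.
  move=> h1 h2; apply/eqP; apply: contraT => ii'.
  have h3 := sep _ _ ii'; have h4 := dist2_triangle K0 Rt i t i'.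
  have ci := csize_gt0 i; have ci' := csize_gt0 i'; have b := bal i' i.
  set a := (csize sigma i)%:R in h1 h3 ci b; set a' := (csize sigma i')%:R in h2 ci' b.
  have e1 : 2 / (3 * a) = 2 / 3 * a^-1 by field; rewrite gt_eqF.
  have e2 : a'^-1 <= 10 / 9 * a^-1.
    by rewrite ler_pdivlMr // mulrC ler_pdivrMr //; lra.
  have ia : 0 < a^-1 by rewrite invr_gt0.
  by move: h1 h2 h3 h4 e2; rewrite e1; lra.
have weaken i : 1 / 12 / (csize sigma i)%:R < 2 / (3 * (csize sigma i)%:R) :> R.
  have ci := csize_gt0 i; have : 0 < ((csize sigma i)%:R)^-1 :> R by rewrite invr_gt0.
  have -> : 2 / (3 * (csize sigma i)%:R) = 2 / 3 * ((csize sigma i)%:R)^-1 :> R.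
    by field; rewrite gt_eqF.
  by lra.
(* Representatives of different clusters carry different labels. An injective self-map of the finite
   label set is a permutation, so every label is that of some representative. *)
have finj : injective (tau \o rp).
  move=> i i' /= e; have [_ h1] := rpP i; have [_ h2] := rpP i'.
  by apply: (clash _ _ (tau (rp i))); rewrite ?(lt_trans h1) // e.
exists (perm finj); split=> [j|].
  set i := sigma j; rewrite inE eqxx /= -ltNge rnE -/i => hj.
  have [i' i'E] : exists i', tau j = tau (rp i').
    by exists ((perm finj)^-1%g (tau j)); have := permKV (perm finj) (tau j); rewrite permE.
  have [_ h2] := rpP i'; rewrite -i'E in h2.
  have ei := clash _ _ _ hj h2.
  have -> : row j (Thetahat sigma) = delta_mx ord0 i :> 'rV[R]_k.
    by apply/rowP => l; rewrite !mxE -/i eqxx /= eq_sym; case: eqP.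
  rewrite -rowE; apply/rowP => l; rewrite !mxE permE /= ei -i'E.
  have [t1 t0] := tau1 j; have [<-|h] := eqVneq (tau j) l; first by rewrite t1.
  by rewrite t0 // eq_sym.
apply: (le_trans (y := 3 / 2 * frob2 Y)); last by move: hF; lra.
rewrite frobE mulr_sumr; apply: ler_sum => i _.
have ci := csize_gt0 i; rewrite ler_pdivrMr //.
apply: (le_trans (y := 3 / 2 * (\sum_(j in S i) 2 / (3 * (csize sigma i)%:R)) * (csize sigma i)%:R)).
  rewrite sumr_const -[_ *+ #|_|]mulr_natr le_eqVlt; apply/orP; left; apply/eqP.
  by field; rewrite gt_eqF.
rewrite ler_pM2r // ler_pM2l; last by lra.
rewrite big_mkcond [leRHS]big_mkcond; apply: ler_sum => j _; rewrite inE.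
by case: (sigma j == i) => //=; case: ifP.
Qed.

End Kmeans.

(** * Cluster sizes and the population Laplacian *)

Section ClusterSizes.
Context {R : realType} {n k : nat}.
Variable sigma : 'I_n -> 'I_k.
Hypothesis sigma_surj : forall i : 'I_k, exists j, sigma j = i.

Lemma csize_sum : \sum_i (csize sigma i)%:R = n%:R :> R.
Proof.
rewrite -natr_sum; congr (_%:R); rewrite -[RHS]card_ord -sum1_card.
rewrite (partition_big sigma predT) //=; apply: eq_bigr => i _.
by rewrite csizeE -sum1_card; apply: eq_bigl => j; rewrite !inE.
Qed.

Lemma bigminn_le (I : eqType) (r : seq I) (F : I -> nat) x i :
  i \in r -> (\big[minn/x]_(j <- r) F j <= F i)%N.
Proof.
elim: r => // a r IH; rewrite inE big_cons => /orP[/eqP ->|/IH h].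
  exact: geq_minl.
exact: leq_trans (geq_minr _ _) h.
Qed.

Lemma nmin_le i : (nmin sigma <= csize sigma i)%N.
Proof. by apply: bigminn_le; rewrite mem_index_enum. Qed.

Lemma nmax_ge i : (csize sigma i <= nmax sigma)%N.
Proof. exact: (leq_bigmax i). Qed.

(** For k >= 2 the denominator is at least 24, so rho > (23/24)^2 > 9/10. The later estimates use
    the balance only in this form. *)
Lemma balanced : (2 <= k)%N ->
  1 - (4 * k%:R * (2 + Num.sqrt k%:R))^-1 < Num.sqrt (rho sigma : R) ->
  9 / 10 * (nmax sigma)%:R <= (nmin sigma)%:R :> R.
Proof.
move=> k2; have k2' : 2 <= k%:R :> R by rewrite ler_nat.
have s1 : 1 <= Num.sqrt k%:R :> R by rewrite -[leLHS]sqrtr1 ler_sqrt ?ler0n // ler1n; lia.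
have h24 : 24 <= 4 * k%:R * (2 + Num.sqrt k%:R) :> R by nra.
have hi : (4 * k%:R * (2 + Num.sqrt k%:R))^-1 <= 24^-1 :> R.
  by rewrite lef_pV2 // posrE; lra.
move=> hr; have sr : 23 / 24 < Num.sqrt (rho sigma) :> R by lra.
have r0 : 0 <= rho sigma :> R by rewrite divr_ge0.
have : 9 / 10 <= rho sigma :> R by rewrite -(sqr_sqrtr r0) expr2; nra.
have i0 : 'I_k by apply: (Ordinal (n := k) (m := 0)); lia.
have c0 : 0 < (nmax sigma)%:R :> R.
  by apply: lt_le_trans (csize_gt0 sigma_surj i0) _; rewrite ler_nat nmax_ge.
by rewrite ler_pdivlMr.
Qed.

Lemma Theta_orth : (Theta sigma)^T *m Theta sigma = 1%:M :> 'M[R]_k.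
Proof.
apply/matrixP => i i'; rewrite !mxE.
rewrite (eq_bigr (fun j => if (sigma j == i) && (i == i') then ((csize sigma i)%:R)^-1 else 0 : R)).
  have [_|_] := eqVneq i i'; last by rewrite big1 // => j _; rewrite andbF.
  under eq_bigr => j _ do rewrite andbT.
  rewrite -big_mkcond sumr_const -csizeE -[LHS]mulr_natr mulVf // gt_eqF //; exact: csize_gt0.
move=> j _; rewrite !mxE; have [->|h] := eqVneq (sigma j) i; last by rewrite mul0r.
have [<-|_] := eqVneq i i'; last by rewrite mulr0.
by rewrite -invfM -expr2 sqr_sqrtr.
Qed.

Lemma Theta_Thetahat q (K : 'M[R]_(k, q)) :
  Theta sigma *m K = Thetahat sigma *m (\matrix_(i, l) ((Num.sqrt (csize sigma i)%:R)^-1 * K i l)).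
Proof.
apply/matrixP => j l; rewrite !mxE; apply: eq_bigr => i _; rewrite !mxE.
by case: eqP => _; rewrite ?mul0r ?mul1r.
Qed.

Variables p eta : R.
Hypothesis d0 : 0 < dbar n p.
Local Notation q0 := (p / dbar n p * (1 - 2 * eta)).

(** With this vector [Bbar] is q0 (2 diag(n_i) - sv sv^T), a diagonal matrix plus one of rank
    one. *)
Definition sv : 'cV[R]_k := \col_i Num.sqrt (csize sigma i)%:R.

Lemma dot_sv : dot sv sv = n%:R.
Proof.
by rewrite -csize_sum; apply: eq_bigr => i _; rewrite mxE -expr2 sqr_sqrtr.
Qed.

Lemma Bbar_mul x i : (Bbar sigma p eta *m x) i ord0 =
  q0 * (2 * (csize sigma i)%:R * x i ord0 - dot sv x * sv i ord0).
Proof.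
rewrite mxE mulrBr /dot mulr_suml mulr_sumr (bigD1 i) //= [X in _ = _ - X](bigD1 i) //=.
rewrite opprD addrA; congr (_ + _).
  rewrite !mxE eqxx.
  have -> : q0 * (Num.sqrt (csize sigma i)%:R * x i ord0 * Num.sqrt (csize sigma i)%:R) =
    q0 * (Num.sqrt (csize sigma i)%:R ^+ 2 * x i ord0) by ring.
  by rewrite sqr_sqrtr //; ring.
rewrite -sumrN; apply: eq_bigr => j /negbTE ji; rewrite !mxE eq_sym ji sqrtrM //; ring.
Qed.

Lemma Bbar_form x : dot x (Bbar sigma p eta *m x) =
  q0 * (2 * (\sum_i (csize sigma i)%:R * x i ord0 ^+ 2) - dot sv x ^+ 2).
Proof.
have -> : dot sv x ^+ 2 = \sum_i dot sv x * (sv i ord0 * x i ord0) by rewrite -mulr_sumr expr2.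
rewrite mulr_sumr -sumrB mulr_sumr; apply: eq_bigr => i _; rewrite Bbar_mul; ring.
Qed.

(** Theta Bbar Theta^T has entries q0 times the sign, also on the diagonal where [EA] vanishes. The
    excess of [alphabar] over 1 is exactly this q0. *)
Lemma LbarE : Lbar sigma p eta =
  (alphabar n p eta)%:M - Theta sigma *m Bbar sigma p eta *m (Theta sigma)^T.
Proof.
have TB a b : (Theta sigma *m Bbar sigma p eta *m (Theta sigma)^T) a b = q0 * sgn sigma a b.
  rewrite mxE (bigD1 (sigma b)) //= big1 ?addr0; last first.
    by move=> i /negbTE ib; rewrite !mxE eq_sym ib mulr0.
  rewrite mxE (bigD1 (sigma a)) //= big1 ?addr0; last first.
    by move=> i /negbTE ib; rewrite !mxE eq_sym ib mul0r.
  rewrite !mxE !eqxx /sgn.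
  have ca := csize_gt0 (R := R) sigma_surj (sigma a); have cb := csize_gt0 (R := R) sigma_surj (sigma b).
  have [<-|ab] := eqVneq (sigma a) (sigma b).
    have -> : (csize sigma (sigma a))%:R = Num.sqrt (csize sigma (sigma a))%:R ^+ 2 :> R.
      by rewrite sqr_sqrtr.
    rewrite sqrtr_sqr ger0_norm ?sqrtr_ge0 //.
    by field; rewrite !gt_eqF ?sqrtr_gt0.
  by rewrite sqrtrM //; field; rewrite !gt_eqF ?sqrtr_gt0.
move: (_ *m (Theta sigma)^T) TB => W TB.
apply/matrixP => a b; rewrite /Lbar !mxE TB /alphabar.
have [->|ab] := eqVneq a b; last first.
  by rewrite !mulr0n; field; rewrite gt_eqF.
by rewrite /sgn eqxx !mulr1n; field; rewrite gt_eqF.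
Qed.

End ClusterSizes.

(** * Spectrum and cluster centres of the population model *)

Section SpectralGap.
Context {R : realType} {n k : nat}.
Variable sigma : 'I_n -> 'I_k.+2.
Hypothesis sigma_surj : forall i : 'I_k.+2, exists j, sigma j = i.
Variables (p eta : R) (Rk : 'M[R]_(k.+2, k.+1)).
Hypotheses (d0 : 0 < dbar n p) (p0 : 0 < p) (eta2 : 0 < 1 - 2 * eta).
Hypothesis bal : 9 / 10 * (nmax sigma)%:R <= (nmin sigma)%:R :> R.
Hypothesis RkV : is_Vsmall (Cbar sigma p eta) Rk.
Local Notation q0 := (p / dbar n p * (1 - 2 * eta)).
Local Notation mx := ((nmax sigma)%:R : R).
Local Notation mn := ((nmin sigma)%:R : R).
Local Notation al := (alphabar n p eta).

Lemma q0_gt0 : 0 < q0.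
Proof. by rewrite mulr_gt0 // divr_gt0. Qed.

Lemma csize_itv i : mn <= (csize sigma i)%:R <= mx.
Proof. by rewrite !ler_nat nmin_le nmax_ge. Qed.

Lemma mx_gt0 : 0 < mx :> R.
Proof.
apply: lt_le_trans (csize_gt0 sigma_surj ord0) _.
by have /andP[] := csize_itv ord0.
Qed.

Lemma n_ge_mn : 2 * mn <= n%:R :> R.
Proof.
rewrite -(csize_sum sigma) 2!big_ord_recl.
have /andP[h1 _] := csize_itv ord0; have /andP[h2 _] := csize_itv (lift ord0 ord0).
have : 0 <= \sum_(i < k) (csize sigma (lift ord0 (lift ord0 i)))%:R :> R by apply: sumr_ge0.
by move: h1 h2; lra.
Qed.

Lemma n_ge_mx : 9 / 5 * mx <= n%:R :> R.
Proof. by have := n_ge_mn; move: bal; lra. Qed.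

Lemma n_le_mx : n%:R <= k.+2%:R * mx :> R.
Proof.
have -> : k.+2%:R * mx = \sum_(i < k.+2) mx by rewrite sumr_const card_ord mulr_natl.
rewrite -(csize_sum sigma).
by apply: ler_sum => i _; have /andP[] := csize_itv i.
Qed.

Lemma Cbar_mul m (x : 'M[R]_(_, m)) : Cbar sigma p eta *m x = al *: x - Bbar sigma p eta *m x.
Proof. by rewrite mulmxBl mul_scalar_mx. Qed.

(** [u] is the top eigenvector, the one left out of [Rk]. Its eigenvalue l is at least the Rayleigh
    quotient of [sv]; the others are bounded through vectors orthogonal to [sv], where the rank-one
    part of [Bbar] vanishes. *)
Lemma Cbar_spectrum : exists (u : 'cV[R]_k.+2) (lm : 'rV[R]_k.+1) (l : R),
  [/\ Rk^T *m Rk = 1%:M /\ Rk *m Rk^T = 1%:M - u *m u^T,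
      Cbar sigma p eta *m Rk = Rk *m diag_mx lm,
      (forall i, lm ord0 i <= al - 2 * q0 * mn),
      dot u u = 1 & Cbar sigma p eta *m u = l *: u /\ al - q0 * (2 * mx - n%:R) <= l].
Proof.
have [km [U [lam [UU CE lamle RE]]]] := is_Vsmall_eig RkV.
pose w := widen_ord km.
have dotU a b : dot (col a U) (col b U) = (a == b)%:R.
  have /matrixP /(_ a b) := UU; rewrite !mxE => <-.
  by apply: eq_bigr => i _; rewrite !mxE.
have n0 : 0 < n%:R :> R by apply: lt_le_trans n_ge_mx; rewrite mulr_gt0 ?mx_gt0 //; lra.
pose u := col ord_max U; exists u, (\row_i lam (w i)), (lam ord_max); split.
- rewrite RE; split; first exact: eigcols_orth.
  apply/matrixP => i j; have /matrixP /(_ i j) := eigen_UUt UU.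
  rewrite !mxE big_ord_recr /= => <-; rewrite big_ord1 !mxE addrK.
  by apply: eq_bigr => a _; rewrite !mxE; congr (U _ _ * U _ _); apply: val_inj.
- by rewrite RE; exact: (eigcols_eigen UU CE).
- move=> i; rewrite mxE; have wi : w i != ord_max.
    by rewrite -val_eqE /= neq_ltn ltn_ord.
  have li : lam (w i) <= lam ord_max by apply: lamle; apply: leq_ord.
  (* Some combination of the i-th and the top eigenvector is orthogonal to [sv]. Its Rayleigh
     quotient averages the two eigenvalues, so it is at least the smaller one. *)
  have [al0 [be0 [hab hsv]]] : exists a b : R, 0 < a ^+ 2 + b ^+ 2 /\
      dot (sv sigma) (a *: col (w i) U + b *: u) = 0.
    have [e|ne] := eqVneq (dot (sv sigma) u) 0.
      have [e'|ne'] := eqVneq (dot (sv sigma) (col (w i) U)) 0.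
        by exists 1, 0; rewrite scale0r addr0 scale1r e' expr1n expr0n addr0.
      exists 0, 1; rewrite scale0r add0r scale1r e expr1n expr0n add0r.
      by split.
    exists (dot (sv sigma) u), (- dot (sv sigma) (col (w i) U)); split.
      rewrite ltr_pwDl ?sqr_ge0 // lt_def sqr_ge0 andbT.
      by rewrite sqrf_eq0.
    by rewrite dotDr !dotZr; ring.
  set x := _ + _ in hsv.
  have xx : dot x x = al0 ^+ 2 + be0 ^+ 2.
    rewrite /x !(dotDl, dotDr, dotZl, dotZr) !dotU !eqxx (negbTE wi) eq_sym (negbTE wi).
    by rewrite /=; ring.
  have xCx : dot x (Cbar sigma p eta *m x) = lam (w i) * al0 ^+ 2 + lam ord_max * be0 ^+ 2.
    rewrite /x mulmxDr -!scalemxAr !(eigen_col UU CE).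
    rewrite !(dotDl, dotDr, dotZl, dotZr) !dotU !eqxx (negbTE wi) eq_sym (negbTE wi).
    by rewrite /=; ring.
  have up : dot x (Cbar sigma p eta *m x) <= (al - 2 * q0 * mn) * dot x x.
    rewrite Cbar_mul dotBr dotZr Bbar_form hsv expr0n /= subr0 mulrBl lerD2l lerN2.
    have -> : 2 * q0 * mn * dot x x = q0 * (2 * (mn * dot x x)) by ring.
    rewrite ler_pM2l ?q0_gt0 // ler_pM2l // mulr_sumr.
    apply: ler_sum => j _; rewrite -expr2 ler_wpM2r ?sqr_ge0 //.
    by have /andP[] := csize_itv j.
  rewrite -(ler_pM2r hab); move: up; rewrite xCx xx.
  have := sqr_ge0 be0; have := sqr_ge0 al0; nra.
- by rewrite dotU eqxx.
split; first exact: (eigen_col UU CE).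
have ray : dot (sv sigma) (Cbar sigma p eta *m sv sigma) <= lam ord_max * n%:R.
  rewrite -(dot_sv sigma) (eigen_dot CE) (eigen_norm UU) mulr_sumr.
  by apply: ler_sum => a _; rewrite ler_wpM2r ?sqr_ge0 // lamle // leq_ord.
rewrite -(ler_pM2r n0); apply: le_trans ray.
rewrite Cbar_mul dotBr dotZr Bbar_form dot_sv.
rewrite [leLHS]mulrBl lerD2l lerN2 -[leRHS]mulrA ler_pM2l ?q0_gt0 //.
have : \sum_i (csize sigma i)%:R * sv sigma i ord0 ^+ 2 <= mx * n%:R.
  rewrite -(dot_sv sigma) mulr_sumr; apply: ler_sum => i _.
  by rewrite -expr2 ler_wpM2r ?sqr_ge0 //; have /andP[] := csize_itv i.
by lra.
Qed.

Lemma TR_orth : (Theta sigma *m Rk)^T *m (Theta sigma *m Rk) = 1%:M.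
Proof.
have [u [lm [l [[RR _] _ _ _ _]]]] := Cbar_spectrum.
by rewrite trmx_mul mulmxA -[_ *m _ *m Theta sigma]mulmxA Theta_orth // mulmx1.
Qed.

Lemma Lbar_eigen : exists2 lm : 'rV[R]_k.+1,
  Lbar sigma p eta *m (Theta sigma *m Rk) = (Theta sigma *m Rk) *m diag_mx lm &
  forall i, lm ord0 i <= al - 2 * q0 * mn.
Proof.
have [u [lm [l [_ CR lmle _ _]]]] := Cbar_spectrum; exists lm => //.
rewrite LbarE // mulmxBl mul_scalar_mx -(mulmxA (Theta sigma) Rk) -CR Cbar_mul mulmxBr.
rewrite -scalemxAr; congr (_ - _).
by rewrite !mulmxA -[_ *m _^T *m Theta sigma]mulmxA Theta_orth // mulmx1.
Qed.

(** Theta^T z is a multiple of [u], so the quadratic form of [Bbar] there is (al - l) times its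
    squared norm, and al - l <= q0 (2 mx - n) <= 2 q0 (mx - mn) because n >= 2 mn. *)
Lemma Lbar_compl z : (Theta sigma *m Rk)^T *m z = 0 ->
  (al - 2 * q0 * (mx - mn)) * dot z z <= dot z (Lbar sigma p eta *m z).
Proof.
move=> hz; have [u [lm [l [[_ RRt] _ _ uu [Cu lge]]]]] := Cbar_spectrum.
pose w := (Theta sigma)^T *m z.
have wE : w = dot u w *: u.
  have : Rk *m Rk^T *m w = 0 by rewrite -mulmxA /w (mulmxA Rk^T) -trmx_mul hz mulmx0.
  rewrite RRt mulmxBl mul1mx => /eqP; rewrite subr_eq0 => /eqP {1}->.
  rewrite -mulmxA; apply/colP => i; rewrite !mxE big_ord1 -dotE mulrC //.
have ww : dot w w <= dot z z.
  by rewrite -vnorm_le; apply: vnorm_trmx_isometry; exact: Theta_orth.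
have Bu : Bbar sigma p eta *m u = (al - l) *: u.
  by rewrite scalerBl -Cu Cbar_mul opprB addrC subrK.
have wBw : dot w (Bbar sigma p eta *m w) = (al - l) * dot w w.
  by rewrite wE -scalemxAr Bu !dotZl !dotZr; ring.
have -> : dot z (Lbar sigma p eta *m z) = al * dot z z - dot w (Bbar sigma p eta *m w).
  rewrite LbarE // mulmxBl dotBr mul_scalar_mx dotZr; congr (_ - _).
  by rewrite -!mulmxA [LHS]dot_mulr.
rewrite wBw mulrBl lerD2l lerN2.
have h1 : al - l <= 2 * q0 * (mx - mn).
  have h2 : q0 * (2 * mx - n%:R) <= q0 * (2 * (mx - mn)).
    by rewrite ler_pM2l ?q0_gt0 //; have := n_ge_mn; lra.
  by move: lge h2; lra.
apply: (le_trans (y := 2 * q0 * (mx - mn) * dot w w)); first by rewrite ler_wpM2r ?dot_ge0.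
apply: ler_wpM2l => //; apply: mulr_ge0; first by apply: mulr_ge0 => //; exact: ltW q0_gt0.
by have /andP[] := csize_itv ord0; lra.
Qed.

Definition centers (Q : 'M[R]_k.+1) : 'M[R]_(k.+2, k.+1) :=
  \matrix_(j, l) ((Num.sqrt (csize sigma j)%:R)^-1 * (Rk *m Q) j l).

(** The rows of Rk Q have Gram matrix 1 - u u^T, so the squared distance is 1/n_i + 1/n_i' -
    (u_i/sqrt n_i - u_i'/sqrt n_i')^2. The eigenvalue equation makes u_j/sqrt n_j = S/(2 n_j - lB)
    almost constant: the last square is at most 1/(10 n_i), and 1 + 9/10 - 1/10 = 9/5. *)
Lemma center_separation (Q : 'M[R]_k.+1) i i' : Q^T *m Q = 1%:M -> i != i' ->
  9 / 5 / (csize sigma i)%:R <= dist2 (centers Q) (centers Q) i i'.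
Proof.
move=> QQ ii'; pose K := centers Q; rewrite -/K; have [u [lm [l [[_ RRt] _ _ uu [Cu lge]]]]] := Cbar_spectrum.
have QQt : Q *m Q^T = 1%:M by exact: mulmx1C.
pose G := Rk *m Q *m (Rk *m Q)^T.
have GE : G = 1%:M - u *m u^T.
  by rewrite /G trmx_mul mulmxA -[Rk *m Q *m Q^T]mulmxA QQt mulmx1 RRt.
have Gij j j' : \sum_l (Rk *m Q) j l * (Rk *m Q) j' l = (j == j')%:R - u j ord0 * u j' ord0.
  transitivity (G j j'); last by rewrite GE !mxE big_ord1 !mxE.
  by rewrite /G [RHS]mxE; apply: eq_bigr => t _; rewrite [(_^T) _ _]mxE.
pose c : R := (csize sigma i)%:R; pose c' : R := (csize sigma i')%:R; rewrite -/c.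
have c0 : 0 < c by exact: csize_gt0.
have c0' : 0 < c' by exact: csize_gt0.
pose a := (Num.sqrt c)^-1; pose b := (Num.sqrt c')^-1.
have aa : a ^+ 2 = c^-1 by rewrite exprVn sqr_sqrtr // ltW.
have bb : b ^+ 2 = c'^-1 by rewrite exprVn sqr_sqrtr // ltW.
have dE : dist2 K K i i' = c^-1 + c'^-1 - (a * u i ord0 - b * u i' ord0) ^+ 2.
  transitivity (a ^+ 2 * (\sum_l (Rk *m Q) i l * (Rk *m Q) i l) +
     b ^+ 2 * (\sum_l (Rk *m Q) i' l * (Rk *m Q) i' l) -
     2 * a * b * (\sum_l (Rk *m Q) i l * (Rk *m Q) i' l)).
    rewrite !mulr_sumr -big_split -sumrB; apply: eq_bigr => t _ /=.
    by rewrite /K ![centers Q _ _]mxE -/c -/c' -/a -/b; ring.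
  by rewrite !Gij !eqxx (negbTE ii') -aa -bb /=; ring.
pose lB := (al - l) / q0; pose S := dot (sv sigma) u.
have q0n : q0 != 0 by rewrite gt_eqF ?q0_gt0.
have eig j : (2 * (csize sigma j)%:R - lB) * u j ord0 = S * Num.sqrt (csize sigma j)%:R.
  have Bu : Bbar sigma p eta *m u = (al - l) *: u.
    by rewrite scalerBl -Cu Cbar_mul opprB addrC subrK.
  have /colP /(_ j) := Bu; rewrite Bbar_mul ![in RHS]mxE => e.
  have -> : S * Num.sqrt (csize sigma j)%:R = S * sv sigma j ord0 by rewrite mxE.
  have qlB : q0 * lB = al - l by rewrite mulrC divfK.
  apply: (mulfI q0n); set x := u j ord0 in e *; set cj := (csize _ _)%:R in e *.
  have -> : q0 * ((2 * cj - lB) * x) = q0 * (2 * cj * x) - q0 * lB * x by ring.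
  by rewrite qlB -e /S; ring.
have lBle : lB <= 2 * mx - n%:R.
  by rewrite ler_pdivrMr ?q0_gt0 // mulrC; move: lge; lra.
have nmx := n_ge_mx; have m0 := mx_gt0.
have n0 : 0 < n%:R :> R by apply: lt_le_trans nmx; rewrite mulr_gt0 //; lra.
(* The denominator is at least n - 2 (mx - mn) >= n - mx/5, and mx <= 5n/9. *)
have Dge j : 8 / 9 * n%:R <= 2 * (csize sigma j)%:R - lB.
  have /andP[h1 h2] := csize_itv j; move: lBle bal nmx; lra.
pose D := 2 * c - lB; pose D' := 2 * c' - lB.
have hD : 8 / 9 * n%:R <= D := Dge i; have hD' : 8 / 9 * n%:R <= D' := Dge i'.
have D0 : 0 < D by apply: lt_le_trans hD; rewrite mulr_gt0 //; lra.
have D0' : 0 < D' by apply: lt_le_trans hD'; rewrite mulr_gt0 //; lra.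
have auE : a * u i ord0 = S / D.
  apply: (canRL (mulfK (lt0r_neq0 D0))); rewrite -mulrA [u _ _ * _]mulrC eig -/c.
  by rewrite /a mulrCA mulVf ?mulr1 // gt_eqF // sqrtr_gt0.
have buE : b * u i' ord0 = S / D'.
  apply: (canRL (mulfK (lt0r_neq0 D0'))); rewrite -mulrA [u _ _ * _]mulrC eig -/c'.
  by rewrite /b mulrCA mulVf ?mulr1 // gt_eqF // sqrtr_gt0.
have S2 : S ^+ 2 <= n%:R.
  rewrite -[S ^+ 2]real_normK ?num_real // -(dot_sv sigma) -vnorm_sqr.
  rewrite ler_sqr ?nnegrE ?vnorm_ge0 ?normr_ge0 //.
  by have := cauchy_schwarz (sv sigma) u; rewrite [vnorm u]vnormE uu sqrtr1 mulr1.
rewrite dE auE buE; set t := S / D - S / D'.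
have tE : t * (D * D') = S * (2 * (c' - c)).
  by rewrite /t /D /D'; field; rewrite !gt_eqF.
have /andP[c1 c2] := csize_itv i; have /andP[c1' c2'] := csize_itv i'.
rewrite -/c in c1 c2; rewrite -/c' in c1' c2'.
have cc : (2 * (c' - c)) ^+ 2 <= (mx / 5) ^+ 2.
  have hc : `|2 * (c' - c)| <= mx / 5.
    by rewrite ler_norml; move: bal c1 c2 c1' c2' => *; apply/andP; split; lra.
  by rewrite -[leLHS]real_normK ?num_real // ler_sqr ?nnegrE ?normr_ge0.
have DD : 3 / 4 * n%:R ^+ 2 <= D * D'.
  have : 8 / 9 * n%:R * (8 / 9 * n%:R) <= D * D'.
    by apply: ler_pM => //; rewrite mulr_ge0 ?(ltW n0) //; lra.
  by have := sqr_ge0 (n%:R : R); rewrite expr2; lra.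
have t1 : t ^+ 2 * (3 / 4 * n%:R ^+ 2) ^+ 2 <= n%:R * (mx / 5) ^+ 2.
  apply: (le_trans (y := t ^+ 2 * (D * D') ^+ 2)).
    have h34 : 0 <= 3 / 4 * n%:R ^+ 2 :> R by have := sqr_ge0 (n%:R : R); lra.
    by rewrite ler_wpM2l ?sqr_ge0 // ler_sqr ?nnegrE ?(le_trans h34 DD).
  by rewrite -exprMn tE exprMn ler_pM ?sqr_ge0.
have t2 : t ^+ 2 * mx <= 1 / 10.
  have n4 : 0 < n%:R ^+ 4 :> R by rewrite exprn_gt0.
  rewrite -(ler_pM2r n4).
  have e1 : t ^+ 2 * (3 / 4 * n%:R ^+ 2) ^+ 2 = 9 / 16 * (t ^+ 2 * n%:R ^+ 4) by field.
  have h1 : t ^+ 2 * n%:R ^+ 4 <= 16 / 225 * (n%:R * mx ^+ 2).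
    by move: t1; rewrite e1 exprMn; lra.
  have h2 : t ^+ 2 * n%:R ^+ 4 * mx <= 16 / 225 * (n%:R * mx ^+ 2) * mx by rewrite ler_pM2r.
  have h3 : n%:R * mx ^+ 2 * mx <= n%:R ^+ 4.
    have -> : n%:R * mx ^+ 2 * mx = n%:R * mx ^+ 3 by ring.
    rewrite [n%:R ^+ 4]exprS ler_pM2l // lerXn2r ?nnegrE ?(ltW m0) ?(ltW n0) //.
    by lra.
  rewrite mulrAC; apply: le_trans h2 _; rewrite -mulrA.
  by move: h3 n4; rewrite mulrA; lra.
have t3 : t ^+ 2 <= 1 / 10 / c.
  rewrite ler_pdivlMr //; apply: le_trans t2; by rewrite ler_wpM2l ?sqr_ge0.
have e2 : 9 / 10 * c^-1 <= c'^-1.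
  by rewrite ler_pdivrMr // [leRHS]mulrC ler_pdivlMr //; move: bal; lra.
by move: t3 e2; lra.
Qed.

End SpectralGap.

(** * From a perturbation bound to recovery *)

Section Recovery.
Context {R : realType} {n k : nat}.
Variable sigma : 'I_n -> 'I_k.+2.
Hypothesis sigma_surj : forall i : 'I_k.+2, exists j, sigma j = i.
Variables (p eta xi delta : R) (Rk : 'M[R]_(k.+2, k.+1)).
Hypotheses (p0 : 0 < p) (eta2 : 0 < 1 - 2 * eta).
Hypothesis bal : 9 / 10 * (nmax sigma)%:R <= (nmin sigma)%:R :> R.
Hypothesis RkV : is_Vsmall (Cbar sigma p eta) Rk.
Hypotheses (xi0 : 0 < xi) (delta0 : 0 < delta).
Hypothesis deltaP : delta ^+ 2 * (12 * (16 + 8 * xi) * k.+1%:R) < 1.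

Lemma clusters_le : (k.+1 < n)%N.
Proof.
rewrite -[k.+2]card_ord -[n]card_ord; pose f i := projT1 (cid (sigma_surj i)).
have fK : cancel f sigma by move=> i; exact: projT2 (cid (sigma_surj i)).
exact: leq_card (can_inj fK).
Qed.

Lemma recovery_of_perturbation (L : 'M[R]_n) eps : 0 <= eps ->
  eps <= delta * (1 - 2 * eta) / (2 * k.+2%:R) -> opb (L - Lbar sigma p eta) eps ->
  recovery_event sigma xi delta Rk L.
Proof.
move=> e0 ele hL V VL.
have n1 : 1 < n%:R :> R by rewrite ltr1n; have := clusters_le; lia.
have d0 : 0 < dbar n p by rewrite mulr_gt0 // subr_gt0.
have k1 : 1 <= k.+1%:R :> R by rewrite ler1n.
have k2 : 2 <= k.+2%:R :> R by rewrite ler_nat.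
have delta1 : delta < 1.
  have h : 192 <= 12 * (16 + 8 * xi) * k.+1%:R.
    by have : 0 <= xi * k.+1%:R by [rewrite mulr_ge0 // ltW]; lra.
  have : delta ^+ 2 < 1.
    have := ler_wpM2l (sqr_ge0 delta) h; have := sqr_ge0 delta; move: deltaP; lra.
  by rewrite expr_lt1 // ltW.
pose g := (1 - 2 * eta) / k.+2%:R.
have g0 : 0 < g by rewrite divr_gt0 //; lra.
have eg : eps <= delta * g / 2.
  apply: le_trans ele _; rewrite le_eqVlt; apply/orP; left; apply/eqP; rewrite /g.
  by field; rewrite gt_eqF //; lra.
have [lm LV lmle] := Lbar_eigen sigma_surj d0 p0 eta2 bal RkV.
have VbVb := TR_orth sigma_surj d0 p0 eta2 bal RkV.
have Lc := Lbar_compl sigma_surj d0 p0 eta2 bal RkV.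
set q0 := p / dbar n p * (1 - 2 * eta) in lmle Lc.
set mu1 := _ - _ in lmle; set mu2 := _ - _ in Lc.
(* The difference is 2 q0 (2 mn - mx) >= 8/5 q0 mx. Moreover n <= k mx and q0 n = (1 - 2 eta) n/(n -
   1), so q0 mx >= g. *)
have gap : 8 / 5 * g <= mu2 - mu1.
  have q0p : 0 < q0 by exact: q0_gt0.
  have h1 : mu2 - mu1 = 2 * q0 * (2 * (nmin sigma)%:R - (nmax sigma)%:R).
    by rewrite /mu1 /mu2; ring.
  have h2 : 8 / 5 * (q0 * (nmax sigma)%:R) <= mu2 - mu1.
    have : 4 / 5 * (nmax sigma)%:R <= 2 * (nmin sigma)%:R - (nmax sigma)%:R :> R.
      by move: bal; lra.
    by rewrite -(ler_pM2l q0p) h1; lra.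
  apply: le_trans h2; rewrite ler_pM2l; last by lra.
  rewrite /g ler_pdivrMr; last by lra.
  have h3 : q0 * n%:R <= q0 * (k.+2%:R * (nmax sigma)%:R).
    by rewrite ler_pM2l // n_le_mx.
  have h4 : 1 - 2 * eta <= q0 * n%:R.
    have -> : q0 * n%:R = (1 - 2 * eta) * (n%:R / (n%:R - 1)).
      by rewrite /q0 /dbar; field; rewrite !gt_eqF //; lra.
    by rewrite ler_peMr ?(ltW eta2) // ler_pdivlMr; lra.
  by apply: le_trans h4 _; apply: le_trans h3 _; rewrite mulrA mulrAC mulrC mulrA; lra.
have dk := davis_kahan clusters_le VL e0 hL VbVb LV lmle Lc.
have dg : delta * g < g by rewrite gtr_pMl.
have gap1 : mu1 + eps < mu2 by move: gap eg dg g0; lra.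
have {}dk := dk gap1.
set s := eps / _ in dk.
have s0 : 0 <= s by rewrite divr_ge0 //; move: gap eg; lra.
(* The denominator of s is at least 8/5 g - g/2 >= g, while eps <= delta g / 2. *)
have sle : s <= delta / 2.
  rewrite ler_pdivrMr; last by move: gap eg; lra.
  have : delta / 2 * g <= delta / 2 * (mu2 - eps - mu1).
    by rewrite ler_pM2l ?divr_gt0 //; move: gap eg; lra.
  by move: eg; lra.
have VV : V^T *m V = 1%:M.
  by have [qm [U [lam [UU _ _ ->]]]] := is_Vsmall_eig VL; exact: eigcols_orth.
have slt : s < 1 by move: sle delta1 delta0; lra.
have [Q [QQ hQ]] := davis_kahan_basis s0 slt VV VbVb dk.
(* This is half of the bound demanded by the event; the sharper value delta is what enters the
   k-means cost [f]. *)
have hQd : opb (V - Theta sigma *m Rk *m Q) delta by apply: opb_le hQ; move: sle; lra.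
exists Q; split=> //; split; first by apply: opnorm_le; apply: opb_le hQd; lra.
move=> Tt Rt km S Vt.
have TK : Theta sigma *m Rk *m Q = Thetahat sigma *m centers sigma Rk Q.
  by rewrite -mulmxA; exact: Theta_Thetahat.
pose f := k.+1%:R * delta ^+ 2.
have hf : frob2 (V - Thetahat sigma *m centers sigma Rk Q) <= f.
  by rewrite -TK; apply: frob2_opb => //; exact: ltW.
have fs : 96 * (2 + xi) * f < 1 by move: deltaP; rewrite /f; lra.
have f0 : 0 <= f by rewrite mulr_ge0 ?sqr_ge0.
have xf : 0 <= (2 + xi) * f by apply: mulr_ge0 f0; move: xi0; lra.
have bal' i i' : 9 / 10 * (csize sigma i')%:R <= (csize sigma i)%:R :> R.
  have /andP[? ?] := csize_itv (R := R) sigma i; have /andP[? ?] := csize_itv (R := R) sigma i'.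
  by move: bal; lra.
have [|s1 [s1P s1S]] := kmeans_recovery sigma_surj xi0
  (fun i i' => center_separation sigma_surj d0 p0 eta2 bal RkV (i := i) (i' := i') QQ) bal' hf _ km.
  by move: fs xf; lra.
exists s1; split=> [j /set_mem /= /existsP[i /andP[/eqP ji jS]]|].
  by apply: s1P; rewrite -TK ji.
rewrite /S TK; apply: le_trans s1S _; rewrite /f; move: xf; rewrite /f /=; lra.
Qed.

End Recovery.

(** * Thresholds and failure probabilities *)

Section Probability.
Context {R : realType}.
Local Notation K1 := (@normcst R).

Lemma ssbm_prob_ge0 n (p eta : R) (E : outcome n -> Prop) :
  0 <= p <= 1 -> 0 <= eta <= 1 -> 0 <= ssbm_prob p eta E.
Proof.
move=> p01 eta01; rewrite ssbm_probE; apply: sumr_ge0 => w _.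
by rewrite mulr_ge0 // wgt_ge0 //; exact: smu_ge0.
Qed.

(** The 44 is 22 * 2: n p <= 2 d gives N <= 2 K1 sqrt d in [Lgamma_perturb]. *)
Lemma ssbm_recovery n k (sigma : 'I_n -> 'I_k.+2) (p eta xi delta gp gm : R)
    (Rk : 'M[R]_(k.+2, k.+1)) :
  (forall i : 'I_k.+2, exists j, sigma j = i) ->
  0 < p <= 1 -> 0 <= eta < 1 / 2 ->
  9 / 10 * (nmax sigma)%:R <= (nmin sigma)%:R :> R ->
  is_Vsmall (Cbar sigma p eta) Rk -> 0 < xi -> 0 < delta ->
  delta ^+ 2 * (12 * (16 + 8 * xi) * k.+1%:R) < 1 ->
  0 <= gp -> 0 <= gm -> 1 <= n%:R * p ->
  44 * K1 / Num.sqrt (dbar n p) + 22 * (gp + gm) / dbar n p <=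
    delta * (1 - 2 * eta) / (2 * k.+2%:R) ->
  1 - 2 * (n%:R * expR (- (2 * (n%:R * p)))) - n%:R * expR (- (dbar n p / 4)) <=
    ssbm_prob p eta (fun w => recovery_event sigma xi delta Rk (Lgamma sigma gp gm w)).
Proof.
move=> surj /andP[p0 p1] /andP[e0 e1] bal RkV xi0 delta0 deltaP gp0 gm0 np1 small.
have p01 : 0 <= p <= 1 by rewrite (ltW p0).
have eta01 : 0 <= eta <= 1 by rewrite e0 /=; lra.
have eta2 : 0 < 1 - 2 * eta by lra.
have n2 : (2 <= n)%N by apply: leq_trans (clusters_le surj).
have n2' : 2 <= n%:R :> R by rewrite ler_nat.
have d0 : 0 < dbar n p by rewrite mulr_gt0 //; lra.
have npd : n%:R * p <= 2 * dbar n p by rewrite /dbar; nra.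
apply: (ssbm_good_event p01 eta01 np1) => w N NE hX hY hD.
have K10 : 0 <= K1 by have := @normcst_ge2 R; lra.
have N0 : 0 <= N by rewrite NE mulr_ge0 ?sqrtr_ge0.
have hL := @Lgamma_perturb R n k.+2 sigma p eta w gp gm N p0 eta01 n2 N0 gp0 gm0 hX hY hD.
apply: (recovery_of_perturbation surj p0 eta2 bal RkV xi0 delta0 deltaP) hL.
  by rewrite divr_ge0 ?(ltW d0) // mulr_ge0 // addr_ge0 // addr_ge0.
apply: le_trans small; set d := dbar n p in d0 npd *.
have sd : 0 < Num.sqrt d by rewrite sqrtr_gt0.
have NK : N <= K1 * (2 * Num.sqrt d).
  rewrite NE ler_wpM2l //.
  have -> : 2 * Num.sqrt d = Num.sqrt (2 ^+ 2 * d).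
    by rewrite [RHS]sqrtrM ?sqr_ge0 // sqrtr_sqr ger0_norm.
  by rewrite ler_sqrt; [move: npd d0; lra|rewrite mulr_ge0 ?sqr_ge0 // ltW].
rewrite mulrDr mulrDl lerD2r ler_pdivrMr //.
have -> : 44 * K1 / Num.sqrt d * d = 22 * (K1 * (2 * Num.sqrt d)).
  rewrite -{2}(sqr_sqrtr (ltW d0)); field; by rewrite gt_eqF.
by rewrite ler_pM2l.
Qed.

(** With x = n p, the three exponentials are at most exp(-x/8). One factor exp(-x/16) pays for the 3
    since x >= 32, the other is at most exp(-x/c). *)
Lemma tail_bound n (p c : R) : (2 <= n)%N -> 0 < p -> 16 <= c -> 32 <= n%:R * p ->
  2 * (n%:R * expR (- (2 * (n%:R * p)))) + n%:R * expR (- (dbar n p / 4)) <=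
  n%:R * expR (- (n%:R * p / c)).
Proof.
move=> n2 p0 c16 np; have n2' : 2 <= n%:R :> R by rewrite ler_nat.
have npd : n%:R * p <= 2 * dbar n p by rewrite /dbar; nra.
set x := n%:R * p in np npd *.
rewrite mulrCA -mulrDr ler_pM2l; last by lra.
have h1 : expR (- (2 * x)) <= expR (- (x / 8)) by rewrite ler_expR; lra.
have h2 : expR (- (dbar n p / 4)) <= expR (- (x / 8)) by rewrite ler_expR; lra.
have h3 : expR (- (x / 16)) <= expR (- (x / c)).
  by rewrite ler_expR lerN2 ler_pM2l ?lef_pV2 ?posrE //; lra.
have h4 : expR (- (x / 8)) = expR (- (x / 16)) * expR (- (x / 16)).
  by rewrite -expRD; congr expR; field.
have h5 : 3 * expR (- (x / 16)) <= 1.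
  rewrite expRN ler_pdivrMr ?expR_gt0 // mul1r.
  by apply: le_trans (expR_ge1Dx _); lra.
have h6 := expR_gt0 (- (x / 16)).
have h7 : 3 * expR (- (x / 16)) * expR (- (x / 16)) <= 1 * expR (- (x / 16)).
  by rewrite ler_pM2r.
by move: h1 h2 h3 h7; rewrite h4; lra.
Qed.

Lemma ln_ge1 n : (10 <= n)%N -> 1 <= ln n%:R :> R.
Proof.
move=> n10; have n10' : 10 <= n%:R :> R by rewrite ler_nat.
rewrite -[leLHS](expRK 1) ler_ln ?posrE ?expR_gt0 //; last by lra.
have h1 := expR_ge1Dx (- (1 / 2) : R).
have h2 : expR (1 / 2) * expR (- (1 / 2)) = 1 :> R by rewrite expRxMexpNx_1.
have h3 := expR_gt0 (1 / 2 : R).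
have e2 : expR (1 / 2) <= 2 :> R by nra.
have -> : 1 = 1 / 2 + 1 / 2 :> R by field.
by rewrite expRD; nra.
Qed.

(** [L] stands for ln n. Because L >= 8 K^2, the threshold T^2 L < x <= 2d yields 2 K T <= sqrt d,
    and the constant 42 in T makes the needed 44 K at most 84 K. *)
Lemma dense_threshold (k : nat) (d x L eta delta K : R) :
  0 < d -> x <= 2 * d -> 0 < 1 - 2 * eta -> 0 < delta -> 0 < K -> 8 * K ^+ 2 <= L ->
  (2 * 42 * k.+2%:R / (delta * (1 - 2 * eta))) ^+ 2 * L < x ->
  44 * K / Num.sqrt d <= delta * (1 - 2 * eta) / (2 * k.+2%:R).
Proof.
move=> d0 xd eta2 delta0 K0 KL; set e := delta * (1 - 2 * eta); set m := k.+2%:R.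
have e0 : 0 < e by rewrite mulr_gt0.
have m0 : 0 < m by rewrite ltr0n.
set T := 2 * 42 * m / e => h.
have T0 : 0 < T by rewrite divr_gt0 // !mulr_gt0.
have h1 : (2 * K * T) ^+ 2 <= d.
  have : T ^+ 2 * (8 * K ^+ 2) <= T ^+ 2 * L by rewrite ler_wpM2l ?sqr_ge0.
  have -> : (2 * K * T) ^+ 2 = T ^+ 2 * (8 * K ^+ 2) / 2 by field.
  by move: h xd; lra.
have sd : 0 < Num.sqrt d by rewrite sqrtr_gt0.
have h2 : 2 * K * T <= Num.sqrt d.
  have t0 : 0 <= 2 * K * T by rewrite mulr_ge0 ?(ltW T0) // mulr_ge0 // ltW.
  by rewrite -(ger0_norm t0) -sqrtr_sqr ler_sqrt // ltW.
rewrite ler_pdivrMr //.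
apply: (le_trans (y := e / (2 * m) * (2 * K * T))); last first.
  by rewrite ler_wpM2l // divr_ge0 ?mulr_ge0 ?(ltW e0) // ltW.
have -> : e / (2 * m) * (2 * K * T) = 84 * K by rewrite /T; field; rewrite !gt_eqF.
by lra.
Qed.

(** In terms of y = d^(1/8), sqrt d = y^4 and g = y^7, so both errors are of order 1/y. The eighth
    power in the threshold says exactly that T <= y, and 128 K r^2 + 1 >= 44 K + 22. *)
Lemma sparse_threshold (k : nat) (d x g r eta delta K : R) :
  1 <= d -> x <= 2 * d -> 0 < 1 - 2 * eta -> 0 < delta -> 1 <= K -> 1 <= r ->
  (2 * k.+2%:R * (128 * K * r ^+ 2 + 1) / (delta * (1 - 2 * eta))) ^+ 8 * 2 < x ->
  g = d `^ (7 / 8) ->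
  44 * K / Num.sqrt d + 22 * g / d <= delta * (1 - 2 * eta) / (2 * k.+2%:R).
Proof.
move=> d1 xd eta2 delta0 K1 r1; set e := delta * (1 - 2 * eta); set m := k.+2%:R.
have e0 : 0 < e by rewrite mulr_gt0.
have m0 : 0 < m by rewrite ltr0n.
have d0 : 0 < d by lra.
set T := 2 * m * _ / e => h gE.
pose y := d `^ (1 / 8).
have y0 : 0 < y by rewrite powR_gt0.
have yn j : y ^+ j = d `^ (j%:R / 8) by rewrite -powR_mulrn ?ltW // -powRrM mulrC mul1r.
have y8 : y ^+ 8 = d by rewrite yn divff // powRr1 // ltW.
have y4 : Num.sqrt d = y ^+ 4.
  by rewrite -y8 (_ : 8 = 4 * 2)%N // exprM sqrtr_sqr ger0_norm // exprn_ge0 // ltW.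
have g7 : g = y ^+ 7 by rewrite gE yn.
have y1 : 1 <= y by rewrite -(@expr_ge1 _ 8) ?(ltW y0) // y8.
have T0 : 0 < T by rewrite divr_gt0 // mulr_gt0 ?mulr_gt0 // ltr_pwDr // !mulr_ge0 ?sqr_ge0 //; lra.
have yT : T <= y.
  by rewrite -(@ler_pXn2r _ 8) ?nnegrE ?(ltW T0) ?(ltW y0) // y8; move: h xd; lra.
have e1 : 22 * g / d = 22 / y.
  by rewrite g7 -y8; field; rewrite gt_eqF.
have e2 : 44 * K / Num.sqrt d <= 44 * K / y.
  rewrite y4 ler_pM2l; last by lra.
  rewrite lef_pV2 ?posrE ?exprn_gt0 // -{1}[y]expr1 ler_weXn2l //.
apply: (le_trans (y := (44 * K + 22) / y)); first by rewrite e1 [leRHS]mulrDl lerD2r.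
rewrite ler_pdivrMr //.
apply: (le_trans (y := e / (2 * m) * T)); last first.
  by rewrite ler_wpM2l // divr_ge0 ?mulr_ge0 ?(ltW e0) // ltW.
have -> : e / (2 * m) * T = 128 * K * r ^+ 2 + 1 by rewrite /T; field; rewrite !gt_eqF.
have : 1 <= r ^+ 2 by rewrite expr2; nra.
by nra.
Qed.

End Probability.


Theorem mainTheorem7 (R : realType) :
  exists C0 C c : R, 0 < C0 < 43 /\ 1 < C /\ 0 < c /\
  forall (n k : nat) (sigma : 'I_n -> 'I_k) (p eta xi delta : R)
         (Rk : 'M[R]_(k, k.-1)),
    (2 <= k)%N -> (10 <= n)%N ->
    (forall i : 'I_k, exists j, sigma j = i) ->
    0 < p <= 1 -> 0 <= eta < 1 / 2 ->
    1 - (4 * k%:R * (2 + Num.sqrt k%:R))^-1 < Num.sqrt (@rho R n k sigma) ->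
    0 < xi ->
    0 < delta < Num.sqrt ((12 * (16 + 8 * xi) * (k.-1)%:R)^-1) ->
    is_Vsmall (Cbar sigma p eta) Rk ->
    ((* dense case *)
     ((2 * C0 * k%:R / (delta * (1 - 2 * eta))) ^+ 2 * ln n%:R / n%:R < p ->
      1 - 2 / n%:R - n%:R * expR (- (n%:R * p / c))
        <= ssbm_prob p eta (fun w => recovery_event sigma xi delta Rk (Lsym sigma w)))
    /\
     (* sparse case *)
     (forall r gp gm : R,
      1 <= r ->
      (2 * k%:R * (128 * C * r ^+ 2 + 1) / (delta * (1 - 2 * eta))) ^+ 8 * (2 / n%:R) < p ->
      0 <= gp -> 0 <= gm -> gp + gm = dbar n p `^ (7 / 8) ->
      1 - 7 * expR (- (2 * r)) - 2 / n%:R - n%:R * expR (- (n%:R * p / c))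
        <= ssbm_prob p eta
             (fun w => recovery_event sigma xi delta Rk (Lgamma sigma gp gm w)))).
Proof.
have K2 := @normcst_ge2 R; set K := @normcst R in K2 *.
(* For this [c] either [n exp (- n p / c) >= 1] and the claim is void, or
   [n p > c ln n], which also forces [ln n >= ln c = 8 K^2]. *)
pose c : R := expR (8 * K ^+ 2).
have c33 : 33 <= c by apply: le_trans (expR_ge1Dx _); rewrite expr2; nra.
exists 42, K, c; split; first by apply/andP; split; lra.
split; first by lra.
split; first by lra.
move=> n k sigma p eta xi delta Rk.
case: k sigma Rk => [//|[//|k]] sigma Rk _ n10 surj p01 eta01 hrho xi0 /andP[delta0 hdelta] RkV.
have bal := balanced surj isT hrho.
have /andP[p0 p1] := p01; have /andP[eta0 eta1] := eta01.
have eta2 : 0 < 1 - 2 * eta by lra.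
have n10' : 10 <= n%:R :> R by rewrite ler_nat.
have n0 : 0 < n%:R :> R by lra.
have npd : n%:R * p <= 2 * dbar n p by rewrite /dbar; nra.
have deltaP : delta ^+ 2 * (12 * (16 + 8 * xi) * k.+1%:R) < 1.
  have M0 : 0 < 12 * (16 + 8 * xi) * k.+1%:R :> R.
    by rewrite !mulr_gt0 ?ltr0n //; lra.
  rewrite -ltr_pdivlMr // div1r -[X in _ < X]sqr_sqrtr ?invr_ge0 ?(ltW M0) //.
  by rewrite ltr_sqr ?nnegrE ?sqrtr_ge0 ?(ltW delta0).
have inv0 : 0 <= 2 / n%:R :> R by rewrite divr_ge0.
have bound (gp gm : R) : 0 <= gp -> 0 <= gm ->
    (c * ln n%:R < n%:R * p -> 44 * K / Num.sqrt (dbar n p) + 22 * (gp + gm) / dbar n p <=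
       delta * (1 - 2 * eta) / (2 * k.+2%:R)) ->
    1 - 2 / n%:R - n%:R * expR (- (n%:R * p / c)) <=
    ssbm_prob p eta (fun w => recovery_event sigma xi delta Rk (Lgamma sigma gp gm w)).
  move=> gp0 gm0 small; have [big|lt1] := leP 1 (n%:R * expR (- (n%:R * p / c))).
    apply: (le_trans (y := 0)); first by move: big inv0; lra.
    by apply: ssbm_prob_ge0; apply/andP; split; lra.
  have c0 : 0 < c by lra.
  have large : c * ln n%:R < n%:R * p.
    rewrite mulrC -ltr_pdivlMr // -[ltRHS]expRK ltr_ln ?posrE ?expR_gt0 //.
    by move: lt1; rewrite expRN ltr_pdivrMr ?expR_gt0 // mul1r.
  have ln1 := ln_ge1 (R := R) n10.
  have np : 33 <= n%:R * p by nra.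
  have np1 : 1 <= n%:R * p by lra.
  have := ssbm_recovery surj p01 eta01 bal RkV xi0 delta0 deltaP gp0 gm0 np1 (small large).
  have c16 : 16 <= c by lra.
  have np32 : 32 <= n%:R * p by lra.
  have n2 : (2 <= n)%N by apply: leq_trans n10.
  have := tail_bound n2 p0 c16 np32.
  by move: inv0; lra.
split.
  rewrite ltr_pdivrMr // [p * _]mulrC => hd.
  have -> : (fun w => recovery_event sigma xi delta Rk (Lsym sigma w)) =
     (fun w => recovery_event sigma xi delta Rk (Lgamma sigma 0 0 w)).
    by apply/funext => w; rewrite LsymE.
  apply: bound => // large; rewrite !addr0 mulr0 mul0r addr0.
  have ln1 := ln_ge1 (R := R) n10.
  have d0 : 0 < dbar n p by rewrite mulr_gt0 //; lra.
  apply: (dense_threshold d0 npd eta2 delta0 _ _ hd); first by lra.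
  (* As ln n >= 1, one has c <= c ln n < n p <= n; logarithms give 8 K^2 <= ln n. *)
  rewrite -[leLHS]expRK ler_ln ?posrE ?expR_gt0 // -/c.
  have : n%:R * p <= n%:R by rewrite ler_piMr // ltW.
  by move: large; nra.
move=> r gp gm r1; rewrite mulrA ltr_pdivrMr // [p * _]mulrC => hs gp0 gm0 gE.
have h7 := expR_ge0 (- (2 * r)).
apply: (le_trans (y := 1 - 2 / n%:R - n%:R * expR (- (n%:R * p / c)))); first by lra.
apply: bound => // large; have ln1 := ln_ge1 (R := R) n10.
have d1 : 1 <= dbar n p by move: npd large; nra.
by apply: (sparse_threshold d1 npd eta2 delta0 _ r1 hs gE); lra.
Qed.
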